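(* Let $\mathfrak g\in\{\mathfrak{sl}_\infty(\mathbb C),\mathfrak{so}_\infty(\mathbb C),\mathfrak{sp}_\infty(\mathbb C)\}$ with root system $\Phi\in\{A_\infty,B_\infty,C_\infty,D_\infty\}$ relative to the splitting Cartan subalgebra $\mathfrak h$, let $\prec$ be an admissible linear order (see context), let $\mathfrak n=\bigoplus_{\alpha\in\Phi^+}\mathfrak g^\alpha$ be the corresponding locally nilpotent radical, and let $\mathcal B$ be the Kostant cascade of $\mathfrak n$ (possibly empty, finite or infinite). If $\Phi=A_\infty$ or $C_\infty$, then the center $Z(\mathfrak n)$ of $U(\mathfrak n)$ is generated as an algebra by the elements $\Delta_q$, $1\le q\le|\mathcal B|$; if $\Phi=B_\infty$ or $D_\infty$, then $Z(\mathfrak n)$ is generated by the elements $P_q$, $1\le q\le |\mathcal B|$. These generators are algebraically independent, so $Z(\mathfrak n)$ is a polynomial ring in $|\mathcal B|$ variables (and $Z(\mathfrak n)=\mathbb C$ if $\mathcal B=\emptyset$).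
   Context: Notation: $\mathfrak g=\bigcup_n\mathfrak g_n$ is a union of simple Lie algebras of rank $n$ of one fixed classical type, $\mathfrak h=\bigcup\mathfrak h_n$ a nested union of Cartan subalgebras (splitting Cartan subalgebra), $\mathfrak g=\mathfrak h\oplus\bigoplus_{\alpha\in\Phi}\mathfrak g^\alpha$. The root systems are $A_\infty=\pm\{\epsilon_i-\epsilon_j: i<j\}$, $B_\infty=A_\infty\cup\pm\{\epsilon_i+\epsilon_j:i<j\}\cup\pm\{\epsilon_i\}$, $C_\infty=A_\infty\cup\pm\{\epsilon_i+\epsilon_j:i<j\}\cup\pm\{2\epsilon_i\}$, $D_\infty=A_\infty\cup\pm\{\epsilon_i+\epsilon_j:i<j\}$, indices in $\mathbb Z_{>0}$. Admissible orders: for $A_\infty$, any linear order $\prec$ on $\{\epsilon_i\}$; for $B_\infty,C_\infty$, any linear order on $\{0\}\cup\{\pm\epsilon_i\}$ reversed by multiplication by $-1$; for $D_\infty$, such an order with the extra property that a minimal positive element, if it exists, is some $\epsilon_i$. Put $\vartheta_i=\epsilon_i$ if $\epsilon_i\succ0$ (and always for $A_\infty$) and $\vartheta_i=-\epsilon_i$ if $\epsilon_i\prec0$. Positive roots: $A_\infty^+=\{\vartheta_i-\vartheta_j:\vartheta_i\succ\vartheta_j\}$; $B^+_\infty$, $C^+_\infty$, $D^+_\infty$ consist of $\vartheta_i\pm\vartheta_j$ ($\vartheta_i\succ\vartheta_j$) together with $\vartheta_i$ (for $B$), $2\vartheta_i$ (for $C$), nothing more (for $D$). $\mathfrak n=\bigoplus_{\alpha\in\Phi^+}\mathfrak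 g^\alpha$. Kostant cascade: $\mathcal N_0=\emptyset$ and for $k\ge1$: for $A_\infty$, $\mathcal N_k=\mathcal N_{k-1}\cup\{i,j\}$ if the set $\{\vartheta_s:s\notin\mathcal N_{k-1}\}$ has a maximal element $\vartheta_i$ and a minimal element $\vartheta_j$; for $C_\infty$, $\mathcal N_k=\mathcal N_{k-1}\cup\{i\}$ if $\{\vartheta_s:s\notin\mathcal N_{k-1}\}$ has a maximal element $\vartheta_i$; for $B_\infty,D_\infty$, $\mathcal N_k=\mathcal N_{k-1}\cup\{i,j\}$ if $\{\vartheta_s:s\notin\mathcal N_{k-1}\}$ has a maximal element $\vartheta_i$ and $\{\vartheta_s:s\notin\mathcal N_{k-1}\cup\{i\}\}$ has a maximal element $\vartheta_j$; otherwise $\mathcal N_k=\mathcal N_{k-1}$. Whenever $\mathcal N_{k-1}\subsetneq\mathcal N_k$ set $\beta_k=\vartheta_i-\vartheta_j$ ($A_\infty$, $\vartheta_i\succ\vartheta_j$), $\beta_k=\vartheta_i+\vartheta_j$ ($B_\infty,D_\infty$), $\beta_k=2\vartheta_i$ ($C_\infty$); $\mathcal B$ is the set of all such $\beta_k$. Root vectors: for the finite-dimensional $\mathfrak n_n$ (strictly upper triangular matrices in $\mathfrak{sl}_n$, $\mathfrak{so}_{2n+1}$, $\mathfrak{sp}_{2n}$, $\mathfrak{so}_{2n}$ in the standard realization with basis $e_1,\dots,e_n,(e_0),e_{-n},\dots,e_{-1}$) use $e_{\epsilon_i-\epsilon_j}=E_{ij}$ (type A), $e_{\epsilon_i-\epsilon_j}=E_{ij}-E_{-j,-i}$,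 $e_{\epsilon_i+\epsilon_j}=E_{i,-j}-E_{j,-i}$ (types B, D), $e_{\epsilon_i+\epsilon_j}=E_{i,-j}+E_{j,-i}$, $e_{2\epsilon_i}=E_{i,-i}$ (type C), with $E_{ab}$ elementary matrices. For a finite $M=\{a_1,\dots,a_n\}\subset\mathbb Z_{>0}$ with $\vartheta_{a_1}\succ\dots\succ\vartheta_{a_n}$ let $j_M$ send $\epsilon_r\mapsto\vartheta_{a_r}$ and $\mathfrak n_M=\bigoplus\{\mathfrak g^\alpha:\alpha\in\Phi^+\cap\mathrm{span}(\epsilon_i,i\in M)\}$. Root vectors $f_\alpha\in\mathfrak g^\alpha$ ($\alpha\in\Phi^+$) are fixed so that for every finite $M$ the map $e_\alpha\mapsto f_{j_M(\alpha)}$ is a Lie algebra isomorphism $\mathfrak n_{|M|}\to\mathfrak n_M$. Generators: for $q\le|\mathcal B|$: (A) write $\mathcal N_q=\{i_1,\dots,i_q,j_1,\dots,j_q\}$ with $\vartheta_{i_1}\succ\dots\succ\vartheta_{i_q}\succ\vartheta_{j_q}\succ\dots\succ\vartheta_{j_1}$ and set $\Delta_q=\det\big(f_{\vartheta_{i_r}-\vartheta_{j_{q+1-s}}}\big)_{r,s=1}^q$; (C) write $\mathcal N_q=\{i_1,\dots,i_q\}$, $\vartheta_{i_1}\succ\dots\succ\vartheta_{i_q}$, and $\Delta_q=\det(x_{rs})_{r,s=1}^q$ with $x_{rs}=f_{\vartheta_{i_r}+\vartheta_{i_{q+1-s}}}$ if $r\ne q+1-s$ and $x_{rs}=2f_{2\vartheta_{i_r}}$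 if $r=q+1-s$; (B, D) write $\mathcal N_q=\{a_1,\dots,a_{2q}\}$ with $\vartheta_{a_1}\succ\dots\succ\vartheta_{a_{2q}}$ and let $P_q$ be the Pfaffian of the skew-symmetric $2q\times 2q$ matrix with $(r,s)$ entry $f_{\vartheta_{a_r}+\vartheta_{a_s}}$ for $r<s$ (so the monomial $f_{\vartheta_{a_1}+\vartheta_{a_2}}\cdots f_{\vartheta_{a_{2q-1}}+\vartheta_{a_{2q}}}$ has coefficient $1$). All entries in each of these expressions commute in $U(\mathfrak n)$, so they are well-defined elements of $U(\mathfrak n)$. *)

(* Defs.v *)
From mathcomp Require Import all_boot all_algebra all_fingroup.
From mathcomp Require Import reals.
From mathcomp Require Import complex.
From mathcomp Require Import mpoly.
Set Implicit Arguments. Unset Strict Implicit. Unset Printing Implicit Defensive.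
Import GRing.Theory.
Local Open Scope ring_scope.

Inductive ctype := TA | TB | TC | TD.
Definition ctype_eqb (a b : ctype) : bool :=
  match a, b with TA,TA | TB,TB | TC,TC | TD,TD => true | _,_ => false end.

(* Elements of {0} ∪ {±ε_i}: None = 0, Some (true,i) = ε_i,
   Some (false,i) = -ε_i.  Index i : nat stands for the paper's i+1. *)
Definition sel := option (bool * nat).
Definition eps (i : nat) : sel := Some (true, i).
Definition sneg (x : sel) : sel :=
  match x with None => None | Some (b, i) => Some (~~ b, i) end.

Definition strict_total (P : sel -> Prop) (prec : rel sel) : Prop :=
  (forall x, P x -> ~~ prec x x) /\
  (forall x y z, P x -> P y -> P z -> prec x y -> prec y z -> prec x z) /\
  (forall x y, P x -> P y -> x <> y -> prec x y \/ prec y x).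

(* Admissible orders.  For A_infty only the restriction of prec to the
   ε_i matters. *)
Definition admissible (t : ctype) (prec : rel sel) : Prop :=
  match t with
  | TA => strict_total (fun x => exists i, x = eps i) prec
  | TB | TC => strict_total (fun _ => True) prec /\
               (forall x y, prec x y = prec (sneg y) (sneg x))
  | TD => (strict_total (fun _ => True) prec /\
           (forall x y, prec x y = prec (sneg y) (sneg x))) /\
          (forall x, prec None x ->
             (forall y, prec None y -> y <> x -> prec x y) ->
             exists i, x = eps i)
  end.

Definition theta (t : ctype) (prec : rel sel) (i : nat) : sel :=
  match t with
  | TA => eps i
  | _ => if prec None (eps i) then eps i else sneg (eps i)
  end.

Definition gtth (t : ctype) (prec : rel sel) (i j : nat) : bool :=
  prec (theta t prec j) (theta t prec i).

Section Cascade.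
Variables (t : ctype) (prec : rel sel).

Definition is_max (S : nat -> Prop) (i : nat) : Prop :=
  ~ S i /\ forall s, ~ S s -> s <> i -> gtth t prec i s.
Definition is_min (S : nat -> Prop) (j : nat) : Prop :=
  ~ S j /\ forall s, ~ S s -> s <> j -> gtth t prec s j.

Definition cstep (S : nat -> Prop) : nat -> Prop := fun x =>
  S x \/
  match t with
  | TA => exists i j, is_max S i /\ is_min S j /\ (x = i \/ x = j)
  | TC => exists i, is_max S i /\ x = i
  | TB | TD => exists i j, is_max S i /\
                 is_max (fun s => S s \/ s = i) j /\ (x = i \/ x = j)
  end.

Definition Nset (k : nat) : nat -> Prop := iter k cstep (fun _ => False).

(* N_{k-1} ⊊ N_k, i.e. β_k is defined *)
Definition grows (k : nat) : Prop :=
  exists x, Nset k x /\ ~ Nset k.-1 x.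

(* q <= |B| *)
Definition cascade_ge (q : nat) : Prop :=
  forall k, (0 < k <= q)%N -> grows k.
End Cascade.

Inductive proot :=
  | PM of nat & nat   (* ϑ_i - ϑ_j,  ϑ_i ≻ ϑ_j *)
  | PP of nat & nat   (* ϑ_i + ϑ_j,  ϑ_i ≻ ϑ_j  (B, C, D) *)
  | PS of nat         (* ϑ_i  (B) *)
  | PL of nat.        (* 2ϑ_i (C) *)

Definition valid (t : ctype) (prec : rel sel) (r : proot) : bool :=
  match r with
  | PM i j => gtth t prec i j
  | PP i j => ~~ ctype_eqb t TA && gtth t prec i j
  | PS _ => ctype_eqb t TB
  | PL _ => ctype_eqb t TC
  end.

(* Finitary matrices as finite lists of (coefficient, row, column);
   the basis vector labelled Some(true,i) has weight ϑ_i, Some(false,i)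
   weight -ϑ_i, None weight 0.  For a finite M this is the standard
   realization transported along j_M. *)
Section Mat.
Variable F : fieldType.
Definition fmat := seq (F * sel * sel).
Definition mentry (L : fmat) (x y : sel) : F :=
  \sum_(e <- L) (if (e.1.2 == x) && (e.2 == y) then e.1.1 else 0).
Definition mmul (L1 L2 : fmat) : fmat :=
  flatten [seq [seq (e1.1.1 * e2.1.1, e1.1.2, e2.2) | e2 <- L2 & e1.2 == e2.1.2]
          | e1 <- L1].

Definition P (i : nat) : sel := Some (true, i).
Definition N (i : nat) : sel := Some (false, i).

Definition rmat (t : ctype) (r : proot) : fmat :=
  match r with
  | PM i j => if ctype_eqb t TA then [:: (1, P i, P j)]
              else [:: (1, P i, P j); (-1, N j, N i)]
  | PP i j => if ctype_eqb t TC then [:: (1, P i, N j); (1, P j, N i)]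
              else [:: (1, P i, N j); (-1, P j, N i)]
  | PS i => [:: (1, P i, None); (-1, None, N i)]
  | PL i => [:: (1, P i, N i)]
  end.
End Mat.

(* U(n) presented by generators f_α and relations                       *)
Inductive term (F : Type) :=
  | Tc of F
  | Tg of proot
  | Tadd of term F & term F
  | Tmul of term F & term F.
Arguments Tg {F}.

Section Enveloping.
Variables (F : fieldType) (t : ctype) (prec : rel sel).

Definition tscale (c : F) (a : term F) := Tmul (Tc c) a.
Definition tsum (s : seq (term F)) := foldr (@Tadd F) (Tc 0) s.
Definition tprod (s : seq (term F)) := foldr (@Tmul F) (Tc 1) s.
Definition tpow (a : term F) (n : nat) := iter n (Tmul a) (Tc 1).

(* equality in U(n): the congruence of unital associative F-algebras
   generated by the defining relations of U(n) *)
Inductive equ : term F -> term F -> Prop :=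
  | eq_refl a : equ a a
  | eq_sym a b : equ a b -> equ b a
  | eq_trans a b c : equ a b -> equ b c -> equ a c
  | eq_add a a' b b' : equ a a' -> equ b b' -> equ (Tadd a b) (Tadd a' b')
  | eq_mul a a' b b' : equ a a' -> equ b b' -> equ (Tmul a b) (Tmul a' b')
  | eq_addA a b c : equ (Tadd a (Tadd b c)) (Tadd (Tadd a b) c)
  | eq_addC a b : equ (Tadd a b) (Tadd b a)
  | eq_add0 a : equ (Tadd (Tc 0) a) a
  | eq_addN a : equ (Tadd a (Tmul (Tc (-1)) a)) (Tc 0)
  | eq_mulA a b c : equ (Tmul a (Tmul b c)) (Tmul (Tmul a b) c)
  | eq_mul1l a : equ (Tmul (Tc 1) a) a
  | eq_mul1r a : equ (Tmul a (Tc 1)) a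
  | eq_mulDl a b c : equ (Tmul (Tadd a b) c) (Tadd (Tmul a c) (Tmul b c))
  | eq_mulDr a b c : equ (Tmul a (Tadd b c)) (Tadd (Tmul a b) (Tmul a c))
  | eq_cadd c d : equ (Tc (c + d)) (Tadd (Tc c) (Tc d))
  | eq_cmul c d : equ (Tc (c * d)) (Tmul (Tc c) (Tc d))
  | eq_ccomm c a : equ (Tmul (Tc c) a) (Tmul a (Tc c))
  (* only the f_α with α ∈ Φ^+ are generators *)
  | eq_invalid r : ~~ valid t prec r -> equ (Tg r) (Tc 0)
  (* f_α f_β - f_β f_α = [f_α, f_β] in n *)
  | eq_lie r s (L : seq (F * proot)) :
      valid t prec r -> valid t prec s ->
      all (fun e => valid t prec e.2) L ->
      (forall x y, mentry (mmul (rmat F t r) (rmat F t s)) x y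
                   - mentry (mmul (rmat F t s) (rmat F t r)) x y
                   = \sum_(e <- L) e.1 * mentry (rmat F t e.2) x y) ->
      equ (Tadd (Tmul (Tg r) (Tg s)) (tscale (-1) (Tmul (Tg s) (Tg r))))
          (tsum [seq tscale e.1 (Tg e.2) | e <- L]).

Definition central (z : term F) : Prop :=
  forall u, equ (Tmul z u) (Tmul u z).

Definition ueval (k : nat) (p : {mpoly F[k]}) (g : 'I_k -> term F) : term F :=
  tsum [seq tscale p@_m (tprod [seq tpow (g i) (m i) | i <- enum 'I_k])
       | m <- msupp p].

(* determinant and Pfaffian of matrices with (commuting) entries in U(n) *)
Definition tdet (q : nat) (x : 'I_q -> 'I_q -> term F) : term F :=
  tsum [seq tscale ((-1) ^+ odd_perm s) (tprod [seq x i (s i) | i <- enum 'I_q])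
       | s <- enum [set: 'S_q]].

Lemma ord_dbl_lt (q : nat) (j : 'I_q) : (j.*2 < q.*2)%N.
Proof. by rewrite ltn_double. Qed.
Lemma ord_dbl1_lt (q : nat) (j : 'I_q) : (j.*2.+1 < q.*2)%N.
Proof. by rewrite -doubleS leq_double. Qed.
Definition odbl q (j : 'I_q) : 'I_q.*2 := Ordinal (ord_dbl_lt j).
Definition odbl1 q (j : 'I_q) : 'I_q.*2 := Ordinal (ord_dbl1_lt j).

Definition tpf (q : nat) (x : 'I_q.*2 -> 'I_q.*2 -> term F) : term F :=
  tscale ((2 ^ q * q`!)%:R)^-1
    (tsum [seq tscale ((-1) ^+ odd_perm s)
                 (tprod [seq x (s (odbl i)) (s (odbl1 i)) | i <- enum 'I_q])
          | s <- enum [set: 'S_q.*2]]).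

Definition fplus (i j : nat) : proot :=
  if gtth t prec i j then PP i j else PP j i.

(* a : decreasing enumeration (a 0, ..., a (n-1)) of N_q *)
Definition Delta_A (q : nat) (a : nat -> nat) : term F :=
  tdet (fun r s : 'I_q => Tg (PM (a r) (a (q + s)%N))).
Definition Delta_C (q : nat) (a : nat -> nat) : term F :=
  tdet (fun r s : 'I_q =>
          if (r + s == q.-1)%N then tscale 2 (Tg (PL (a r)))
          else Tg (fplus (a r) (a (q.-1 - s)%N))).
Definition Pf_BD (q : nat) (a : nat -> nat) : term F :=
  tpf (fun r s : 'I_q.*2 =>
         if (r < s)%N then Tg (PP (a r) (a s))
         else if (s < r)%N then tscale (-1) (Tg (PP (a s) (a r)))
         else Tc 0).

Definition dec_listing (n : nat) (S : nat -> Prop) (a : nat -> nat) : Prop :=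
  (forall r s, (r < s < n)%N -> gtth t prec (a r) (a s)) /\
  (forall x, S x <-> exists2 r, (r < n)%N & a r = x).

Definition is_generator (q : nat) (G : term F) : Prop :=
  exists a : nat -> nat,
    match t with
    | TA => dec_listing q.*2 (Nset t prec q) a /\ G = Delta_A q a
    | TC => dec_listing q (Nset t prec q) a /\ G = Delta_C q a
    | TB | TD => dec_listing q.*2 (Nset t prec q) a /\ G = Pf_BD q a
    end.
End Enveloping.

(* Main.v *)
Require Import Defs.
From HB Require Import structures.
From mathcomp Require Import reals complex mpoly.
From mathcomp Require Import boolp functions ring zify.
From mathcomp Require Import all_boot all_algebra all_fingroup.
Import GRing.Theory Num.Theory.
Local Open Scope ring_scope.
Set Implicit Arguments. Unset Strict Implicit. Unset Printing Implicit Defensive.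

(** The symbol of a central element of degree d is a polynomial function on the
    dual of n that is annihilated by the coadjoint vector fields; it is well defined
    because matrix coefficients of tensor powers of the natural representation read
    it off.  Only finitely many indices occur in it, and bracketing with root vectors
    that involve a fresh index shows that it depends only on the f_{i-j} (type A) or
    the f_{i+j}, f_{2i} (types B, C, D) with i in a finite initial segment of the
    order (and j in a finite final segment in type A).  These root vectors commute,
    and the symbol becomes a polynomial function of a rectangular, symmetric or
    skew-symmetric matrix that is invariant under unipotent row and column operations.
    By elimination such a function is determined by its values on (block) diagonal
    matrices; moving along a 2x2 (4x4) block shows that the exponents of these
    values decrease, so that they are polynomials in the leading minors (Pfaffians).
    Subtracting the corresponding polynomial in the generators lowers the degree. *)

(** * Polynomial functions *)

Section OrdExtension.
Variables (T : Type) (x0 : T) (k : nat) (y : 'I_k -> T).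

Definition ord_ext (j : nat) : T := oapp y x0 (insub j).

Lemma ord_extE (i : 'I_k) : ord_ext i = y i.
Proof. by rewrite /ord_ext valK. Qed.

Lemma ord_ext_ind (P : T -> Prop) :
  P x0 -> (forall i, P (y i)) -> forall j, P (ord_ext j).
Proof. by move=> P0 Py j; rewrite /ord_ext; case: insubP => [i _ _|_] /=. Qed.
End OrdExtension.

Section PolynomialFunctions.
Variable F : numDomainType.

Lemma poly_fun_eq0 (p : {poly F}) : (forall x, x != 0 -> p.[x] = 0) -> p = 0.
Proof.
move=> p_eq0; apply/eqP/negPn/negP => p_neq0.
pose rs : seq F := [seq i.+1%:R | i <- iota 0 (size p)].
have : (size rs < size p)%N.
  apply: max_poly_roots p_neq0 _ _.
    by apply/allP => _ /mapP [i _ ->]; rewrite /root p_eq0 ?pnatr_eq0.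
  by rewrite map_inj_uniq ?iota_uniq // => i j /eqP; rewrite eqr_nat => /eqP [].
by rewrite size_map size_iota ltnn.
Qed.

Lemma deriv_eq0_const (p : {poly F}) :
  (forall x, p^`().[x] = 0) -> forall x y, p.[x] = p.[y].
Proof.
move=> dp_fun0; have dp0 : p^`() = 0 by apply: poly_fun_eq0.
suff -> : p = (p`_0)%:P by move=> x y; rewrite !hornerC.
apply/polyP => -[|i]; rewrite coefC //=; apply/eqP.
have := congr1 (fun r : {poly F} => r`_i) dp0.
by rewrite coef_deriv coef0 => /eqP; rewrite mulrn_eq0.
Qed.
End PolynomialFunctions.

Section KroneckerSubstitution.
Variable k : nat.
Implicit Types m : 'X_{1..k}.

Definition kronecker_exp B m : nat := \sum_(i < k) m i * B ^ i.

Lemma base_expansion_inj B n (a b : nat -> nat) :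
  (forall i, i < n -> a i < B)%N -> (forall i, i < n -> b i < B)%N ->
  (\sum_(i < n) a i * B ^ i = \sum_(i < n) b i * B ^ i)%N ->
  forall i, (i < n)%N -> a i = b i.
Proof.
elim: n a b => [|n IHn] a b aB bB //.
have sum_recl (c : nat -> nat) :
    (\sum_(i < n.+1) c i * B ^ i = (\sum_(i < n) c i.+1 * B ^ i) * B + c 0)%N.
  rewrite big_ord_recl /= expn0 muln1 big_distrl addnC; congr (_ + _)%N.
  by apply: eq_bigr => i _; rewrite expnSr mulnA.
rewrite !sum_recl => eq_ab; have ab0 : a 0%N = b 0%N.
  by have := congr1 (modn^~ B) eq_ab; rewrite /= !modnMDl !modn_small ?aB ?bB.
case=> [//|i] lt_in; apply: (IHn (a \o succn) (b \o succn)) => //= [j|j|].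
- exact: (aB j.+1).
- exact: (bB j.+1).
- have B_gt0 : (0 < B)%N by apply: leq_ltn_trans (aB 0%N isT).
  by move: eq_ab; rewrite ab0 => /addIn/eqP; rewrite eqn_pmul2r // => /eqP.
Qed.

Lemma kronecker_exp_inj B m1 m2 :
  (forall i, m1 i < B)%N -> (forall i, m2 i < B)%N ->
  kronecker_exp B m1 = kronecker_exp B m2 -> m1 = m2.
Proof.
move=> m1B m2B eq_m; apply/mnmP => i; rewrite !(mnm_nth 0%N).
apply: (@base_expansion_inj B k (nth 0%N m1) (nth 0%N m2)) => //.
- by move=> j ltjk; have := m1B (Ordinal ltjk); rewrite (mnm_nth 0%N).
- by move=> j ltjk; have := m2B (Ordinal ltjk); rewrite (mnm_nth 0%N).
- by under eq_bigr do rewrite -mnm_nth; under [RHS]eq_bigr do rewrite -mnm_nth.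
Qed.
End KroneckerSubstitution.

Section MpolyFunctions.
Variables (F : numFieldType) (k : nat).
Implicit Types (p h : {mpoly F[k]}) (m : 'X_{1..k}) (y : 'I_k -> F).

Lemma msupp_lt_msize p m i : m \in msupp p -> (m i < msize p)%N.
Proof.
by move/msize_mdeg_lt; apply: leq_ltn_trans; rewrite mdegE (bigD1 i) //= leq_addr.
Qed.

Lemma mpoly_fun_eq0 p : (forall y, (forall i, y i != 0) -> p.@[y] = 0) -> p = 0.
Proof.
move=> p_fun0; pose B := msize p.
pose q := \sum_(m <- msupp p) p@_m *: 'X^(kronecker_exp B m).
have q_eq0 : q = 0.
  apply: poly_fun_eq0 => x x0; rewrite -(p_fun0 (fun i => x ^+ (B ^ i))); last first.
    by move=> i; rewrite expf_neq0.
  rewrite mevalE horner_sum; apply: eq_bigr => m _; rewrite hornerZ hornerXn.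
  by rewrite expr_sum; congr (_ * _); apply: eq_bigr => i _; rewrite mulnC exprM.
apply/mpolyP => m; rewrite mcoeff0.
have [pm|] := boolP (m \in msupp p); last by rewrite -mcoeff_eq0 => /eqP.
have := congr1 (fun r : {poly F} => r`_(kronecker_exp B m)) q_eq0.
rewrite coef0 coef_sum (bigD1_seq m) ?msupp_uniq //= coefZ coefXn eqxx mulr1.
rewrite big_seq_cond big1 ?addr0 // => m' /andP [pm' neq_m].
rewrite coefZ coefXn; case: eqP => [/kronecker_exp_inj eq_m|_]; last by rewrite mulr0.
by rewrite eq_m ?eqxx // in neq_m => i; apply: msupp_lt_msize.
Qed.

Definition torus_scale (I : eqType) (i j : I) (s : F) (d : I -> F) : I -> F :=
  fun l => if l == i then s * d i else if l == j then d j / s else d l.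

Lemma prod_torus_scale (i j : 'I_k) s y m n :
  i != j -> s != 0 -> (m j <= n)%N ->
  s ^+ n * \prod_l torus_scale i j s y l ^+ m l =
  s ^+ (n + m i - m j) * \prod_l y l ^+ m l.
Proof.
move=> neq_ij s0 le_mjn; have neq_ji : j != i by rewrite eq_sym.
rewrite (bigD1 i) //= (bigD1 j) //= [in RHS](bigD1 i) //= [in RHS](bigD1 j) //=.
rewrite (eq_bigr (fun l => y l ^+ m l)); last first.
  by move=> l /andP [/negbTE neq_li /negbTE neq_lj]; rewrite /torus_scale neq_li neq_lj.
have -> : s ^+ (n + m i - m j) = s ^+ n * s ^+ m i / s ^+ m j.
  rewrite -exprD; apply: (canRL (mulfK _)); first exact: expf_neq0.
  by rewrite -exprD subnK // (leq_trans le_mjn) // leq_addr.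
by rewrite /torus_scale !eqxx (negbTE neq_ji) !exprMn exprVn; ring.
Qed.

Lemma msupp_le_of_torus_regular h (i j : 'I_k) : i != j ->
  (forall y, (forall l, y l != 0) -> exists p : {poly F}, forall s, s != 0 ->
     h.@[torus_scale i j s y] = p.[s]) ->
  forall m, m \in msupp h -> (m j <= m i)%N.
Proof.
move=> neq_ij h_regular m0 hm0; rewrite leqNgt; apply/negP => lt_m0.
pose n := msize h; pose wt m := (n + m i - m j)%N.
have le_n m : m \in msupp h -> (m j <= n)%N by move=> hm; apply/ltnW/msupp_lt_msize.
pose h0 := \sum_(m <- msupp h | wt m == wt m0) h@_m *: 'X_[m].
have h0_eq0 : h0 = 0.
  apply: mpoly_fun_eq0 => y y0; have [p hp] := h_regular y y0.
  pose A : {poly F} := \sum_(m <- msupp h) (h@_m * \prod_l y l ^+ m l) *: 'X^(wt m).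
  have A_eq : A - 'X^n * p = 0.
    apply: poly_fun_eq0 => s s0; rewrite hornerD hornerN hornerM hornerXn -hp //.
    apply/eqP; rewrite subr_eq0; apply/eqP; rewrite mevalE mulr_sumr horner_sum.
    apply: eq_big_seq => m hm; rewrite hornerZ hornerXn mulrCA.
    by rewrite prod_torus_scale ?le_n // mulrAC mulrA.
  have := congr1 (fun r : {poly F} => r`_(wt m0)) A_eq.
  rewrite coef0 coefB coefXnM (_ : wt m0 < n)%N; last first.
    by rewrite /wt; have := le_n _ hm0; lia.
  rewrite subr0 coef_sum => <-; rewrite (raddf_sum (meval y)) big_mkcond.
  apply: eq_bigr => m _; rewrite coefZ coefXn [wt m0 == _]eq_sym.
  by case: ifP => _; rewrite ?mulr0 // mulr1 /= mevalZ mevalX.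
have := congr1 (mcoeff m0) h0_eq0.
rewrite mcoeff0 (raddf_sum (mcoeff m0)) /= big_mkcond (bigD1_seq m0) ?msupp_uniq //= eqxx.
rewrite mcoeffZ mcoeffX eqxx mulr1 big1 ?addr0 => [h_m0|m neq_m]; last first.
  by rewrite mcoeffZ mcoeffX (negbTE neq_m) mulr0; case: ifP.
by rewrite mcoeff_msupp h_m0 eqxx in hm0.
Qed.
End MpolyFunctions.

Section PartialProducts.
Variable F : numFieldType.
Implicit Types (c d : nat -> F).

Lemma prod_partial_prod d (a : nat -> nat) k :
  (forall i, (i < k)%N -> (a i.+1 <= a i)%N) ->
  \prod_(i < k) (\prod_(j < i.+1) d j) ^+ (a i - a i.+1) * (\prod_(j < k) d j) ^+ a k
  = \prod_(i < k) d i ^+ a i.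
Proof.
elim: k => [|k IHk] a_dec; first by rewrite !big_ord0 expr1n mulr1.
rewrite big_ord_recr [RHS]big_ord_recr -IHk /=; last by move=> i /ltnW/a_dec.
rewrite -!mulrA; congr (_ * _); rewrite -exprD subnK ?a_dec //.
by rewrite big_ord_recr exprMn.
Qed.

Lemma mpoly_in_partial_prods k (h : {mpoly F[k]}) c : (forall i, c i != 0) ->
  (forall m (i j : 'I_k), m \in msupp h -> val j = i.+1 -> (m j <= m i)%N) ->
  exists Q : {mpoly F[k]}, forall d,
    Q.@[fun i : 'I_k => c i * \prod_(j < i.+1) d j] = h.@[fun i : 'I_k => d i].
Proof.
move=> c0 h_dom.
pose drop_exp (m : 'X_{1..k}) := [multinom (nth 0 m i - nth 0 m i.+1)%N | i < k].
exists (\sum_(m <- msupp h)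
          (h@_m * \prod_(i < k) c i ^- drop_exp m i) *: 'X_[drop_exp m]) => d.
rewrite (raddf_sum (meval _)) /= [RHS]mevalE; apply: eq_big_seq => m hm.
rewrite [LHS]mevalZ mevalX -mulrA -big_split /=; congr (_ * _).
rewrite (eq_bigr (fun i : 'I_k =>
   (\prod_(j < i.+1) d j) ^+ (nth 0 m i - nth 0 m i.+1)%N)); last first.
  by move=> i _; rewrite mnmE exprMn mulKf // expf_neq0.
under [RHS]eq_bigr do rewrite (mnm_nth 0%N).
rewrite -prod_partial_prod => [|i lt_ik].
  by rewrite [nth 0%N m k]nth_default ?size_tuple // expr0 mulr1.
have [lt_i1k|le_ki1] := ltnP i.+1 k; last by rewrite nth_default ?size_tuple.
have := h_dom m (Ordinal lt_ik) (Ordinal lt_i1k) hm erefl.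
by rewrite !(mnm_nth 0%N).
Qed.

Lemma partial_prods_alg_independent k (p : {mpoly F[k]}) c : (forall i, c i != 0) ->
  (forall d, p.@[fun i : 'I_k => c i * \prod_(j < i.+1) d j] = 0) -> p = 0.
Proof.
move=> c0 p_eq0; apply: mpoly_fun_eq0 => y y0.
pose z i := ord_ext 1 y i / c i.
have z0 i : z i != 0.
  rewrite mulf_neq0 ?invr_eq0 //.
  by apply: (@ord_ext_ind _ _ _ _ (fun x => x != 0)); rewrite ?oner_eq0.
pose d i := if i is i'.+1 then z i / z i' else z 0%N.
have prod_d i : \prod_(j < i.+1) d j = z i.
  elim: i => [|i IHi]; first by rewrite big_ord1.
  by rewrite big_ord_recr /= IHi mulrC divfK.
rewrite -(p_eq0 d); apply: meval_eq => i.
by rewrite prod_d /z ord_extE mulrC divfK.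
Qed.
End PartialProducts.

(** * Matrices under unipotent row and column operations *)

Section UnipotentOperations.
Variable A : comNzRingType.
Implicit Types (X : nat -> nat -> A) (c d : nat -> A).

Definition rowop a c X := fun i j => X i j + c i * X a j.
Definition colop a c X := fun i j => X i j + c j * X i a.
Definition cong a c X :=
  fun i j => X i j + c i * X a j + c j * X i a + c i * c j * X a a.
Definition single b (u : A) : nat -> A := fun i => if i == b then u else 0.

Lemma singleE b u i : single b u i = u * (i == b)%:R.
Proof. by rewrite /single; case: eqP => _; rewrite ?mulr1 ?mulr0. Qed.

Lemma cong_colop_rowop a c X : cong a c X = colop a c (rowop a c X).
Proof. by apply: funext => i; apply: funext => j; rewrite /cong /colop /rowop; ring. Qed.

Definition sign_symmetric (e : A) X := forall i j, X j i = e * X i j.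

Lemma cong_sign_symmetric e a c X : sign_symmetric e X -> sign_symmetric e (cong a c X).
Proof.
move=> symX i j; rewrite /cong (symX i j) (symX a j) (symX i a).
by rewrite {1}(symX a a); ring.
Qed.

Definition diagm d := fun i j => if i == j then d i else 0.
Definition partner i := if odd i then i.-1 else i.+1.
Definition skewm d :=
  fun i j => if j == partner i then if odd i then - d i./2 else d i./2 else 0.

Lemma partner_sym i j : (j == partner i) = (i == partner j).
Proof. by rewrite /partner; case: ifP => oi; case: ifP => oj; lia. Qed.

Lemma diagm_symmetric d : sign_symmetric 1 (diagm d).
Proof. by move=> i j; rewrite /diagm mul1r eq_sym; case: eqP => [->|]. Qed.

Lemma skewm_skew d : sign_symmetric (-1) (skewm d).
Proof.
move=> i j; rewrite /skewm partner_sym; case: (j =P partner i) => [->|_]; last by rewrite mulr0.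
rewrite /partner mulN1r; have [oi|oi] := boolP (odd i).
  by rewrite (_ : odd i.-1 = false) ?opprK; [congr d; lia|lia].
by rewrite (_ : odd i.+1 = true); [congr (- d _); lia|lia].
Qed.
End UnipotentOperations.

Section SingleOperations.
Variables (A : comNzRingType) (op : (nat -> A) -> (nat -> nat -> A) -> nat -> nat -> A).
Variables (S : (nat -> nat -> A) -> Prop) (B : Type) (f : (nat -> nat -> A) -> B).
Variables (a n : nat).
Hypothesis op0 : forall X, op (fun=> 0) X = X.
Hypothesis op_add_single : forall c b u X, c a = 0 ->
  op (fun i => c i + single b u i) X = op (single b u) (op c X).
Hypothesis op_stable : forall c X, S X -> S (op c X).
Hypothesis f_single : forall b u X, (a < b < n)%N -> S X -> f (op (single b u) X) = f X.

Lemma op_invariant_of_single c X :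
  (forall i, c i != 0 -> (a < i < n)%N) -> S X -> f (op c X) = f X.
Proof.
move=> c_supp SX; pose trunc m i := if (i < m)%N then c i else 0.
have truncS m i : trunc m.+1 i = trunc m i + single m (c m) i.
  rewrite /trunc /single ltnS leq_eqVlt.
  by case: (i =P m) => [->|_] /=; rewrite ?ltnn ?add0r ?addr0.
have f_trunc m : f (op (trunc m) X) = f X.
  elim: m => [|m IHm]; first by rewrite op0.
  rewrite (funext (truncS m)) op_add_single; last first.
    by rewrite /trunc; case: ifP => // _; apply/eqP; apply: contraT => /c_supp; rewrite ltnn.
  have [cm0|/c_supp lt_amn] := eqVneq (c m) 0; last by rewrite f_single //; apply: op_stable.
  rewrite cm0 (_ : single m 0 = fun=> 0) ?op0 //.
  by apply: funext => i; rewrite /single; case: ifP.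
rewrite -(f_trunc n); congr (f (op _ X)); apply: funext => i; rewrite /trunc.
by case: ltnP => // le_ni; apply/eqP; apply: contraT => /c_supp; lia.
Qed.
End SingleOperations.

Section VectorOperations.
Variables (A : comNzRingType) (B : Type) (f : (nat -> nat -> A) -> B) (a n : nat).
Implicit Types (X : nat -> nat -> A) (c : nat -> A).

Lemma rowop_invariant c X :
  (forall b u Y, (a < b < n)%N -> f (rowop a (single b u) Y) = f Y) ->
  (forall i, c i != 0 -> (a < i < n)%N) -> f (rowop a c X) = f X.
Proof.
move=> f_single c_supp; apply: (op_invariant_of_single (S := xpredT)) c_supp _ => //.
- by move=> Y; apply: funext => i; apply: funext => j; rewrite /rowop mul0r addr0.
- move=> c' b u Y c'a; apply: funext => i; apply: funext => j.
  by rewrite /rowop c'a; ring.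
- by move=> b u Y lt_abn _; apply: f_single.
Qed.

Lemma colop_invariant c X :
  (forall b u Y, (a < b < n)%N -> f (colop a (single b u) Y) = f Y) ->
  (forall i, c i != 0 -> (a < i < n)%N) -> f (colop a c X) = f X.
Proof.
move=> f_single c_supp; apply: (op_invariant_of_single (S := xpredT)) c_supp _ => //.
- by move=> Y; apply: funext => i; apply: funext => j; rewrite /colop mul0r addr0.
- move=> c' b u Y c'a; apply: funext => i; apply: funext => j.
  by rewrite /colop c'a; ring.
- by move=> b u Y lt_abn _; apply: f_single.
Qed.

Lemma cong_invariant e c X :
  (forall b u Y, (a < b < n)%N -> sign_symmetric e Y -> f (cong a (single b u) Y) = f Y) ->
  (forall i, c i != 0 -> (a < i < n)%N) -> sign_symmetric e X -> f (cong a c X) = f X.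
Proof.
move=> f_single; apply: (op_invariant_of_single (S := sign_symmetric e)) => //.
- move=> Y; apply: funext => i; apply: funext => j.
  by rewrite /cong !mul0r !addr0.
- move=> c' b u Y c'a; apply: funext => i; apply: funext => j.
  by rewrite /cong c'a; ring.
- by move=> c' Y; apply: cong_sign_symmetric.
Qed.
End VectorOperations.

Section Elimination.
Variable F : numFieldType.
Local Notation mat := (nat -> nat -> F).
Implicit Types (X Y H : mat) (c d : nat -> F) (f : mat -> F).

Definition line X H (s : F) : mat := fun i j => X i j + s * H i j.
Definition polynomial_on_lines f :=
  forall X H, exists p : {poly F}, forall s, f (line X H s) = p.[s].

Lemma line_eq0 f X H : polynomial_on_lines f ->
  (forall s, s != 0 -> f (line X H s) = 0) -> f X = 0.
Proof.
move=> f_poly f_eq0; have [p f_line] := f_poly X H.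
have p_eq0 : p = 0 by apply: poly_fun_eq0 => s s0; rewrite -f_line f_eq0.
have := f_line 0; rewrite p_eq0 horner0 => <-; congr f.
by apply: funext => i; apply: funext => j; rewrite /line mul0r addr0.
Qed.

(* A vanishing pivot is first made nonzero along a line. *)
Lemma pivot_elimination f (S : mat -> Prop) (cleared : nat -> mat -> Prop)
    (pivot : nat -> mat -> F) (H : nat -> mat) K :
  polynomial_on_lines f ->
  (forall k X s, S X -> cleared k X -> pivot k X = 0 -> s != 0 ->
     [/\ S (line X (H k) s), cleared k (line X (H k) s) & pivot k (line X (H k) s) != 0]) ->
  (forall k X, (k < K)%N -> S X -> cleared k X -> pivot k X != 0 ->
     exists Y, [/\ S Y, cleared k.+1 Y & f Y = f X]) ->
  (forall X, S X -> cleared K X -> f X = 0) ->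
  forall X, S X -> cleared 0 X -> f X = 0.
Proof.
move=> f_poly perturb eliminate f_cleared.
suff from j X : (j <= K)%N -> S X -> cleared (K - j)%N X -> f X = 0.
  by move=> X SX X0; apply: (from K) => //; rewrite subnn.
elim: j X => [|j IHj] X; first by rewrite subn0 => _; apply: f_cleared.
move=> lt_jK SX clX; have eK : (K - j = (K - j.+1).+1)%N by lia.
have pivoted Y : S Y -> cleared (K - j.+1)%N Y -> pivot (K - j.+1)%N Y != 0 -> f Y = 0.
  move=> SY clY pivY; have [|Z [SZ clZ <-]] := eliminate _ Y _ SY clY pivY; first by lia.
  by apply: IHj; rewrite ?eK // ltnW.
have [piv0|] := eqVneq (pivot (K - j.+1)%N X) 0; last exact: pivoted.
apply: (line_eq0 (H := H (K - j.+1)%N) f_poly) => s s0.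
by have [] := perturb _ X s SX clX piv0 s0; apply: pivoted.
Qed.

Definition cleared (p m : nat) (off : rel nat) k X := forall i j,
  off i j -> (i < k)%N || (j < k)%N -> (i < p)%N -> (j < m)%N -> X i j = 0.
Definition unitm k : mat := fun i j => (i == k)%:R * (j == k)%:R.
Local Notation off_diag := (fun i j => i != j).

Lemma cleared_line_unitm p m k X s :
  cleared p m off_diag k X -> cleared p m off_diag k (line X (unitm k) s).
Proof.
move=> clX i j neq_ij lt_k ltip ltjm; rewrite /line clX // /unitm -natrM mulnb.
by rewrite (_ : _ && _ = false) ?mulr0 ?addr0 //; lia.
Qed.

Lemma pivot_line_unitm k X s :
  X k k = 0 -> s != 0 -> line X (unitm k) s k k != 0.
Proof. by move=> Xkk0 s0; rewrite /line Xkk0 /unitm !eqxx !mulr1 add0r. Qed.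

Lemma cleared_diag p m X i j : cleared p m off_diag (minn p m) X ->
  (i < p)%N -> (j < m)%N -> X i j = diagm (fun k => X k k) i j.
Proof.
move=> clX ltip ltjm; rewrite /diagm; case: eqP => [->//|/eqP neq_ij].
by apply: clX => //; rewrite !leq_min; lia.
Qed.

Definition col_multiplier p a X i := if (a < i < p)%N then - X i a / X a a else 0.
Definition row_multiplier m a X j := if (a < j < m)%N then - X a j / X a a else 0.

Lemma col_multiplier_supp p a X i : col_multiplier p a X i != 0 -> (a < i < p)%N.
Proof. by rewrite /col_multiplier; case: ifP => //; rewrite eqxx. Qed.
Lemma row_multiplier_supp m a X j : row_multiplier m a X j != 0 -> (a < j < m)%N.
Proof. by rewrite /row_multiplier; case: ifP => //; rewrite eqxx. Qed.

Lemma cleared_pivot p m a X : (a < minn p m)%N ->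
  cleared p m off_diag a X -> X a a != 0 ->
  cleared p m off_diag a.+1
    (colop a (row_multiplier m a X) (rowop a (col_multiplier p a X) X)).
Proof.
rewrite leq_min => /andP [ltap ltam] clX piv0 i j neq_ij lt_a1 ltip ltjm.
rewrite /colop /rowop.
have col0 k : (k <= a)%N -> col_multiplier p a X k = 0.
  by rewrite /col_multiplier; case: ifP => //; lia.
have row0 k : (k <= a)%N -> row_multiplier m a X k = 0.
  by rewrite /row_multiplier; case: ifP => //; lia.
have [ltia|leai] := ltnP i a.
  by rewrite col0 1?ltnW // (clX i j) ?(clX i a) ?ltia //; [ring|lia..].
have [ltja|leaj] := ltnP j a.
  by rewrite row0 1?ltnW // (clX i j) ?(clX a j) ?ltja ?orbT //; [ring|lia..].
have [eq_ia|neq_ia] := eqVneq i a.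
  rewrite eq_ia col0 // !mul0r !addr0 /row_multiplier ltjm andbT.
  rewrite (_ : (a < j)%N); last by lia.
  by rewrite divfK // addrN.
have -> : j = a by lia.
rewrite row0 // mul0r addr0 /col_multiplier ltip andbT (_ : (a < i)%N); last by lia.
by rewrite divfK // addrN.
Qed.

Section Rectangular.
Variables (p m : nat) (f : mat -> F).
Hypothesis f_local : forall X Y,
  (forall i j, (i < p)%N -> (j < m)%N -> X i j = Y i j) -> f X = f Y.
Hypothesis f_rowop : forall a c X,
  (forall i, c i != 0 -> (a < i < p)%N) -> f (rowop a c X) = f X.
Hypothesis f_colop : forall a c X,
  (forall i, c i != 0 -> (a < i < m)%N) -> f (colop a c X) = f X.
Hypothesis f_poly : polynomial_on_lines f.

Lemma rect_eq0_of_diag : (forall d, f (diagm d) = 0) -> forall X, f X = 0.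
Proof.
move=> f_diag X.
apply: (pivot_elimination (S := xpredT) (cleared := cleared p m off_diag)
          (pivot := fun k X => X k k) (H := unitm) (K := minn p m) f_poly) => //.
- move=> k Y s _ clY piv0 s0; split=> //; first exact: cleared_line_unitm.
  exact: pivot_line_unitm.
- move=> k Y ltk _ clY piv0.
  exists (colop k (row_multiplier m k Y) (rowop k (col_multiplier p k Y) Y)).
  split=> //; first exact: cleared_pivot.
  by rewrite f_colop ?f_rowop // => i; [apply: col_multiplier_supp|apply: row_multiplier_supp].
- move=> Y _ clY; rewrite -(f_diag (fun k => Y k k)); apply: f_local => i j.
  exact: cleared_diag.
Qed.
End Rectangular.

Section Symmetric.
Variables (n : nat) (f : mat -> F).
Hypothesis f_local : forall X Y,
  (forall i j, (i < n)%N -> (j < n)%N -> X i j = Y i j) -> f X = f Y.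
Hypothesis f_cong : forall a c X, sign_symmetric 1 X ->
  (forall i, c i != 0 -> (a < i < n)%N) -> f (cong a c X) = f X.
Hypothesis f_poly : polynomial_on_lines f.

Lemma symmetric_eq0_of_diag :
  (forall d, f (diagm d) = 0) -> forall X, sign_symmetric 1 X -> f X = 0.
Proof.
move=> f_diag X symX.
apply: (pivot_elimination (S := sign_symmetric 1) (cleared := cleared n n off_diag)
          (pivot := fun k X => X k k) (H := unitm) (K := n) f_poly) => //.
- move=> k Y s symY clY piv0 s0; split; first by move=> i j; rewrite /line /unitm symY; ring.
    exact: cleared_line_unitm.
  exact: pivot_line_unitm.
- move=> k Y ltk symY clY piv0; exists (cong k (col_multiplier n k Y) Y).
  split; [exact: cong_sign_symmetric| |exact: f_cong (@col_multiplier_supp n k Y)].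
  have colE : col_multiplier n k Y = row_multiplier n k Y.
    by apply: funext => i; rewrite /row_multiplier symY mul1r.
  by rewrite cong_colop_rowop {1}colE; apply: cleared_pivot; rewrite ?minnn.
- move=> Y _ clY; rewrite -(f_diag (fun k => Y k k)); apply: f_local => i j.
  by apply: cleared_diag; rewrite minnn.
Qed.
End Symmetric.

Section SkewSymmetric.
Variables (n : nat) (f : mat -> F).
Local Notation off_pair := (fun i j => j != partner i).
Hypothesis f_local : forall X Y,
  (forall i j, (i < n)%N -> (j < n)%N -> X i j = Y i j) -> f X = f Y.
Hypothesis f_cong : forall a c X, sign_symmetric (-1) X ->
  (forall i, c i != 0 -> (a < i < n)%N) -> f (cong a c X) = f X.
Hypothesis f_poly : polynomial_on_lines f.

Lemma skew_diag_eq0 X i : sign_symmetric (-1) X -> X i i = 0.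
Proof.
by move=> /(_ i i)/eqP; rewrite mulN1r -addr_eq0 -mulr2n mulrn_eq0 /= => /eqP.
Qed.

Definition wedge u v : mat := fun i j =>
  (i == u)%:R * (j == v)%:R - (i == v)%:R * (j == u)%:R.

Lemma wedge_skew u v : sign_symmetric (-1) (wedge u v).
Proof. by move=> i j; rewrite /wedge; ring. Qed.

Lemma wedge_pairE l i j : wedge l.*2 l.*2.+1 i j =
  if j == partner i then if i./2 == l then if odd i then -1 else 1 else 0 else 0.
Proof.
rewrite /wedge -!natrM !mulnb /partner; have [oi|oi] := boolP (odd i).
  have -> : (i == l.*2) && (j == l.*2.+1) = false by lia.
  have -> : (i == l.*2.+1) && (j == l.*2) = (j == i.-1) && (i./2 == l) by lia.
  by case: (j == _); case: (_ == l); rewrite /= ?sub0r ?oppr0.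
have -> : (i == l.*2.+1) && (j == l.*2) = false by lia.
have -> : (i == l.*2) && (j == l.*2.+1) = (j == i.+1) && (i./2 == l) by lia.
by case: (j == _); case: (_ == l); rewrite /= ?subr0.
Qed.

Lemma cleared_line_wedge a X s : cleared n n off_pair a.*2 X ->
  cleared n n off_pair a.*2 (line X (wedge a.*2 a.*2.+1) s).
Proof.
move=> clX i j neq_ij lt_a ltin ltjn.
by rewrite /line clX // wedge_pairE (negbTE neq_ij) mulr0 addr0.
Qed.

Lemma cleared_skewm X i j : sign_symmetric (-1) X ->
  cleared n n off_pair (n./2).*2 X -> (i < n)%N -> (j < n)%N ->
  X i j = skewm (fun k => X k.*2 k.*2.+1) i j.
Proof.
move=> skewX clX ltin ltjn; rewrite /skewm; case: (j =P partner i) => [->|/eqP neq_ij].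
  rewrite /partner; case: ifP => oi.
    have -> : (i./2).*2 = i.-1 by lia.
    have -> : i.-1.+1 = i by lia.
    by rewrite skewX mulN1r.
  by have -> : (i./2).*2 = i by lia.
have [big|small] := leqP (n./2).*2 (minn i j); last by apply: clX => //; lia.
by have -> : i = j by [lia]; apply: skew_diag_eq0.
Qed.

Definition pair_col_multiplier a X i :=
  if (a.*2.+1 < i < n)%N then X a.*2.+1 i / X a.*2 a.*2.+1 else 0.
Definition pair_row_multiplier a X i :=
  if (a.*2.+1 < i < n)%N then - X a.*2 i / X a.*2 a.*2.+1 else 0.
Definition pair_clear a X :=
  cong a.*2.+1 (pair_row_multiplier a X) (cong a.*2 (pair_col_multiplier a X) X).

Lemma pair_col_multiplier_eq0 a X k : (k <= a.*2.+1)%N -> pair_col_multiplier a X k = 0.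
Proof. by rewrite /pair_col_multiplier ltnNge => ->. Qed.
Lemma pair_row_multiplier_eq0 a X k : (k <= a.*2.+1)%N -> pair_row_multiplier a X k = 0.
Proof. by rewrite /pair_row_multiplier ltnNge => ->. Qed.

Lemma pair_clearE a X i j : sign_symmetric (-1) X -> (i <= a.*2.+1)%N ->
  pair_clear a X i j =
  X i j + pair_col_multiplier a X j * X i a.*2 + pair_row_multiplier a X j * X i a.*2.+1.
Proof.
move=> skewX le_i; rewrite /pair_clear /cong.
rewrite !(pair_row_multiplier_eq0 X le_i, pair_col_multiplier_eq0 X le_i).
by rewrite (pair_col_multiplier_eq0 X (leqnn _)); ring.
Qed.

Lemma cleared_pair_clear a X : (a < n./2)%N -> sign_symmetric (-1) X ->
  cleared n n off_pair a.*2 X -> X a.*2 a.*2.+1 != 0 ->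
  cleared n n off_pair a.+1.*2 (pair_clear a X).
Proof.
move=> lt_an skewX clX piv0.
have symZ : sign_symmetric (-1) (pair_clear a X) by do 2!apply: cong_sign_symmetric.
suff half i j : j != partner i -> (i < a.+1.*2)%N -> (i < n)%N -> (j < n)%N ->
    pair_clear a X i j = 0.
  move=> i j neq_ij /orP [lt_a|lt_a] ltin ltjn; first exact: half.
  by rewrite symZ half ?mulr0 // -partner_sym.
move=> neq_ij lt_a ltin ltjn; rewrite pair_clearE => [|//|]; last first.
  by rewrite doubleS in lt_a.
have [lti|lei] := ltnP i a.*2.
  have X0 k : k != partner i -> (k < n)%N -> X i k = 0.
    by move=> neq_k ltkn; apply: clX; rewrite ?lti.
  rewrite (X0 j) // (X0 a.*2) ?(X0 a.*2.+1) ?mulr0 ?addr0 //.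
  - by rewrite /partner; case: ifP; lia.
  - by lia.
  - by rewrite /partner; case: ifP; lia.
  - by lia.
have [lej|ltj] := leqP j a.*2.+1.
  rewrite pair_col_multiplier_eq0 // pair_row_multiplier_eq0 // !mul0r !addr0.
  have [ltja|leaj] := ltnP j a.*2; first by rewrite clX // ltja orbT.
  have -> : j = i by move: neq_ij; rewrite /partner; case: ifP; lia.
  exact: skew_diag_eq0.
rewrite /pair_col_multiplier /pair_row_multiplier ltj ltjn /=.
have [->|neq_i] := eqVneq i a.*2; first by rewrite (skew_diag_eq0 a.*2) // divfK //; ring.
have -> : i = a.*2.+1 by lia.
by rewrite (skew_diag_eq0 a.*2.+1) // (skewX a.*2 a.*2.+1) mulN1r mulrN divfK //; ring.
Qed.

Lemma pair_clear_invariant a X : sign_symmetric (-1) X -> f (pair_clear a X) = f X.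
Proof.
move=> skewX; rewrite f_cong; last 2 first.
- exact: cong_sign_symmetric.
- by move=> i; rewrite /pair_row_multiplier; case: ifP => //; rewrite eqxx.
rewrite f_cong // => i; rewrite /pair_col_multiplier.
by case: ifP => [|_]; [lia|rewrite eqxx].
Qed.

Lemma skew_eq0_of_skewm :
  (forall d, f (skewm d) = 0) -> forall X, sign_symmetric (-1) X -> f X = 0.
Proof.
move=> f_skewm X skewX.
apply: (pivot_elimination (S := sign_symmetric (-1))
          (cleared := fun k => cleared n n off_pair k.*2)
          (pivot := fun k X => X k.*2 k.*2.+1) (H := fun k => wedge k.*2 k.*2.+1)
          (K := n./2) f_poly) => //.
- move=> k Y s skewY clY piv0 s0; split; last 2 first.
  + exact: cleared_line_wedge.
  + by rewrite /line piv0 wedge_pairE /partner odd_double doubleK !eqxx mulr1 add0r.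
  by move=> i j; rewrite /line skewY (wedge_skew _ _ i j); ring.
- move=> k Y ltk skewY clY piv0; exists (pair_clear k Y); split; last exact: pair_clear_invariant.
    by do 2!apply: cong_sign_symmetric.
  exact: cleared_pair_clear.
- move=> Y skewY clY; rewrite -(f_skewm (fun k => Y k.*2 k.*2.+1)); apply: f_local => i j.
  exact: cleared_skewm.
Qed.
End SkewSymmetric.
End Elimination.

(* Along each curve s |-> diag(..., s d_q, d_{q+1}/s, ...) the function is a
   polynomial in s, since the curve is moved into a line by unipotent operations. *)
Section TorusRegularity.
Variables (F : numClosedFieldType) (f : (nat -> nat -> F) -> F) (q : nat).
Hypothesis f_poly : polynomial_on_lines f.
Implicit Types (d : nat -> F) (s : F).

Definition punch d l := if (l == q) || (l == q.+1) then 0 else d l.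

Lemma punch_torus_scale s d : punch (torus_scale q q.+1 s d) = punch d.
Proof.
by apply: funext => l; rewrite /punch /torus_scale; case: (l == q); case: (l == q.+1).
Qed.

Lemma diagm_units d i j :
  diagm d i j = diagm (punch d) i j
    + d q * unitm F q i j + d q.+1 * unitm F q.+1 i j.
Proof.
rewrite /diagm /punch /unitm -!natrM !mulnb; have [<-|neq_ij] := eqVneq i j.
  have [->|_] /= := eqVneq i q; last by case: eqP => [->|_]; rewrite ?mulr0 ?mulr1 ?add0r ?addr0.
  by rewrite ltn_eqF // mulr0 mulr1 add0r addr0.
have off l : (i == l) && (j == l) = false.
  by apply: contraNF neq_ij => /andP [/eqP -> /eqP ->].
by rewrite !off !mulr0 !addr0.
Qed.

Lemma symmetric_torus_regular d :
  (forall u X, sign_symmetric 1 X -> f (cong q (single q.+1 u) X) = f X) ->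
  (forall l, d l != 0) -> exists p : {poly F}, forall s, s != 0 ->
    f (diagm (torus_scale q q.+1 s d)) = p.[s].
Proof.
move=> f_cong d0; pose x := sqrtC (- (d q * d q.+1)).
have x2 : x ^+ 2 = - (d q * d q.+1) by rewrite sqrtCK.
pose rest := diagm (punch d).
pose X i j := rest i j + x * ((i == q)%:R * (j == q.+1)%:R + (i == q.+1)%:R * (j == q)%:R).
pose H i j := d q * unitm F q i j.
have [p f_line] := f_poly X H; exists p => s s0; rewrite -f_line.
have sym_rest : sign_symmetric 1 rest by apply: diagm_symmetric.
have symX : sign_symmetric 1 (line X H s).
  by move=> i j; rewrite /line /X /H /unitm (sym_rest i j); ring.
have y0 : s * d q != 0 by rewrite mulf_neq0.
rewrite -(f_cong (- (x / (s * d q))) _ symX); congr f.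
apply: funext => i; apply: funext => j; rewrite diagm_units.
rewrite punch_torus_scale -/rest.
have rest_q k : rest q k = 0 by rewrite /rest /diagm /punch eqxx /=; case: ifP.
have rest_q' k : rest k q = 0 by rewrite (sym_rest q k) rest_q mulr0.
rewrite /cong /line /X /H /unitm !rest_q !rest_q' !singleE /torus_scale !eqxx.
rewrite (ltn_eqF (ltnSn q)) (gtn_eqF (ltnSn q)) /=.
have -> : d q.+1 / s = - (x ^+ 2 / (s * d q)).
  by rewrite x2; field; rewrite s0 d0.
by field; rewrite s0 d0.
Qed.

Lemma skewm_wedges d i j :
  skewm d i j = skewm (punch d) i j
    + d q * wedge F q.*2 q.*2.+1 i j + d q.+1 * wedge F q.*2.+2 q.*2.+3 i j.
Proof.
rewrite -[q.*2.+2]/(q.+1.*2) !wedge_pairE /skewm /punch.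
case: (j == _); last by rewrite !mulr0 !addr0.
have [->|neq_q] := eqVneq i./2 q; last have [->|neq_q1] := eqVneq i./2 q.+1.
- by rewrite (_ : (q == q.+1) = false) /=; [case: ifP => _; ring|lia].
- by case: ifP => _ /=; ring.
- by case: ifP => _ /=; ring.
Qed.

Lemma skewm_eq0 d i j : d i./2 = 0 -> skewm d i j = 0.
Proof. by rewrite /skewm => ->; case: ifP => // _; case: ifP; rewrite ?oppr0. Qed.

Lemma skew_torus_regular d :
  (forall a b u X, (a < b <= q.*2.+3)%N -> sign_symmetric (-1) X ->
     f (cong a (single b u) X) = f X) ->
  (forall l, d l != 0) -> exists p : {poly F}, forall s, s != 0 ->
    f (skewm (torus_scale q q.+1 s d)) = p.[s].
Proof.
move=> f_cong d0; set a := q.*2 in f_cong; pose x := d q * d q.+1.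
pose rest := skewm (punch d).
pose X i j := rest i j - x * wedge F a a.+2 i j + wedge F a.+1 a.+3 i j.
pose H i j := d q * wedge F a a.+1 i j.
have [p f_line] := f_poly X H; exists p => s s0; rewrite -f_line.
have skew_rest : sign_symmetric (-1) rest by apply: skewm_skew.
have skewX : sign_symmetric (-1) (line X H s).
  move=> i j; rewrite /line /X /H (skew_rest i j) (wedge_skew _ a a.+2 i j).
  by rewrite (wedge_skew _ a a.+1 i j) (wedge_skew _ a.+1 a.+3 i j); ring.
have y0 : s * d q != 0 by rewrite mulf_neq0.
rewrite -(f_cong a.+1 a.+2 (x / (s * d q)) _ _ skewX); last by lia.
rewrite -(f_cong a a.+3 (s * d q)^-1 (cong _ _ _)); [|lia|exact: cong_sign_symmetric].
congr f; apply: funext => i; apply: funext => j; rewrite skewm_wedges -/a.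
rewrite punch_torus_scale -/rest.
have rest0 k l : (k == a) || (k == a.+1) -> rest k l = 0 /\ rest l k = 0.
  move=> k_a; have rest_kl : rest k l = 0 by apply: skewm_eq0; rewrite /punch ifT //; lia.
  by rewrite (skew_rest k l) rest_kl mulr0.
have rest_a l : rest a l = 0 by case: (rest0 a l); rewrite ?eqxx.
have rest_a' l : rest l a = 0 by case: (rest0 a l); rewrite ?eqxx.
have rest_a1 l : rest a.+1 l = 0 by case: (rest0 a.+1 l); rewrite ?eqxx ?orbT.
have rest_a1' l : rest l a.+1 = 0 by case: (rest0 a.+1 l); rewrite ?eqxx ?orbT.
rewrite /cong /line /X /H !(rest_a, rest_a', rest_a1, rest_a1') /wedge !singleE.
rewrite /torus_scale !eqxx (gtn_eqF (ltnSn q)).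
have neq1 l : (l == l.+1) = false by rewrite ltn_eqF.
have neq2 l : (l == l.+2) = false by elim: l.
have neq3 l : (l == l.+3) = false by elim: l.
have neq1' l : (l.+1 == l) = false by rewrite gtn_eqF.
rewrite !(neq1, neq2, neq3, neq1') /=.
have -> : d q.+1 / s = x / (s * d q) by rewrite /x; field; rewrite s0 d0.
by field; rewrite s0 d0.
Qed.
End TorusRegularity.

(** * Determinants and Pfaffians *)

Section ReversedDeterminant.
Variable A : comNzRingType.
Implicit Types (X Y : nat -> nat -> A) (d : nat -> A).

Definition rev_det q X : A := \det (\matrix_(r < q, s < q) X r (q.-1 - s)%N).
Definition rev_perm q : 'S_q := perm (@rev_ord_inj q).

Lemma eq_rev_det q X Y :
  (forall i j, (i < q)%N -> (j < q)%N -> X i j = Y i j) -> rev_det q X = rev_det q Y.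
Proof.
move=> eqXY; congr (\det _); apply/matrixP => i j; rewrite !mxE eqXY //.
by have := ltn_ord j; lia.
Qed.

Lemma rev_detE q X :
  rev_det q X = (-1) ^+ rev_perm q * \det (\matrix_(r < q, s < q) X r s).
Proof.
rewrite /rev_det (_ : \matrix_(r, s) _ = col_perm (rev_perm q) (\matrix_(r < q, s < q) X r s)).
  by rewrite col_permE det_mulmx det_perm odd_permV mulrC.
apply/matrixP => r s; rewrite !mxE permE /=; congr (X r _).
by have := ltn_ord s; lia.
Qed.

Lemma det_rowop_single q a b u X : (a < b)%N ->
  \det (\matrix_(r < q, s < q) rowop a (single b u) X r s)
  = \det (\matrix_(r < q, s < q) X r s).
Proof.
move=> ltab; have [leqb|ltbq] := leqP q b.
  congr (\det _); apply/matrixP => r s; rewrite !mxE /rowop /single.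
  by rewrite ltn_eqF ?mul0r ?addr0 // (leq_trans (ltn_ord r)).
pose b' := Ordinal ltbq; pose a' := Ordinal (ltn_trans ltab ltbq).
pose C : 'M[A]_q := \matrix_(r, s) X (if r == b' then a else r) s.
rewrite (@determinant_multilinear _ _ _ (\matrix_(r < q, s < q) X r s) C b' 1 u).
- rewrite mul1r (@determinant_alternate _ _ C a' b') ?mulr0 ?addr0 //.
    by rewrite -val_eqE /= ltn_eqF.
  by move=> s; rewrite !mxE eqxx; case: ifP.
- by apply/rowP => s; rewrite !mxE /rowop /single /= !eqxx mul1r.
- apply/matrixP => r s; rewrite !mxE /rowop /single.
  by rewrite (inj_eq val_inj (lift b' r) b') eq_sym (negbTE (neq_lift _ _)) mul0r addr0.
- apply/matrixP => r s; rewrite !mxE /rowop /single.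
  rewrite (inj_eq val_inj (lift b' r) b') [lift _ _ == _]eq_sym (negbTE (neq_lift _ _)).
  by rewrite mul0r addr0.
Qed.

Lemma rev_det_rowop q a b u X : (a < b)%N ->
  rev_det q (rowop a (single b u) X) = rev_det q X.
Proof. by move=> ltab; rewrite !rev_detE det_rowop_single. Qed.

Lemma rev_det_colop q a b u X : (a < b)%N ->
  rev_det q (colop a (single b u) X) = rev_det q X.
Proof.
move=> ltab; rewrite !rev_detE; congr (_ * _).
have det_flip Y :
    \det (\matrix_(r < q, s < q) Y r s) = \det (\matrix_(r < q, s < q) Y s r).
  by rewrite -det_tr; congr (\det _); apply/matrixP => i j; rewrite !mxE.
by rewrite det_flip [RHS]det_flip -(@det_rowop_single q a b u (fun i j => X j i)).
Qed.

Lemma rev_det_cong q a b u X : (a < b)%N ->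
  rev_det q (cong a (single b u) X) = rev_det q X.
Proof. by move=> ltab; rewrite cong_colop_rowop rev_det_colop // rev_det_rowop. Qed.

Lemma rev_det_diagm q d : rev_det q (diagm d) = (-1) ^+ rev_perm q * \prod_(i < q) d i.
Proof.
rewrite rev_detE (_ : \matrix_(r, s) _ = diag_mx (\row_(i < q) d i)).
  by rewrite det_diag; congr (_ * _); apply: eq_bigr => i _; rewrite mxE.
apply/matrixP => i j; rewrite !mxE /diagm -val_eqE /=.
by case: (_ == _).
Qed.
End ReversedDeterminant.

Section MatchedPermutations.
Variable q : nat.
Implicit Types (s : 'S_q.*2) (x y : 'I_q.*2) (i j : 'I_q).

Lemma ltn_partner x : (partner x < q.*2)%N.
Proof. by have := ltn_ord x; rewrite /partner; case: ifP; lia. Qed.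
Definition ord_partner x : 'I_q.*2 := Ordinal (ltn_partner x).

Lemma ord_partnerK : involutive ord_partner.
Proof.
move=> x; apply: val_inj; rewrite /= /partner.
by have [o|o] := boolP (odd x); case: ifP; lia.
Qed.
Lemma odd_partner x : odd (ord_partner x) = ~~ odd x.
Proof. by rewrite /= /partner; case: ifP; lia. Qed.
Lemma ord_partner_neq x : ord_partner x != x.
Proof. by apply/eqP => /(congr1 (odd \o val)); rewrite /= odd_partner; case: odd. Qed.
Lemma ord_partner_odbl i : ord_partner (odbl i) = odbl1 i.
Proof. by apply: val_inj; rewrite /= /partner odd_double. Qed.
Lemma odbl_inj : injective (@odbl q).
Proof. by move=> i j /(congr1 val) /= /double_inj/val_inj. Qed.

Variant ord_dbl_spec x : 'I_q.*2 -> Prop :=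
  | OrdDblEven i of x = odbl i : ord_dbl_spec x (odbl i)
  | OrdDblOdd i of x = odbl1 i : ord_dbl_spec x (odbl1 i).

Lemma ord_dblP x : ord_dbl_spec x x.
Proof.
have ltxq : (x./2 < q)%N by have := ltn_ord x; lia.
have [ox|ex] := boolP (odd x).
  have {2}-> : x = odbl1 (Ordinal ltxq) by apply: val_inj => /=; lia.
  by apply: OrdDblOdd; apply: val_inj => /=; lia.
have {2}-> : x = odbl (Ordinal ltxq) by apply: val_inj => /=; lia.
by apply: OrdDblEven; apply: val_inj => /=; lia.
Qed.

Definition matched s := [forall x, s (ord_partner x) == ord_partner (s x)].

Lemma matchedP s : reflect (forall x, s (ord_partner x) = ord_partner (s x)) (matched s).
Proof. exact: 'forall_eqP. Qed.

Lemma matched_odbl s : (forall i, s (odbl1 i) = ord_partner (s (odbl i))) -> matched s.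
Proof.
move=> s_odbl; apply/matchedP => x; case: (ord_dblP x) => i _.
  by rewrite ord_partner_odbl.
by rewrite -ord_partner_odbl ord_partnerK ord_partner_odbl s_odbl ord_partnerK.
Qed.

(* Such an s is e * e^J for the permutation e that agrees with s on even
   indices and fixes odd ones, J being the partner involution. *)
Lemma odd_perm_matched_parity s : matched s -> (forall x, odd (s x) = odd x) ->
  odd_perm s = false.
Proof.
move/matchedP=> s_match s_par.
have e_inj : injective (fun x => if odd x then x else s x).
  move=> x y; case: ifP => ox; case: ifP => oy // eq_xy; last exact: perm_inj eq_xy.
    by rewrite -s_par -eq_xy ox in oy.
  by rewrite -s_par eq_xy oy in ox.
pose e := perm e_inj; pose J := perm (inv_inj ord_partnerK).
suff -> : s = (e * e ^ J)%g by rewrite odd_permM odd_permJ addbb.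
have JK : J^-1%g = J.
  by apply/permP => x; apply: (@perm_inj _ J); rewrite permKV !permE ord_partnerK.
apply/permP => x; rewrite conjgE JK !permM !permE.
have [ox|ex] := boolP (odd x).
  by rewrite odd_partner ox /= s_match ord_partnerK.
by rewrite odd_partner s_par ex /= ord_partnerK.
Qed.

Lemma matched_sign (A : comNzRingType) s : matched s ->
  (-1) ^+ s * \prod_(i < q) (if odd (s (odbl i)) then -1 else 1) = 1 :> A.
Proof.
have [n] := ubnP #|[set i : 'I_q | odd (s (odbl i))]|; elim: n s => // n IHn s lt_n s_match.
have [/existsP [i oi]|/existsPn s_even] := boolP [exists i : 'I_q, odd (s (odbl i))]; last first.
  rewrite big1 => [|i _]; last by rewrite (negbTE (s_even i)).
  rewrite odd_perm_matched_parity ?mulr1 // => x.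
  have odd_odbl i : odd (s (odbl i)) = false by apply/negbTE/s_even.
  case: (ord_dblP x) => i _; first by rewrite odd_odbl /= odd_double.
  by rewrite -ord_partner_odbl (matchedP _ s_match) !odd_partner odd_odbl /= odd_double.
pose s' := (tperm (odbl i) (odbl1 i) * s)%g.
have odd_s' j : odd (s' (odbl j)) = if j == i then false else odd (s (odbl j)).
  rewrite permM; case: eqP => [->|/eqP neq_ji].
    by rewrite tpermL -ord_partner_odbl (matchedP _ s_match) odd_partner oi.
  rewrite tpermD // ?(inj_eq odbl_inj) 1?eq_sym //.
  by apply/eqP => /(congr1 (odd \o val)); rewrite /= !odd_double.
have s'_match : matched s'.
  apply: matched_odbl => j; rewrite !permM -(matchedP _ s_match); congr (s _).
  rewrite -!ord_partner_odbl; case: (tpermP _ _ (odbl j)) => [->|->|neq0 neq1].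
  - by rewrite tpermR ord_partnerK.
  - by rewrite ord_partnerK tpermL.
  - rewrite tpermD ?(can_eq ord_partnerK) //; apply/eqP => eq_ij; last by case: neq0.
    by case: neq1; rewrite eq_ij ord_partnerK.
have sign_s' : (-1) ^+ s' * \prod_(j < q) (if odd (s' (odbl j)) then -1 else 1) = 1 :> A.
  apply: IHn => //; rewrite -ltnS (leq_trans _ lt_n) //; apply: proper_card; apply/properP; split.
    by apply/subsetP => j; rewrite !inE odd_s'; case: ifP.
  by exists i; rewrite !inE ?odd_s' ?eqxx ?oi.
rewrite -[RHS]sign_s' odd_permM odd_tperm -ord_partner_odbl eq_sym ord_partner_neq.
rewrite addTb signrN !(bigD1 i (P := xpredT)) //= odd_s' eqxx oi mul1r mulN1r.
rewrite mulrN mulNr; congr (- (_ * _)); apply: eq_bigr => j /negbTE neq_ji.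
by rewrite odd_s' neq_ji.
Qed.

End MatchedPermutations.

Section Pfaffian.
Variable F : numFieldType.
Implicit Types (X Y : nat -> nat -> F) (d : nat -> F).

Definition pf_monomial q X (s : 'S_q.*2) : F :=
  \prod_(i < q) X (s (odbl i)) (s (odbl1 i)).
Definition pfaffian q X : F :=
  (2 ^ q * q`!)%:R^-1 * \sum_(s : 'S_q.*2) (-1) ^+ s * pf_monomial X s.

Lemma eq_pfaffian q X Y :
  (forall i j, (i < q.*2)%N -> (j < q.*2)%N -> X i j = Y i j) -> pfaffian q X = pfaffian q Y.
Proof.
move=> eqXY; congr (_ * _); apply: eq_bigr => s _; congr (_ * _).
by apply: eq_bigr => i _; rewrite eqXY.
Qed.

Definition redirect (a b x : nat) : nat := if x == b then a else x.

Lemma sum_pf_monomial_redirect q (a b : 'I_q.*2) X : a != b ->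
  \sum_(s : 'S_q.*2) (-1) ^+ s * pf_monomial (fun i j => X (redirect a b i) (redirect a b j)) s
  = 0.
Proof.
move=> neq_ab; set S := LHS.
have redirect_tperm x : redirect a b (tperm a b x) = redirect a b x.
  rewrite /redirect !(inj_eq val_inj).
  by case: tpermP => [->|->|//]; rewrite ?eqxx ?(negbTE neq_ab).
suff /eqP : - S = S by rewrite eqNr => /eqP.
rewrite {2}/S (reindex_inj (mulIg (tperm a b))) -sumrN; apply: eq_bigr => s _ /=.
rewrite odd_permM odd_tperm neq_ab addbT signrN mulNr; congr (- (_ * _)).
by apply: eq_bigr => i _; rewrite !permM !redirect_tperm.
Qed.

Lemma pf_monomial_cong_single q (a b : 'I_q.*2) u X (s : 'S_q.*2) : a != b ->
  pf_monomial (cong a (single b u) X) s = pf_monomial X s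
    + u * pf_monomial (fun i j => X (redirect a b i) (redirect a b j)) s.
Proof.
move=> neq_ab; have neq_pair i : s (odbl i) != s (odbl1 i).
  by rewrite (inj_eq perm_inj) -ord_partner_odbl eq_sym ord_partner_neq.
have [i0 i0_b] : exists i, s (odbl i) = b \/ s (odbl1 i) = b.
  have : s (s^-1 b)%g = b by rewrite permKV.
  by case: (ord_dblP (s^-1 b)%g) => i _; exists i; [left|right].
have off_b i : i != i0 -> (val (s (odbl i)) == b = false) * (val (s (odbl1 i)) == b = false).
  move=> neq_i; have off x y : s y = b -> x != y -> val (s x) == b = false.
    by move=> <- neq_xy; rewrite (inj_eq val_inj) (inj_eq perm_inj) (negbTE neq_xy).
  have par j j' : odbl j != odbl1 j' :> 'I_q.*2.
    by apply/eqP => /(congr1 (odd \o val)); rewrite /= !odd_double.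
  have odbl1_neq : odbl1 i != odbl1 i0.
    by rewrite -!ord_partner_odbl (can_eq (@ord_partnerK q)) (inj_eq (@odbl_inj q)).
  have odbl_neq : odbl i != odbl i0 by rewrite (inj_eq (@odbl_inj q)).
  by case: i0_b => s_b; split; apply: off s_b _; rewrite // eq_sym.
have cong_off i : i != i0 -> cong a (single b u) X (s (odbl i)) (s (odbl1 i)) =
    X (s (odbl i)) (s (odbl1 i)).
  by move/off_b=> off; rewrite /cong /single !off; ring.
have redirect_off i : i != i0 ->
    X (redirect a b (s (odbl i))) (redirect a b (s (odbl1 i))) = X (s (odbl i)) (s (odbl1 i)).
  by move/off_b=> off; rewrite /redirect !off.
rewrite /pf_monomial (bigD1 i0) //= [\prod_i X _ _](bigD1 i0) //=.
rewrite [\prod_i X (redirect _ _ _) _](bigD1 i0) //= (eq_bigr _ cong_off).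
rewrite [\prod_(i < q | _) X (redirect _ _ _) _](eq_bigr _ redirect_off) mulrA -mulrDl.
congr (_ * _); rewrite /cong /single /redirect; have := neq_pair i0; rewrite -val_eqE.
by case: i0_b => -> ; rewrite ?[val b == _]eq_sym => /negbTE -> /=; rewrite eqxx; ring.
Qed.

Lemma pfaffian_cong q a b u X : (a < b)%N ->
  pfaffian q (cong a (single b u) X) = pfaffian q X.
Proof.
move=> ltab; have [leqb|ltbq] := leqP q.*2 b.
  apply: eq_pfaffian => i j ltiq ltjq; rewrite /cong /single.
  by rewrite !ltn_eqF ?(leq_trans ltiq) ?(leq_trans ltjq) //; ring.
pose b' := Ordinal ltbq; pose a' := Ordinal (ltn_trans ltab ltbq).
have neq_ab : a' != b' by rewrite -val_eqE /= ltn_eqF.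
congr (_ * _); under eq_bigr do
  rewrite (pf_monomial_cong_single (a := a') (b := b') u X) // mulrDr mulrCA.
by rewrite big_split /= -mulr_sumr (sum_pf_monomial_redirect X neq_ab) mulr0 addr0.
Qed.

Lemma pf_monomial_skewm_unmatched q d (s : 'S_q.*2) :
  ~~ matched s -> pf_monomial (skewm d) s = 0.
Proof.
move=> s_unmatched.
have /existsP [i /negbTE neq_i] : [exists i, s (odbl1 i) != ord_partner (s (odbl i))].
  apply: contraNT s_unmatched => /existsPn s_odbl; apply: matched_odbl => i.
  exact/eqP/negPn/s_odbl.
by rewrite /pf_monomial (bigD1 i) //= /skewm (_ : (_ == _) = false) ?mul0r.
Qed.

Lemma pf_monomial_skewm_matched q d (s : 'S_q.*2) : matched s ->
  (-1) ^+ s * pf_monomial (skewm d) s = \prod_(i < q) d i.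
Proof.
move=> s_match; have half_lt i : ((s (odbl i))./2 < q)%N by have := ltn_ord (s (odbl i)); lia.
pose h i : 'I_q := Ordinal (half_lt i).
have h_inj : injective h.
  move=> i j /(congr1 val) /= eq_half; apply: odbl_inj; apply: (@perm_inj _ s).
  have [o|o] := eqVneq (odd (s (odbl i))) (odd (s (odbl j))); first by apply: val_inj => /=; lia.
  have : s (odbl i) = s (odbl1 j).
    rewrite -ord_partner_odbl (matchedP _ s_match); apply: val_inj.
    by rewrite /= /partner; case: ifP o; lia.
  by move/perm_inj/(congr1 (odd \o val)); rewrite /= !odd_double.
rewrite -[RHS]mul1r -[X in _ = X * _](matched_sign F s_match) -mulrA; congr (_ * _).
rewrite [\prod_(i < q) d i](reindex_inj h_inj) -big_split /=; apply: eq_bigr => i _.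
rewrite -ord_partner_odbl (matchedP _ s_match) /skewm eqxx.
by case: ifP; rewrite ?mulN1r ?mul1r.
Qed.

Lemma pfaffian_skewm q : exists2 c : F, c != 0 &
  forall d, pfaffian q (skewm d) = c * \prod_(i < q) d i.
Proof.
pose M := [set s : 'S_q.*2 | matched s].
exists ((2 ^ q * q`!)%:R^-1 * #|M|%:R) => [|d].
  rewrite mulf_neq0 ?invr_eq0 ?pnatr_eq0 -?lt0n ?muln_gt0 ?expn_gt0 ?fact_gt0 //.
  by apply/card_gt0P; exists 1%g; rewrite inE; apply/matchedP => x; rewrite !perm1.
rewrite -mulrA; congr (_ * _).
rewrite (bigID (mem M)) /= [X in _ + X]big1 ?addr0 => [|s]; last first.
  by rewrite inE => /pf_monomial_skewm_unmatched ->; rewrite mulr0.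
rewrite mulr_natl -sumr_const; apply: eq_bigr => s; rewrite inE.
exact: pf_monomial_skewm_matched.
Qed.
End Pfaffian.

(** * Initial segments of a strict total order and the cascade *)

Record strict_total_order (T : eqType) (gt : rel T) : Prop := StrictTotalOrder {
  gt_irr : irreflexive gt;
  gt_trans : transitive gt;
  gt_total : forall i j, i != j -> gt i j || gt j i }.

Section StrictTotalOrder.
Variables (T : eqType) (gt : rel T).
Hypothesis gtO : strict_total_order gt.
Implicit Types (x y : T) (s : seq T).

Lemma gt_asym x y : gt x y -> gt y x = false.
Proof.
by move=> gt_xy; apply/negP => /(gt_trans gtO gt_xy); rewrite (gt_irr gtO).
Qed.

Lemma gt_neq x y : gt x y -> x != y.
Proof. by apply: contraTneq => ->; rewrite (gt_irr gtO). Qed.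

Lemma converse_strict_total_order : strict_total_order (fun x y => gt y x).
Proof.
split=> [x|y x z gt_yx gt_zy|x y neq_xy]; first exact: gt_irr.
  exact: gt_trans gt_zy gt_yx.
by rewrite orbC gt_total.
Qed.

Lemma gt_sorted_uniq s : sorted gt s -> uniq s.
Proof. exact: sorted_uniq (gt_trans gtO) (gt_irr gtO) s. Qed.

Lemma gt_sorted_nth x0 s i j : sorted gt s -> (i < size s)%N -> (j < size s)%N ->
  gt (nth x0 s i) (nth x0 s j) = (i < j)%N.
Proof.
move=> s_sorted ltis ltjs; have nth_gt := sorted_ltn_nth (gt_trans gtO) x0 s_sorted.
case: (ltngtP i j) => [ltij|ltji|->]; last exact: (gt_irr gtO).
  exact: nth_gt.
by apply: gt_asym; apply: nth_gt.
Qed.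

Definition initial_segment s :=
  sorted gt s /\ forall x y, y \in s -> gt x y -> x \in s.

Lemma initial_segment_take n s : initial_segment s -> initial_segment (take n s).
Proof.
move=> [s_sorted s_up]; split=> [|x y y_s gt_xy]; first exact: take_sorted.
have ys := mem_take y_s; have xs := s_up x y ys gt_xy.
move: y_s; rewrite !in_take //; apply: ltn_trans.
by rewrite -(gt_sorted_nth x s_sorted) ?index_mem ?nth_index.
Qed.

Lemma initial_segment_rcons s i : initial_segment s -> i \notin s ->
  (forall x, x \notin s -> x != i -> gt i x) -> initial_segment (rcons s i).
Proof.
move=> [s_sorted s_up] ni i_max; split=> [|x y].
  move: s_sorted; rewrite !(sorted_pairwise (gt_trans gtO)) pairwise_rcons => ->.
  rewrite andbT; apply/allP => y ys /=.
  have /(gt_total gtO)/orP [//|/(s_up _ _ ys)] : y != i by apply: contraNneq ni => <-.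
  by rewrite (negbTE ni).
rewrite !mem_rcons !inE => /orP [/eqP ->|ys] gt_xy; last by rewrite (s_up _ _ ys) ?orbT.
rewrite (negbTE (gt_neq gt_xy)) /=; apply: contraT => nx.
by have := i_max x nx (gt_neq gt_xy); rewrite gt_asym.
Qed.

Lemma initial_segment_nth_max x0 n s x : initial_segment s -> (n < size s)%N ->
  x \notin take n s -> x != nth x0 s n -> gt (nth x0 s n) x.
Proof.
move=> [s_sorted s_up] lt_n nx neq_x; have nth_s := mem_nth x0 lt_n.
have /orP [gt_x|//] := gt_total gtO neq_x; have xs := s_up _ _ nth_s gt_x.
move: nx; rewrite in_take // -(gt_sorted_nth x0 s_sorted) ?index_mem // nth_index //.
by rewrite gt_x.
Qed.

Lemma nth_notin_take x0 n s : sorted gt s -> (n < size s)%N -> nth x0 s n \notin take n s.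
Proof.
move=> s_sorted lt_n; rewrite in_take ?mem_nth // index_uniq ?ltnn //.
exact: gt_sorted_uniq.
Qed.

Lemma maximal_initial_segment (M : seq T) : exists2 s, initial_segment s &
  forall x, x \in M -> x \notin s -> exists2 k, k \notin M & gt k x.
Proof.
pose ge x y := (x == y) || gt x y.
have ge_total : total ge.
  by move=> x y; rewrite /ge; have [//|/(gt_total gtO)] := eqVneq x y.
pose s := sort ge [seq x <- undup M | `[< forall k, gt k x -> k \in M >]].
have mem_s x : (x \in s) = `[< forall k, gt k x -> k \in M >] && (x \in M).
  by rewrite mem_sort mem_filter mem_undup.
exists s => [|x xM]; last first.
  rewrite mem_s xM andbT => /asboolPn/existsNP [k /not_implyP [gt_kx /negP nkM]].
  by exists k.
split=> [|x y].
  rewrite (sorted_pairwise (gt_trans gtO)).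
  have ge_trans : transitive ge.
    move=> y x z /orP [/eqP -> //|gt_xy] /orP [/eqP <-|gt_yz]; rewrite /ge ?gt_xy ?orbT //.
    by rewrite (gt_trans gtO gt_xy gt_yz) orbT.
  have := sort_sorted ge_total [seq x <- undup M | `[< forall k, gt k x -> k \in M >]].
  rewrite -/s (sorted_pairwise ge_trans) => ge_s.
  have neq_s : pairwise [rel x y | x != y] s.
    by rewrite -uniq_pairwise sort_uniq filter_uniq // undup_uniq.
  have : pairwise [rel x y | ge x y && (x != y)] s by rewrite pairwise_relI ge_s.
  by apply: sub_pairwise => x y /= /andP [/orP [/eqP ->|//]]; rewrite eqxx.
rewrite !mem_s => /andP [/asboolP y_max yM] gt_xy; rewrite y_max // andbT.
by apply/asboolP => k gt_kx; apply: y_max; apply: gt_trans gt_kx gt_xy.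
Qed.
End StrictTotalOrder.

Lemma exists_notin_nat (M : seq nat) : exists k, k \notin M.
Proof.
exists (\max_(x <- M) x).+1; apply/negP => M_k.
by have := leq_bigmax_seq (P := xpredT) (F := id) _ M_k isT; rewrite ltnn.
Qed.

Lemma initial_gt_final (gt : rel nat) s s' : strict_total_order gt ->
  initial_segment gt s -> initial_segment (fun x y => gt y x) s' ->
  forall x y, x \in s -> y \in s' -> gt x y.
Proof.
move=> gtO [_ s_up] [_ s'_down] x y xs ys'.
have [k] := exists_notin_nat (s ++ s'); rewrite mem_cat negb_or => /andP [ks ks'].
have neq_xk : x != k by apply: contraNneq ks => <-.
have neq_yk : y != k by apply: contraNneq ks' => <-.
have gt_xk : gt x k.
  by have /orP [//|/(s_up _ _ xs)] := gt_total gtO neq_xk; rewrite (negbTE ks).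
have gt_ky : gt k y.
  by have /orP [/(s'_down _ _ ys')|//] := gt_total gtO neq_yk; rewrite (negbTE ks').
exact: (gt_trans gtO) gt_xk gt_ky.
Qed.

Lemma admissible_strict_total_order t prec :
  admissible t prec -> strict_total_order (gtth t prec).
Proof.
have theta_inj : injective (theta t prec).
  move=> i j; rewrite /theta /eps /sneg.
  by case: t => /=; do ?case: ifP => _; case.
move=> prec_adm.
have [Q [irr [tr tot]] HQ] : exists2 Q,
    strict_total Q prec & forall i, Q (theta t prec i).
  case: t prec_adm {theta_inj} => /= [precO|[precO _]|[precO _]|[[precO _] _]].
  - by eexists; [exact: precO|move=> i; exists i].
  - by exists (fun _ => True).
  - by exists (fun _ => True).
  - by exists (fun _ => True).
split=> [i|j i k gt_ij gt_jk|i j neq_ij]; rewrite /gtth.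
- by apply/negbTE/irr.
- by apply: (tr _ (theta t prec j)).
- have [||eq_theta|lt_ij|lt_ji] := tot (theta t prec i) (theta t prec j) => //.
  + by rewrite (theta_inj _ _ eq_theta) eqxx in neq_ij.
  + by rewrite lt_ij orbT.
  + by rewrite lt_ji.
Qed.

Section Cascade.
Variables (t : ctype) (prec : rel sel).
Local Notation gt := (gtth t prec).
Local Notation lt := (fun i j => gtth t prec j i).
Hypothesis gtO : strict_total_order gt.
Implicit Types (s : seq nat) (S : nat -> Prop).

Lemma is_max_unique S i j : is_max t prec S i -> is_max t prec S j -> i = j.
Proof.
move=> [ni i_max] [nj j_max]; apply: contrapT => neq_ij.
have := gt_asym gtO (i_max j nj (nesym neq_ij)).
by rewrite (j_max i ni neq_ij).
Qed.

Lemma is_min_unique S i j : is_min t prec S i -> is_min t prec S j -> i = j.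
Proof.
move=> [ni i_min] [nj j_min]; apply: contrapT => neq_ij.
have := gt_asym gtO (i_min j nj (nesym neq_ij)).
by rewrite (j_min i ni neq_ij).
Qed.

Lemma is_max_nth S n s : initial_segment gt s -> (n < size s)%N ->
  (forall x, S x <-> x \in take n s) -> is_max t prec S (nth 0%N s n).
Proof.
move=> s_init lt_n S_take; split=> [/S_take|x nx /eqP neq_x].
  exact/negP/(nth_notin_take gtO 0%N s_init.1 lt_n).
by apply: initial_segment_nth_max => //; apply/negP => /S_take.
Qed.

Lemma initial_segment_max S s i : initial_segment gt s ->
  (forall x, S x <-> x \in s) -> is_max t prec S i -> initial_segment gt (rcons s i).
Proof.
move=> s_init S_s [ni i_max]; apply: initial_segment_rcons => //.
  by apply/negP => /S_s.
by move=> x nx /eqP neq_x; apply: i_max => // /S_s; apply/negP.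
Qed.

Definition step_size : nat := if ctype_eqb t TC then 1 else 2.

Lemma step_size_gt0 : (0 < step_size)%N.
Proof. by rewrite /step_size; case: ifP. Qed.

Lemma mul_step_size_C q : ctype_eqb t TC -> (q * step_size)%N = q.
Proof. by rewrite /step_size => ->; rewrite muln1. Qed.

Lemma mul_step_size_BD q : ~~ ctype_eqb t TC -> (q * step_size)%N = q.*2.
Proof. by rewrite /step_size => /negbTE ->; rewrite muln2. Qed.

Lemma NsetS q x : Nset t prec q.+1 x <-> cstep t prec (Nset t prec q) x.
Proof. by []. Qed.

Lemma mem_takeS n s x : (n < size s)%N ->
  (x \in take n.+1 s) = (x \in take n s) || (x == nth 0%N s n).
Proof. by move=> lt_n; rewrite (take_nth 0%N) // mem_rcons inE orbC. Qed.

Section NotTypeA.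
Hypothesis not_A : ~~ ctype_eqb t TA.

Lemma cstep_C S x : ctype_eqb t TC ->
  cstep t prec S x <-> S x \/ exists i, is_max t prec S i /\ x = i.
Proof. by rewrite /cstep; case: t. Qed.

Lemma cstep_BD S x : ~~ ctype_eqb t TC ->
  cstep t prec S x <-> S x \/ exists i j, is_max t prec S i /\
    is_max t prec (fun y => S y \/ y = i) j /\ (x = i \/ x = j).
Proof. by move: not_A; rewrite /cstep; case: t. Qed.

Lemma Nset_initial s q : initial_segment gt s -> (q * step_size <= size s)%N ->
  forall x, Nset t prec q x <-> x \in take (q * step_size) s.
Proof.
move=> s_init; elim: q => [_ x|q IHq le_s x]; first by rewrite take0.
have lt_s : (q * step_size < size s)%N.
  by apply: leq_trans le_s; rewrite mulSn addnC -addn1 leq_add2l step_size_gt0.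
have {}IHq := IHq (ltnW lt_s); have max0 := is_max_nth s_init lt_s IHq.
move: (le_s) max0 IHq lt_s; rewrite NsetS /step_size; case: ifP => [t_C|/negbT t_BD].
  rewrite !muln1 cstep_C // => _ max0 IHq lt_s; rewrite mem_takeS //; split.
    case=> [/IHq -> //|[i [i_max ->]]].
    by rewrite (is_max_unique i_max max0) eqxx orbT.
  by case/orP => [/IHq|/eqP ->]; [left|right; exists (nth 0%N s q)].
rewrite !muln2 doubleS cstep_BD // => lt_s1 max0 IHq lt_s; rewrite !mem_takeS //.
have max1 : is_max t prec (fun y => Nset t prec q y \/ y = nth 0%N s q.*2)
              (nth 0%N s q.*2.+1).
  apply: is_max_nth => // y; rewrite mem_takeS //; split.
    by case=> [/IHq ->|->]; rewrite ?eqxx ?orbT.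
  by case/orP => [/IHq|/eqP]; [left|right].
split.
  case=> [/IHq -> //|[i [j [i_max [j_max x_ij]]]]].
  rewrite (is_max_unique i_max max0) in j_max x_ij.
  by case: x_ij => ->; rewrite ?(is_max_unique j_max max1) eqxx !orbT.
rewrite -orbA => /or3P [/IHq|/eqP ->|/eqP ->]; first by left.
- by right; exists (nth 0%N s q.*2), (nth 0%N s q.*2.+1); auto.
- by right; exists (nth 0%N s q.*2), (nth 0%N s q.*2.+1); auto.
Qed.

Lemma cascade_ge_initial s k : initial_segment gt s -> (k * step_size <= size s)%N ->
  cascade_ge t prec k.
Proof.
move=> s_init le_s [//|q] /andP [_ lt_qk].
have le_q1 : (q.+1 * step_size <= size s)%N.
  by apply: leq_trans le_s; rewrite leq_pmul2r // step_size_gt0.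
have lt_q : (q * step_size < q.+1 * step_size)%N by rewrite ltn_pmul2r // step_size_gt0.
have lt_s := leq_trans lt_q le_q1; have [s_sorted _] := s_init.
exists (nth 0%N s (q * step_size)); split.
  apply/(Nset_initial s_init le_q1); rewrite in_take ?mem_nth //.
  by rewrite index_uniq // (gt_sorted_uniq gtO).
by move/(Nset_initial s_init (ltnW lt_s)); apply/negP/(nth_notin_take gtO 0%N s_sorted lt_s).
Qed.

Lemma initial_of_cascade_ge k : cascade_ge t prec k ->
  exists2 s, initial_segment gt s & size s = (k * step_size)%N.
Proof.
elim: k => [_|q IHq k_casc]; first by exists [::].
have [|s s_init size_s] := IHq; first by move=> j /andP [j0 le_jq]; apply: k_casc; rewrite j0 ltnW.
have Nq x : Nset t prec q x <-> x \in s.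
  by rewrite -{1}(take_size s) size_s; apply: Nset_initial; rewrite // size_s.
have [x [Nq1x nx]] : grows t prec q.+1 by apply: k_casc; rewrite ltnS leqnn.
move: Nq1x size_s; rewrite NsetS /step_size; case: ifP => [t_C|/negbT t_BD].
  rewrite cstep_C // !muln1 => -[//|[i [i_max _]]] size_s.
  by exists (rcons s i); rewrite ?size_rcons ?size_s //; apply: initial_segment_max Nq i_max.
rewrite cstep_BD // !muln2 => -[//|[i [j [i_max [j_max _]]]]] size_s.
exists (rcons (rcons s i) j); last by rewrite !size_rcons size_s.
apply: initial_segment_max j_max; first exact: initial_segment_max Nq i_max.
move=> y; rewrite mem_rcons inE; split=> [[/Nq ->|->]|/orP [/eqP|/Nq]]; rewrite ?eqxx ?orbT //.
  by right.
by left.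
Qed.
End NotTypeA.

Section TypeA.
Hypothesis is_A : ctype_eqb t TA.

Lemma cstep_A S x : cstep t prec S x <->
  S x \/ exists i j, is_max t prec S i /\ is_min t prec S j /\ (x = i \/ x = j).
Proof. by move: is_A; rewrite /cstep; case: t. Qed.

Lemma is_max_min_nth S s s' q : initial_segment gt s -> initial_segment lt s' ->
  (q < size s)%N -> (q < size s')%N ->
  (forall x, S x <-> (x \in take q s) || (x \in take q s')) ->
  is_max t prec S (nth 0%N s q) /\ is_min t prec S (nth 0%N s' q).
Proof.
move=> s_init s'_init lt_s lt_s' S_take.
have gt_ss' := initial_gt_final gtO s_init s'_init.
have ltO := converse_strict_total_order gtO.
split; split.
- move/S_take => /orP [|/mem_take/(gt_ss' _ _ (mem_nth 0%N lt_s))].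
    exact/negP/(nth_notin_take gtO 0%N s_init.1 lt_s).
  by rewrite (gt_irr gtO).
- move=> x nx /eqP neq_x; apply: initial_segment_nth_max => //.
  by apply/negP => x_s; apply/nx/S_take; rewrite x_s.
- move/S_take => /orP [/mem_take xs|].
    by have := gt_ss' _ _ xs (mem_nth 0%N lt_s'); rewrite (gt_irr gtO).
  exact/negP/(nth_notin_take ltO 0%N s'_init.1 lt_s').
- move=> x nx /eqP neq_x; apply: (initial_segment_nth_max ltO) => //.
  by apply/negP => x_s'; apply/nx/S_take; rewrite x_s' orbT.
Qed.

Lemma Nset_initial_final s s' q : initial_segment gt s -> initial_segment lt s' ->
  (q <= size s)%N -> (q <= size s')%N ->
  forall x, Nset t prec q x <-> (x \in take q s) || (x \in take q s').
Proof.
move=> s_init s'_init; elim: q => [_ _ x|q IHq lt_s lt_s' x]; first by rewrite !take0.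
have {}IHq := IHq (ltnW lt_s) (ltnW lt_s').
have [max0 min0] := is_max_min_nth s_init s'_init lt_s lt_s' IHq.
rewrite NsetS cstep_A !mem_takeS // orbACA; split.
  case=> [/IHq -> //|[i [j [i_max [j_min x_ij]]]]].
  rewrite (is_max_unique i_max max0) (is_min_unique j_min min0) in x_ij.
  by case: x_ij => ->; rewrite eqxx !orbT.
case/orP => [/IHq|x_nth]; first by left.
right; exists (nth 0%N s q), (nth 0%N s' q); split=> //; split=> //.
by case/orP: x_nth => /eqP; [left|right].
Qed.

Lemma cascade_ge_initial_final s s' k : initial_segment gt s -> initial_segment lt s' ->
  (k <= size s)%N -> (k <= size s')%N -> cascade_ge t prec k.
Proof.
move=> s_init s'_init le_s le_s' [//|q] /andP [_ lt_qk].
have lt_s := leq_trans lt_qk le_s; have lt_s' := leq_trans lt_qk le_s'.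
exists (nth 0%N s q); split.
  apply/(Nset_initial_final s_init s'_init) => //.
  by rewrite mem_takeS // eqxx orbT.
have Nq := Nset_initial_final s_init s'_init (ltnW lt_s) (ltnW lt_s').
by have [[]] := is_max_min_nth s_init s'_init lt_s lt_s' Nq.
Qed.

Lemma initial_final_of_cascade_ge k : cascade_ge t prec k ->
  exists s s', [/\ initial_segment gt s, initial_segment lt s', size s = k & size s' = k].
Proof.
elim: k => [_|q IHq k_casc]; first by exists [::], [::].
have [|s [s' [s_init s'_init size_s size_s']]] := IHq.
  by move=> j /andP [j0 le_jq]; apply: k_casc; rewrite j0 ltnW.
have Nq x : Nset t prec q x <-> (x \in s) || (x \in s').
  rewrite -{1}(take_size s) size_s -{1}(take_size s') size_s'.
  by apply: Nset_initial_final; rewrite ?size_s ?size_s'.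
have [x [Nq1x nx]] : grows t prec q.+1 by apply: k_casc; rewrite ltnS leqnn.
move: Nq1x; rewrite NsetS cstep_A => -[//|[i [j [[ni i_max] [[nj j_min] _]]]]].
have ltO := converse_strict_total_order gtO.
have /norP [ni_s ni_s'] : ~~ ((i \in s) || (i \in s')) by apply/negP => /Nq.
have /norP [nj_s nj_s'] : ~~ ((j \in s) || (j \in s')) by apply/negP => /Nq.
exists (rcons s i), (rcons s' j); rewrite !size_rcons size_s size_s'; split=> //.
  apply: initial_segment_rcons => // y ny /eqP neq_y; have [ys'|ny'] := boolP (y \in s').
    have /(gt_total gtO)/orP [//|gt_yi] : i != y by apply/eqP/nesym.
    by rewrite (s'_init.2 _ _ ys' gt_yi) in ni_s'.
  by apply: i_max => // /Nq/orP []; apply/negP.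
apply: (initial_segment_rcons ltO) => // y ny /eqP neq_y; have [ys|ny'] := boolP (y \in s).
  have /(gt_total gtO)/orP [gt_jy|//] : j != y by apply/eqP/nesym.
  by rewrite (s_init.2 _ _ ys gt_jy) in nj_s.
by apply: j_min => // /Nq/orP []; apply/negP.
Qed.
End TypeA.

Lemma dec_listing_sorted n S a s : dec_listing t prec n S a -> sorted gt s ->
  (forall x, S x <-> x \in s) -> mkseq a n = s.
Proof.
move=> [a_dec a_S] s_sorted S_s.
apply: (irr_sorted_eq (gt_trans gtO) (gt_irr gtO)) => // [|x].
  rewrite sorted_map; apply: (@sub_in_sorted _ [pred x | x < n]%N ltn).
  - by move=> i j _ ltjn ltij; apply: a_dec; apply/andP; split.
  - by apply/allP => x; rewrite mem_iota.
  - exact: iota_ltn_sorted.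
apply/mapP/idP.
  by case=> i; rewrite mem_iota => ltin ->; apply/S_s/a_S; exists i.
by move=> /S_s/a_S [i ltin <-]; exists i; rewrite ?mem_iota.
Qed.
End Cascade.

(** * The enveloping algebra *)

Definition proot_code (r : proot) : nat * (nat * nat) :=
  match r with
  | PM i j => (0, (i, j)) | PP i j => (1, (i, j))
  | PS i => (2, (i, 0)) | PL i => (3, (i, 0))
  end%N.
Definition proot_decode (c : nat * (nat * nat)) : proot :=
  match c.1 with
  | 0 => PM c.2.1 c.2.2 | 1 => PP c.2.1 c.2.2 | 2 => PS c.2.1 | _ => PL c.2.1
  end%N.
Lemma proot_codeK : cancel proot_code proot_decode. Proof. by case. Qed.
HB.instance Definition _ := Countable.copy proot (can_type proot_codeK).

Section TermChoice.
Variable F : Type.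
HB.instance Definition _ := gen_eqMixin (term F).
HB.instance Definition _ := gen_choiceMixin (term F).
End TermChoice.

Section EnvelopingAlgebra.
Local Open Scope quotient_scope.
Variables (F : fieldType) (t : ctype) (prec : rel sel).
Local Notation equ := (@equ F t prec).
Local Notation repr := generic_quotient.repr.
Implicit Types (a b : term F) (c d : F).

Definition equb a b : bool := `[< equ a b >].
Lemma equb_refl : reflexive equb.
Proof. by move=> a; apply/asboolP; constructor. Qed.
Lemma equb_sym : ssrbool.symmetric equb.
Proof. by move=> a b; apply/asboolP/asboolP; apply: Defs.eq_sym. Qed.
Lemma equb_trans : ssrbool.transitive equb.
Proof.
by move=> b a c /asboolP eq_ab /asboolP eq_bc; apply/asboolP; apply: Defs.eq_trans eq_ab eq_bc.
Qed.
Canonical equb_equiv := EquivRel equb equb_refl equb_sym equb_trans.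

Definition env := {eq_quot equb}.
HB.instance Definition _ := EqQuotient.on env.
HB.instance Definition _ := Choice.on env.
Implicit Types x y z : env.

Definition env_of a : env := \pi_env a.

Lemma env_ofP a b : env_of a = env_of b <-> equ a b.
Proof. by split=> [/eqmodP/asboolP|eq_ab] //; apply/eqmodP/asboolP. Qed.
Lemma equ_repr a : equ (repr (env_of a)) a.
Proof. by apply/env_ofP; rewrite /env_of reprK. Qed.
Lemma env_ind (Q : env -> Prop) : (forall a, Q (env_of a)) -> forall x, Q x.
Proof. by move=> Q_of x; rewrite -[x]reprK; apply: Q_of. Qed.

Definition eadd x y := env_of (Tadd (repr x) (repr y)).
Definition emul x y := env_of (Tmul (repr x) (repr y)).
Definition eopp x := env_of (Tmul (Tc (-1)) (repr x)).
Definition escale c x := env_of (Tmul (Tc c) (repr x)).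

Lemma eaddE a b : eadd (env_of a) (env_of b) = env_of (Tadd a b).
Proof. by apply/env_ofP; apply: eq_add; apply: equ_repr. Qed.
Lemma emulE a b : emul (env_of a) (env_of b) = env_of (Tmul a b).
Proof. by apply/env_ofP; apply: eq_mul; apply: equ_repr. Qed.
Lemma eoppE a : eopp (env_of a) = env_of (Tmul (Tc (-1)) a).
Proof. by apply/env_ofP; apply: eq_mul (equ_repr _); constructor. Qed.
Lemma escaleE c x : escale c x = emul (env_of (Tc c)) x.
Proof.
by elim/env_ind: x => a; rewrite emulE; apply/env_ofP; apply: eq_mul (equ_repr _); constructor.
Qed.

Lemma eaddA : associative eadd.
Proof.
elim/env_ind=> a; elim/env_ind=> b; elim/env_ind=> c.
by rewrite !eaddE; apply/env_ofP; constructor.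
Qed.
Lemma eaddC : commutative eadd.
Proof.
by elim/env_ind=> a; elim/env_ind=> b; rewrite !eaddE; apply/env_ofP; constructor.
Qed.
Lemma eadd0 : left_id (env_of (Tc 0)) eadd.
Proof. by elim/env_ind=> a; rewrite !eaddE; apply/env_ofP; constructor. Qed.
Lemma eaddN : left_inverse (env_of (Tc 0)) eopp eadd.
Proof.
by elim/env_ind=> a; rewrite eaddC eoppE eaddE; apply/env_ofP; constructor.
Qed.
HB.instance Definition _ := GRing.isZmodule.Build env eaddA eaddC eadd0 eaddN.

Lemma emulA : associative emul.
Proof.
elim/env_ind=> a; elim/env_ind=> b; elim/env_ind=> c.
by rewrite !emulE; apply/env_ofP; constructor.
Qed.
Lemma emul1l : left_id (env_of (Tc 1)) emul.
Proof. by elim/env_ind=> a; rewrite !emulE; apply/env_ofP; constructor. Qed.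
Lemma emul1r : right_id (env_of (Tc 1)) emul.
Proof. by elim/env_ind=> a; rewrite !emulE; apply/env_ofP; constructor. Qed.
Lemma emulDl : left_distributive emul eadd.
Proof.
elim/env_ind=> a; elim/env_ind=> b; elim/env_ind=> c.
by rewrite !(emulE, eaddE); apply/env_ofP; constructor.
Qed.
Lemma emulDr : right_distributive emul eadd.
Proof.
elim/env_ind=> a; elim/env_ind=> b; elim/env_ind=> c.
by rewrite !(emulE, eaddE); apply/env_ofP; constructor.
Qed.

Fixpoint augmentation (a : term F) : F :=
  match a with
  | Tc c => c
  | Tg _ => 0
  | Tadd a b => augmentation a + augmentation b
  | Tmul a b => augmentation a * augmentation b
  end.

Lemma equ_augmentation a b : equ a b -> augmentation a = augmentation b.
Proof.
elim=> {a b} /=; try by move=> *; first [congruence | ring].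
move=> r s L _ _ _ _; rewrite !(mulr0, addr0).
by elim: L => //= e L <-; rewrite mulr0 addr0.
Qed.

Lemma env_oner_neq0 : env_of (Tc 1) != env_of (Tc 0).
Proof.
by apply/eqP => /env_ofP/equ_augmentation /= /eqP; rewrite oner_eq0.
Qed.
HB.instance Definition _ :=
  GRing.Zmodule_isNzRing.Build env emulA emul1l emul1r emulDl emulDr env_oner_neq0.

Lemma env_ofD a b : env_of (Tadd a b) = env_of a + env_of b.
Proof. by rewrite -eaddE. Qed.
Lemma env_ofM a b : env_of (Tmul a b) = env_of a * env_of b.
Proof. by rewrite -emulE. Qed.
Lemma env_of0 : env_of (Tc 0) = 0. Proof. by []. Qed.
Lemma env_of_const_comm c x : env_of (Tc c) * x = x * env_of (Tc c).
Proof. by elim/env_ind: x => a; rewrite -!env_ofM; apply/env_ofP; constructor. Qed.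

Lemma escaleA c d x : escale c (escale d x) = escale (c * d) x.
Proof.
rewrite !escaleE emulA emulE; congr emul.
by apply/env_ofP/Defs.eq_sym; constructor.
Qed.
Lemma escale1 : left_id 1 escale.
Proof. by move=> x; rewrite escaleE emul1l. Qed.
Lemma escaleDr : right_distributive escale +%R.
Proof. by move=> c x y; rewrite !escaleE; apply: emulDr. Qed.
Lemma escaleDl x : {morph escale^~ x : c d / c + d}.
Proof.
move=> c d; rewrite !escaleE -[RHS]emulDl; congr emul.
by rewrite eaddE; apply/env_ofP; constructor.
Qed.
HB.instance Definition _ :=
  GRing.Zmodule_isLmodule.Build F env escaleA escale1 escaleDr escaleDl.

Lemma scale_env_of c x : c *: x = env_of (Tc c) * x.
Proof. exact: escaleE. Qed.
Lemma escaleAl c x y : c *: (x * y) = (c *: x) * y.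
Proof. by rewrite !scale_env_of mulrA. Qed.
HB.instance Definition _ := GRing.Lmodule_isLalgebra.Build F env escaleAl.
Lemma escaleAr c x y : c *: (x * y) = x * (c *: y).
Proof. by rewrite !scale_env_of !mulrA env_of_const_comm. Qed.
HB.instance Definition _ := GRing.Lalgebra_isAlgebra.Build F env escaleAr.

Lemma env_of_const c : env_of (Tc c) = c%:A.
Proof. by rewrite scale_env_of mulr1. Qed.
Lemma env_of_scale c a : env_of (tscale c a) = c *: env_of a.
Proof. by rewrite env_ofM env_of_const mulr_algl. Qed.
Lemma env_of_tsum s : env_of (tsum s) = \sum_(a <- s) env_of a.
Proof. by elim: s => [|a s IHs]; rewrite ?big_nil ?big_cons //= env_ofD IHs. Qed.

Definition gen (r : proot) : env := env_of (Tg r).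

Lemma gen_invalid r : ~~ valid t prec r -> gen r = 0.
Proof. by move=> r_invalid; rewrite -env_of0; apply/env_ofP; constructor. Qed.

Lemma centralP a : central t prec a <-> forall x, env_of a * x = x * env_of a.
Proof.
split=> [a_central|a_comm u]; last by apply/env_ofP; rewrite !env_ofM.
by elim/env_ind=> u; rewrite -!env_ofM; apply/env_ofP.
Qed.

Lemma commute_of_gens z :
  (forall r, valid t prec r -> gen r * z = z * gen r) -> forall x, z * x = x * z.
Proof.
move=> z_comm; elim/env_ind; elim=> [c|r|a IHa b IHb|a IHa b IHb].
- by rewrite env_of_const_comm.
- have [/z_comm //|/gen_invalid r0] := boolP (valid t prec r).
  by rewrite -/(gen r) r0 mul0r mulr0.
- by rewrite env_ofD mulrDr mulrDl IHa IHb.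
- by rewrite env_ofM mulrA IHa -mulrA IHb mulrA.
Qed.
End EnvelopingAlgebra.

(** * Brackets and weights of root vectors *)

Definition position (r : proot) : sel * sel :=
  match r with
  | PM i j => (P i, P j) | PP i j => (P i, N j)
  | PS i => (P i, None) | PL i => (P i, N i)
  end.

Definition sel_weight (x : sel) (k : nat) : int :=
  match x with
  | Some (true, i) => (i == k : nat)%:Z
  | Some (false, i) => - (i == k : nat)%:Z
  | None => 0
  end.

Definition root_weight (r : proot) (k : nat) : int :=
  sel_weight (position r).1 k - sel_weight (position r).2 k.

Definition root_support (r : proot) : seq nat :=
  match r with PM i j | PP i j => [:: i; j] | PS i | PL i => [:: i] end.

Section Weights.
Variables (t : ctype) (prec : rel sel).
Local Notation gt := (gtth t prec).
Hypothesis gtO : strict_total_order gt.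
Local Notation valid := (valid t prec).
Implicit Types r s : proot.

Lemma valid_PP_neq i j : valid (PP i j) -> i != j.
Proof. by case/andP => _; apply: gt_neq. Qed.

Lemma root_weight_inj r s :
  valid r -> valid s -> root_weight r =1 root_weight s -> r = s.
Proof.
case: r s => [i j|i j|i|i] [k l|k l|k|k] vr vs eq_rs.
- have neq_ij := gt_neq gtO vr.
  have ek : k = i by move: (eq_rs i) neq_ij; rewrite /root_weight /= eqxx; lia.
  by have := eq_rs j; rewrite /root_weight /= ek eqxx => ?; congr PM; lia.
- by have := eq_rs j; have := gt_neq gtO vr; rewrite /root_weight /= eqxx; lia.
- by have := eq_rs j; have := gt_neq gtO vr; rewrite /root_weight /= eqxx; lia.
- by have := eq_rs j; have := gt_neq gtO vr; rewrite /root_weight /= eqxx; lia.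
- by have := eq_rs l; have := gt_neq gtO vs; rewrite /root_weight /= eqxx; lia.
- have neq_ij := valid_PP_neq vr; have eq_i := eq_rs i; have eq_j := eq_rs j.
  have : k = i \/ l = i by move: eq_i neq_ij; rewrite /root_weight /= eqxx; lia.
  case=> e; subst; last first.
    have ek : k = j by move: eq_j neq_ij; rewrite /root_weight /= eqxx; lia.
    by case/andP: vr vs => _ gt_ij /andP [_]; rewrite ek (gt_asym gtO gt_ij).
  by congr PP; move: eq_j neq_ij; rewrite /root_weight /= eqxx; lia.
- have := eq_rs i; have := eq_rs j; have := valid_PP_neq vr.
  by rewrite /root_weight /= !eqxx; lia.
- by have := eq_rs i; have := valid_PP_neq vr; rewrite /root_weight /= eqxx; lia.
- by have := eq_rs l; have := gt_neq gtO vs; rewrite /root_weight /= eqxx; lia.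
- have := eq_rs k; have := eq_rs l; have := valid_PP_neq vs.
  by rewrite /root_weight /= !eqxx; lia.
- by have := eq_rs i; rewrite /root_weight /= eqxx => ?; congr PS; lia.
- by have := eq_rs i; rewrite /root_weight /= eqxx; lia.
- by have := eq_rs l; have := gt_neq gtO vs; rewrite /root_weight /= eqxx; lia.
- by have := eq_rs k; have := valid_PP_neq vs; rewrite /root_weight /= eqxx; lia.
- by have := eq_rs k; rewrite /root_weight /= eqxx; lia.
- by have := eq_rs i; rewrite /root_weight /= eqxx => ?; congr PL; lia.
Qed.

Lemma mem_root_support r k : valid r -> (k \in root_support r) = (root_weight r k != 0).
Proof.
rewrite /root_weight; case: r => [i j|i j|i|i] vr; rewrite /= !inE.
- by have := gt_neq gtO vr; lia.
- by lia.
- by lia.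
- by lia.
Qed.
End Weights.

Section Bracket.
Variables (F : fieldType) (t : ctype) (prec : rel sel).
Local Notation gt := (gtth t prec).
Hypothesis gtO : strict_total_order gt.
Local Notation valid := (valid t prec).
Local Notation lincomb := (seq (F * proot)).
Implicit Types (r s : proot) (L : lincomb) (x y : sel).

(* The sign of the invariant bilinear form under transposition: symplectic in
   type C, orthogonal in types B and D. *)
Definition form_sign : F := if ctype_eqb t TC then 1 else -1.

Lemma form_sign_sq : form_sign * form_sign = 1.
Proof. by rewrite /form_sign; case: ifP => _; ring. Qed.

(* The matrix E_{i,-j} + form_sign E_{j,-i} in terms of root vectors. *)
Definition sum_root (i j : nat) : lincomb :=
  if gt i j then [:: (1, PP i j)]
  else if gt j i then [:: (form_sign, PP j i)]
  else if ctype_eqb t TC then [:: (2, PL i)] else [::].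

Definition lincomb_opp L : lincomb := [seq (- e.1, e.2) | e <- L].

Definition bracket r s : lincomb :=
  match r, s with
  | PM i j, PM k l => (if j == k then [:: (1, PM i l)] else [::])
                      ++ (if l == i then [:: (-1, PM k j)] else [::])
  | PM i j, PP k l => (if j == k then sum_root i l else [::])
                      ++ (if j == l then sum_root k i else [::])
  | PM i j, PL k => if j == k then sum_root i k else [::]
  | PM i j, PS k => if j == k then [:: (1, PS i)] else [::]
  | PP k l, PM i j => lincomb_opp ((if j == k then sum_root i l else [::])
                      ++ (if j == l then sum_root k i else [::]))
  | PL k, PM i j => lincomb_opp (if j == k then sum_root i k else [::])
  | PS k, PM i j => lincomb_opp (if j == k then [:: (1, PS i)] else [::])
  | PS i, PS j => lincomb_opp (sum_root i j)
  | _, _ => [::]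
  end.

Lemma all_if (b : bool) (Q : pred (F * proot)) L :
  (b -> all Q L) -> all Q (if b then L else [::]).
Proof. by case: b => // ->. Qed.

Lemma all_lincomb_opp (Q : pred proot) L :
  all (fun e => Q e.2) (lincomb_opp L) = all (fun e => Q e.2) L.
Proof. by rewrite all_map. Qed.

Lemma sum_root_valid i j :
  ~~ ctype_eqb t TA -> all (fun e => valid e.2) (sum_root i j).
Proof.
move=> not_A; rewrite /sum_root; case: ifP => [|_] /=; first by rewrite not_A => ->.
case: ifP => [|_] /=; first by rewrite not_A => ->.
by case: ifP => //= ->.
Qed.

Lemma bracket_valid r s : valid r -> valid s -> all (fun e => valid e.2) (bracket r s).
Proof.
have C_not_A : ctype_eqb t TC -> ~~ ctype_eqb t TA by case: t.
have B_not_A : ctype_eqb t TB -> ~~ ctype_eqb t TA by case: t.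
case: r s => [i j|i j|i|i] [k l|k l|k|k] //= vr vs;
  rewrite ?all_lincomb_opp ?all_cat ?sum_root_valid ?B_not_A //.
- rewrite !all_if //= => /eqP e; rewrite andbT.
    by apply: (gt_trans gtO vs); rewrite e.
  by apply: (gt_trans gtO vr); rewrite e.
- by case/andP: vs => not_A _; rewrite !all_if // => _; rewrite sum_root_valid.
- by apply: all_if => _ /=; rewrite vs.
- by apply: all_if => _; rewrite sum_root_valid ?C_not_A.
- by case/andP: vr => not_A _; rewrite !all_if // => _; rewrite sum_root_valid.
- by rewrite all_if //= vr.
- by apply: all_if => _; rewrite sum_root_valid ?C_not_A.
Qed.

Lemma sum_root_weight i j k :
  all (fun e => root_weight e.2 k == (i == k : nat)%:Z + (j == k : nat)%:Z) (sum_root i j).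
Proof.
rewrite /sum_root; case: ifP => [_|ngt_ij]; first by rewrite /= /root_weight /= opprK eqxx.
case: ifP => [_|ngt_ji]; first by rewrite /= /root_weight /= opprK addrC eqxx.
case: ifP => // _; rewrite /= /root_weight /= opprK.
have [->|/(gt_total gtO)] := eqVneq i j; first by rewrite eqxx.
by rewrite ngt_ij ngt_ji.
Qed.

Lemma bracket_weight r s k :
  all (fun e => root_weight e.2 k == root_weight r k + root_weight s k) (bracket r s).
Proof.
have opp_all (c : int) L : all (fun e => root_weight e.2 k == c) L ->
    all (fun e => root_weight e.2 k == c) (lincomb_opp L) by rewrite all_map.
have sum_all (i j : nat) (c : int) : (i == k : nat)%:Z + (j == k : nat)%:Z = c ->
    all (fun e => root_weight e.2 k == c) (sum_root i j) by move=> <-; apply: sum_root_weight.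
case: r s => [i j|i j|i|i] [k' l|k' l|k'|k'] //=; do ?apply: opp_all;
  rewrite ?all_cat /root_weight /= ?opprK ?subr0.
- by apply/andP; split; apply: all_if => /eqP <- /=; apply/andP; split=> //; apply/eqP; ring.
- by apply/andP; split; apply: all_if => /eqP <-; apply: sum_all; ring.
- by apply: all_if => /eqP <- /=; apply/andP; split=> //; apply/eqP; ring.
- by apply: all_if => /eqP <-; apply: sum_all; ring.
- by apply/andP; split; apply: all_if => /eqP <-; apply: sum_all; ring.
- by apply: all_if => /eqP <- /=; apply/andP; split=> //; apply/eqP; ring.
- exact: sum_all.
- by apply: all_if => /eqP <-; apply: sum_all; ring.
Qed.

Lemma mentryE (M : fmat F) x y :
  mentry M x y = \sum_(e <- M) e.1.1 * (e.1.2 == x)%:R * (e.2 == y)%:R.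
Proof.
apply: eq_bigr => e _; case: (_ == x); case: (_ == y); rewrite ?mulr1 ?mulr0 ?mul0r //.
Qed.

Lemma mentry_mmul (A B : fmat F) x y : mentry (mmul A B) x y =
  \sum_(a <- A) \sum_(b <- B)
     a.1.1 * b.1.1 * (a.1.2 == x)%:R * (a.2 == b.1.2)%:R * (b.2 == y)%:R.
Proof.
rewrite mentryE /mmul big_flatten big_map; apply: eq_bigr => a _.
rewrite big_map big_filter big_mkcond; apply: eq_bigr => b _.
by case: ifP => _ /=; rewrite ?mulr1 ?mulr0 ?mul0r.
Qed.

Definition comm_entry (A B : fmat F) x y := mentry (mmul A B) x y - mentry (mmul B A) x y.
Definition lincomb_entry L x y := \sum_(e <- L) e.1 * mentry (rmat F t e.2) x y.

Lemma comm_entryC A B x y : comm_entry B A x y = - comm_entry A B x y.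
Proof. by rewrite /comm_entry opprB. Qed.

Lemma lincomb_entry_cat L L' x y :
  lincomb_entry (L ++ L') x y = lincomb_entry L x y + lincomb_entry L' x y.
Proof. exact: big_cat. Qed.
Lemma lincomb_entry_opp L x y : lincomb_entry (lincomb_opp L) x y = - lincomb_entry L x y.
Proof. by rewrite /lincomb_entry big_map -sumrN; apply: eq_bigr => e _; rewrite mulNr. Qed.
Lemma lincomb_entry_if (b : bool) L x y :
  lincomb_entry (if b then L else [::]) x y = b%:R * lincomb_entry L x y.
Proof. by case: b; rewrite ?mul1r // /lincomb_entry big_nil mul0r. Qed.
Lemma lincomb_entry1 c r x y : lincomb_entry [:: (c, r)] x y = c * mentry (rmat F t r) x y.
Proof. exact: big_seq1. Qed.

Lemma PP_mat i j : rmat F t (PP i j) = [:: (1, P i, N j); (form_sign, P j, N i)].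
Proof. by rewrite /rmat /form_sign; case: ifP. Qed.

Lemma PM_mat i j : ~~ ctype_eqb t TA -> rmat F t (PM i j) = [:: (1, P i, P j); (-1, N j, N i)].
Proof. by rewrite /rmat => /negbTE ->. Qed.

Lemma lincomb_entry_sum_root i j x y : lincomb_entry (sum_root i j) x y =
  (P i == x)%:R * (N j == y)%:R + form_sign * (P j == x)%:R * (N i == y)%:R.
Proof.
rewrite /sum_root; case: ifP => [_|ngt_ij].
  by rewrite lincomb_entry1 mentryE PP_mat !big_cons big_nil /=; ring.
case: ifP => [_|ngt_ji].
  rewrite lincomb_entry1 mentryE PP_mat !big_cons big_nil /=.
  by rewrite addr0 mulrDr !mulrA form_sign_sq; ring.
have -> : i = j.
  by apply/eqP; apply/negPn/negP => /(gt_total gtO); rewrite ngt_ij ngt_ji.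
rewrite /form_sign; case: ifP => _; last by rewrite /lincomb_entry big_nil; ring.
by rewrite lincomb_entry1 mentryE !big_cons big_nil /=; ring.
Qed.

Lemma sel_PP i j : (P i == P j) = (i == j). Proof. by []. Qed.
Lemma sel_NN i j : (N i == N j) = (i == j). Proof. by []. Qed.
Lemma sel_PN i j : (P i == N j) = false. Proof. by []. Qed.
Lemma sel_NP i j : (N i == P j) = false. Proof. by []. Qed.
Lemma sel_P0 i : (P i == None) = false. Proof. by []. Qed.
Lemma sel_N0 i : (N i == None) = false. Proof. by []. Qed.
Lemma sel_0P i : (None == P i) = false. Proof. by []. Qed.
Lemma sel_0N i : (None == N i) = false. Proof. by []. Qed.
Definition sel_eqE := (sel_PP, sel_NN, sel_PN, sel_NP, sel_P0, sel_N0, sel_0P, sel_0N).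

Lemma comm_entryE A B x y : comm_entry A B x y =
  \sum_(a <- A) \sum_(b <- B)
    a.1.1 * b.1.1 * (a.1.2 == x)%:R * (a.2 == b.1.2)%:R * (b.2 == y)%:R
  - \sum_(b <- B) \sum_(a <- A)
    b.1.1 * a.1.1 * (b.1.2 == x)%:R * (b.2 == a.1.2)%:R * (a.2 == y)%:R.
Proof. by rewrite /comm_entry !mentry_mmul. Qed.

Lemma comm_PM_PM i j k l x y :
  comm_entry (rmat F t (PM i j)) (rmat F t (PM k l)) x y
  = lincomb_entry (bracket (PM i j) (PM k l)) x y.
Proof.
rewrite /= lincomb_entry_cat !lincomb_entry_if !lincomb_entry1 comm_entryE !mentryE /rmat.
case: ifP => _; rewrite !big_cons !big_nil /= ?sel_eqE.
  by case: (j =P k) => [<-|_]; case: (l =P i) => [<-|_]; ring.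
rewrite [i == l]eq_sym [k == j]eq_sym.
by case: (j =P k) => [<-|_]; case: (l =P i) => [<-|_]; ring.
Qed.

Lemma comm_PM_PP i j k l x y : ~~ ctype_eqb t TA ->
  comm_entry (rmat F t (PM i j)) (rmat F t (PP k l)) x y
  = lincomb_entry (bracket (PM i j) (PP k l)) x y.
Proof.
move=> not_A; rewrite /bracket lincomb_entry_cat !lincomb_entry_if !lincomb_entry_sum_root.
rewrite comm_entryE PM_mat // PP_mat !big_cons !big_nil /= ?sel_eqE.
rewrite [l == j]eq_sym [k == j]eq_sym.
by rewrite /form_sign; case: ifP => _;
  case: (j =P k) => [<-|_]; case: (j =P l) => [<-|_]; ring.
Qed.

Lemma comm_PM_PS i j k x y : ctype_eqb t TB ->
  comm_entry (rmat F t (PM i j)) (rmat F t (PS k)) x y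
  = lincomb_entry (bracket (PM i j) (PS k)) x y.
Proof.
move=> is_B; have not_A : ~~ ctype_eqb t TA by case: t is_B.
rewrite /bracket lincomb_entry_if lincomb_entry1 comm_entryE mentryE PM_mat //.
rewrite !big_cons !big_nil /= ?sel_eqE [k == j]eq_sym.
by case: (j =P k) => [<-|_]; ring.
Qed.

Lemma comm_PM_PL i j k x y : ctype_eqb t TC ->
  comm_entry (rmat F t (PM i j)) (rmat F t (PL k)) x y
  = lincomb_entry (bracket (PM i j) (PL k)) x y.
Proof.
move=> is_C; have not_A : ~~ ctype_eqb t TA by case: t is_C.
rewrite /bracket lincomb_entry_if lincomb_entry_sum_root comm_entryE PM_mat //.
rewrite !big_cons !big_nil /= ?sel_eqE [k == j]eq_sym /form_sign is_C.
by case: (j =P k) => [<-|_]; ring.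
Qed.

Lemma comm_PS_PS i j x y : ctype_eqb t TB ->
  comm_entry (rmat F t (PS i)) (rmat F t (PS j)) x y
  = lincomb_entry (bracket (PS i) (PS j)) x y.
Proof.
move=> is_B; rewrite /bracket lincomb_entry_opp lincomb_entry_sum_root comm_entryE.
rewrite !big_cons !big_nil /= ?sel_eqE /form_sign.
by have -> : ctype_eqb t TC = false; [case: t is_B|ring].
Qed.

Definition is_sum_root r := match r with PP _ _ | PL _ => true | _ => false end.
Definition is_difference_root r := if r is PM _ _ then true else false.

Lemma comm_sum_root r s x y : is_sum_root r -> ~~ is_difference_root s ->
  comm_entry (rmat F t r) (rmat F t s) x y = 0.
Proof.
case: r s => [//|i j|//|i] [//|k l|k|k] _ _;
  by rewrite comm_entryE ?PP_mat !big_cons !big_nil /= ?sel_eqE; ring.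
Qed.

Lemma comm_entry_bracket r s x y : valid r -> valid s ->
  comm_entry (rmat F t r) (rmat F t s) x y = lincomb_entry (bracket r s) x y.
Proof.
have swap r' s' : bracket s' r' = lincomb_opp (bracket r' s') ->
    comm_entry (rmat F t r') (rmat F t s') x y = lincomb_entry (bracket r' s') x y ->
    comm_entry (rmat F t s') (rmat F t r') x y = lincomb_entry (bracket s' r') x y.
  by move=> -> comm_rs; rewrite comm_entryC comm_rs lincomb_entry_opp.
case: r s => [i j|i j|i|i] [k l|k l|k|k] vr vs;
  try by rewrite comm_sum_root // /lincomb_entry big_nil.
- exact: comm_PM_PM.
- by apply: comm_PM_PP; case/andP: vs.
- exact: comm_PM_PS.
- exact: comm_PM_PL.
- by apply: swap => //; apply: comm_PM_PP; case/andP: vr.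
- by apply: swap => //; apply: comm_PM_PS.
- by rewrite comm_entryC comm_sum_root // oppr0 /lincomb_entry big_nil.
- exact: comm_PS_PS.
- by case: t vr vs.
- by apply: swap => //; apply: comm_PM_PL.
Qed.

Lemma gen_bracket r s : valid r -> valid s ->
  gen F t prec r * gen F t prec s - gen F t prec s * gen F t prec r
  = \sum_(e <- bracket r s) e.1 *: gen F t prec e.2.
Proof.
move=> vr vs; rewrite /gen -!env_ofM -scaleN1r -env_of_scale -env_ofD.
have /env_ofP -> := eq_lie vr vs (bracket_valid vr vs)
  (fun x y => comm_entry_bracket x y vr vs).
by rewrite env_of_tsum big_map; apply: eq_bigr => e _; rewrite env_of_scale.
Qed.
End Bracket.

(** * Noncommutative polynomials in the root vectors *)

Notation ncpoly F := (seq (F * seq proot)).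

Section NoncommutativePolynomials.
Variable F : fieldType.
Implicit Types (S T : ncpoly F) (Q : pred proot) (w : seq proot).

Definition ncscale (c : F) T : ncpoly F := [seq (c * e.1, e.2) | e <- T].
Definition ncmul S T : ncpoly F := [seq (a.1 * b.1, a.2 ++ b.2) | a <- S, b <- T].
Definition ncsub S T : ncpoly F := S ++ ncscale (-1) T.
Definition letters Q T := all (fun e => all Q e.2) T.
Definition homog_part (d : nat) T := [seq e <- T | size e.2 == d].

Lemma letters_cat Q S T : letters Q (S ++ T) = letters Q S && letters Q T.
Proof. exact: all_cat. Qed.
Lemma letters_scale Q c T : letters Q (ncscale c T) = letters Q T.
Proof. by rewrite /letters all_map; apply: eq_all. Qed.
Lemma letters_ncsub Q S T : letters Q (ncsub S T) = letters Q S && letters Q T.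
Proof. by rewrite letters_cat letters_scale. Qed.
Lemma letters_ncmul Q S T : letters Q S -> letters Q T -> letters Q (ncmul S T).
Proof.
move=> /allP Q_S /allP Q_T; apply/allP => _ /allpairsP [[a b] [/= Sa Tb ->]] /=.
by rewrite all_cat (Q_S _ Sa) (Q_T _ Tb).
Qed.
Lemma letters_subset Q (Q' : pred proot) T : {subset Q <= Q'} -> letters Q T -> letters Q' T.
Proof. by move=> subQ; apply: sub_all => e; apply: sub_all => r; apply: subQ. Qed.
Lemma letters_filter Q (p : pred (F * seq proot)) T : letters Q T -> letters Q (filter p T).
Proof. by rewrite /letters all_filter; apply: sub_all => e /= ->; rewrite implybT. Qed.

Section Evaluation.
Variables (A : comNzRingType) (iota : F -> A) (v : proot -> A).

Definition weval w : A := \prod_(r <- w) v r.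
Definition nceval T : A := \sum_(e <- T) iota e.1 * weval e.2.

Lemma weval_nil : weval [::] = 1. Proof. exact: big_nil. Qed.
Lemma weval_cons r w : weval (r :: w) = v r * weval w. Proof. exact: big_cons. Qed.
Lemma weval_cat w w' : weval (w ++ w') = weval w * weval w'. Proof. exact: big_cat. Qed.
Lemma nceval_cat S T : nceval (S ++ T) = nceval S + nceval T. Proof. exact: big_cat. Qed.
Lemma nceval_filter (p : pred (F * seq proot)) T :
  nceval T = nceval (filter p T) + nceval (filter (predC p) T).
Proof. by rewrite /nceval !big_filter; apply: (bigID p). Qed.
End Evaluation.

Local Notation ev := (nceval idfun).

Lemma nceval_scale (v : proot -> F) c T : ev v (ncscale c T) = c * ev v T.
Proof. by rewrite /nceval big_map mulr_sumr; apply: eq_bigr => e _; rewrite mulrA. Qed.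
Lemma nceval_ncsub (v : proot -> F) S T : ev v (ncsub S T) = ev v S - ev v T.
Proof. by rewrite nceval_cat nceval_scale mulN1r. Qed.
Lemma nceval_ncmul (v : proot -> F) S T : ev v (ncmul S T) = ev v S * ev v T.
Proof.
rewrite /nceval big_allpairs_dep mulr_suml; apply: eq_bigr => a _.
rewrite mulr_sumr; apply: eq_bigr => b _ /=.
by rewrite weval_cat; ring.
Qed.

Lemma eq_nceval Q T (v v' : proot -> F) :
  letters Q T -> (forall r, Q r -> v r = v' r) -> ev v T = ev v' T.
Proof.
move=> /allP Q_T eq_v; apply: eq_big_seq => e /Q_T /allP Qe; congr (_ * _).
by apply: eq_big_seq => r /Qe /eq_v.
Qed.

Lemma nceval_morph (A B : comNzRingType) (iota : F -> A) (f : {rmorphism A -> B}) v T :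
  f (nceval iota v T) = nceval (f \o iota) (f \o v) T.
Proof.
rewrite rmorph_sum; apply: eq_bigr => e _; rewrite rmorphM; congr (_ * _).
exact: rmorph_prod.
Qed.

Section Derivation.
Variables (v h : proot -> F).

Fixpoint wderiv w : F :=
  if w is r :: w' then h r * weval v w' + v r * wderiv w' else 0.
Definition ncderiv T : F := \sum_(e <- T) e.1 * wderiv e.2.

Lemma wderiv_cat w w' : wderiv (w ++ w') = wderiv w * weval v w' + weval v w * wderiv w'.
Proof.
elim: w => [|r w IHw] /=; first by rewrite weval_nil; ring.
by rewrite IHw weval_cat weval_cons; ring.
Qed.
Lemma ncderiv_cat S T : ncderiv (S ++ T) = ncderiv S + ncderiv T.
Proof. exact: big_cat. Qed.
Lemma ncderiv_scale c T : ncderiv (ncscale c T) = c * ncderiv T.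
Proof. by rewrite /ncderiv big_map mulr_sumr; apply: eq_bigr => e _; rewrite mulrA. Qed.
Lemma ncderiv_ncsub S T : ncderiv (ncsub S T) = ncderiv S - ncderiv T.
Proof. by rewrite ncderiv_cat ncderiv_scale mulN1r. Qed.
Lemma ncderiv_ncmul S T : ncderiv (ncmul S T) = ncderiv S * ev v T + ev v S * ncderiv T.
Proof.
rewrite /ncderiv /nceval big_allpairs_dep !mulr_suml -big_split /=.
apply: eq_bigr => a _; rewrite !mulr_sumr -big_split /=.
by apply: eq_bigr => b _; rewrite wderiv_cat; ring.
Qed.
End Derivation.

Lemma eq_ncderiv Q T v v' h h' : letters Q T ->
  (forall r, Q r -> v r = v' r) -> (forall r, Q r -> h r = h' r) ->
  ncderiv v h T = ncderiv v' h' T.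
Proof.
move=> /allP Q_T eq_v eq_h; apply: eq_big_seq => e /Q_T; move: e => [c w] /= Qw.
congr (_ * _); elim: w Qw => [//|r w IHw] /= /andP [Qr Qw].
rewrite IHw // eq_v // eq_h //; congr (_ * _ + _).
by apply: eq_big_seq => s /(allP Qw)/eq_v.
Qed.

Lemma ncderiv_linear v h h' c T :
  ncderiv v (fun r => c * h r + h' r) T = c * ncderiv v h T + ncderiv v h' T.
Proof.
rewrite /ncderiv mulr_sumr -big_split /=; apply: eq_bigr => -[c' w] _ /=.
suff -> : wderiv v (fun r => c * h r + h' r) w = c * wderiv v h w + wderiv v h' w by ring.
by elim: w => [|r w IHw] /=; rewrite ?IHw; ring.
Qed.

Lemma ncderiv0 v T : ncderiv v (fun=> 0) T = 0.
Proof.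
rewrite /ncderiv big1 // => -[c w] _ /=.
suff -> : wderiv v (fun=> 0) w = 0 by rewrite mulr0.
by elim: w => [|r w IHw] //=; rewrite IHw; ring.
Qed.

Lemma ncderiv_sum (I : Type) (s : seq I) (c : I -> F) (h : I -> proot -> F) v T :
  ncderiv v (fun r => \sum_(i <- s) c i * h i r) T = \sum_(i <- s) c i * ncderiv v (h i) T.
Proof.
elim: s => [|i s IHs].
  rewrite big_nil -[RHS](ncderiv0 v T); congr (ncderiv _ _ T).
  by apply: funext => r; rewrite big_nil.
rewrite big_cons -IHs -ncderiv_linear; congr (ncderiv _ _ T).
by apply: funext => r; rewrite big_cons.
Qed.

Lemma horner_nceval (g : proot -> {poly F}) T c :
  (nceval polyC g T).[c] = ev (fun r => (g r).[c]) T.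
Proof.
rewrite /nceval horner_sum; apply: eq_bigr => e _.
by rewrite hornerM hornerC /weval horner_prod.
Qed.

Lemma deriv_nceval (g : proot -> {poly F}) T c :
  (nceval polyC g T)^`().[c] = ncderiv (fun r => (g r).[c]) (fun r => (g r)^`().[c]) T.
Proof.
rewrite /nceval raddf_sum horner_sum; apply: eq_bigr => -[a w] _ /=.
rewrite derivM derivC mul0r add0r hornerM hornerC; congr (_ * _).
elim: w => [|r w IHw]; first by rewrite weval_nil -[1]/(1%:P) derivC hornerC.
by rewrite weval_cons derivM hornerD !hornerM IHw /weval /= horner_prod.
Qed.
End NoncommutativePolynomials.

Notation ev := (nceval idfun).

Definition jet (F : nzRingType) (v h k : proot -> F) (s : F) : proot -> F :=
  fun r => v r + s * h r + s ^+ 2 * k r.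

Section Curves.
Variable F : numFieldType.
Implicit Types (T : ncpoly F) (v h k : proot -> F) (s : F).

Definition jet_poly v h k r : {poly F} := (v r)%:P + (h r)%:P * 'X + (k r)%:P * 'X^2.

Lemma horner_jet_poly v h k r s : (jet_poly v h k r).[s] = jet v h k s r.
Proof.
by rewrite /jet_poly !hornerD !hornerM !hornerC !hornerX /jet; ring.
Qed.

Lemma deriv_jet_poly v h k r s : (jet_poly v h k r)^`().[s] = h r + s * (k r *+ 2).
Proof.
rewrite /jet_poly expr2 !derivD !derivM !derivC !derivX.
by rewrite !(hornerD, hornerM, hornerC, hornerX); ring.
Qed.

Lemma nceval_jet_poly v h k T s : (nceval polyC (jet_poly v h k) T).[s] = ev (jet v h k s) T.
Proof.
by rewrite horner_nceval; congr (nceval _ _ T); apply: funext => r; apply: horner_jet_poly.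
Qed.

Lemma deriv_nceval_jet v h k T s : (nceval polyC (jet_poly v h k) T)^`().[s] =
  ncderiv (jet v h k s) (fun r => h r + s * (k r *+ 2)) T.
Proof.
rewrite deriv_nceval; congr (ncderiv _ _ T); apply: funext => r.
  exact: horner_jet_poly.
exact: deriv_jet_poly.
Qed.

Lemma jet0 v h k : jet v h k 0 = v.
Proof. by apply: funext => r; rewrite /jet; ring. Qed.

Lemma nceval_jet_const v h k T :
  (forall s, ncderiv (jet v h k s) (fun r => h r + s * (k r *+ 2)) T = 0) ->
  forall s, ev (jet v h k s) T = ev v T.
Proof.
move=> dT0 s; rewrite -nceval_jet_poly (@deriv_eq0_const _ _ _ s 0).
  by rewrite nceval_jet_poly jet0.
by move=> x; rewrite deriv_nceval_jet.
Qed.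

Lemma ncderiv_jet_const v h k T :
  (forall s, ev (jet v h k s) T = ev v T) -> ncderiv v h T = 0.
Proof.
move=> evT; have /(congr1 (fun p : {poly F} => p^`().[0])) :
    nceval polyC (jet_poly v h k) T = (ev v T)%:P.
  apply/eqP; rewrite -subr_eq0; apply/eqP/poly_fun_eq0 => s _.
  by rewrite hornerD hornerN hornerC nceval_jet_poly evT subrr.
rewrite derivC horner0 deriv_nceval_jet jet0 => dT0; rewrite -[RHS]dT0.
by congr (ncderiv _ _ T); apply: funext => r; ring.
Qed.

Lemma eq_ncderiv_of_eval v h S T : (forall v, ev v S = ev v T) -> ncderiv v h S = ncderiv v h T.
Proof.
move=> eqST; apply/eqP; rewrite -subr_eq0 -ncderiv_ncsub.
by apply/eqP/(@ncderiv_jet_const _ _ (fun=> 0)) => s; rewrite !nceval_ncsub !eqST !subrr.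
Qed.

Lemma nceval_line v h T : exists p : {poly F}, forall s,
  ev (fun r => v r + s * h r) T = p.[s].
Proof.
exists (nceval polyC (jet_poly v h (fun=> 0)) T) => s.
rewrite nceval_jet_poly; congr (nceval _ _ T); apply: funext => r.
by rewrite /jet mulr0 addr0.
Qed.
End Curves.

Section WordMultiplicities.
Variables (F : numFieldType) (L : seq proot).
Implicit Types w : seq proot.

Definition word_mnm w : 'X_{1..size L} :=
  [multinom count_mem (tnth (in_tuple L) i) w | i < size L].

Lemma word_mnm_perm w w' : {subset w <= L} -> {subset w' <= L} ->
  (word_mnm w == word_mnm w') = perm_eq w w'.
Proof.
move=> wL w'L; apply/eqP/idP => [eq_mnm|/seq.permP perm_ww']; last first.
  by apply/mnmP => i; rewrite !mnmE perm_ww'.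
apply/allP => r; rewrite mem_cat => r_ww'; have rL : r \in L by case/orP: r_ww' => [/wL|/w'L].
have /mnmP/(_ (Ordinal (etrans (index_mem r L) rL))) := eq_mnm.
by rewrite !mnmE (tnth_nth r) nth_index //= => ->.
Qed.

Lemma weval_word_mnm w (y : 'I_(size L) -> F) : uniq L -> {subset w <= L} ->
  weval (fun r => ord_ext 0 y (index r L)) w = \prod_i y i ^+ word_mnm w i.
Proof.
move=> L_uniq; elim: w => [_|r w IHw wL].
  by rewrite weval_nil big1 // => i _; rewrite mnmE.
have rL : r \in L by apply: wL; rewrite mem_head.
rewrite weval_cons IHw => [|s ws]; last by apply: wL; rewrite inE ws orbT.
pose i0 := Ordinal (etrans (index_mem r L) rL).
rewrite -[index r L]/(val i0) ord_extE (bigD1 i0) //= [RHS](bigD1 i0) //= mulrA -exprS.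
have tnth_r i : (r == tnth (in_tuple L) i) = (i == i0).
  rewrite (tnth_nth r); apply/eqP/eqP => [r_i|->]; last by rewrite nth_index.
  by apply: val_inj; rewrite /= {1}r_i index_uniq.
congr (_ * _); first by rewrite !mnmE /= tnth_r eqxx.
by apply: eq_bigr => i /negbTE neq_i; rewrite !mnmE /= tnth_r neq_i.
Qed.
End WordMultiplicities.

Lemma nceval_eq0_coef (F : numFieldType) (T : ncpoly F) w :
  (forall v, ev v T = 0) -> \sum_(e <- T | perm_eq e.2 w) e.1 = 0.
Proof.
move=> T0; pose L := undup (w ++ flatten [seq e.2 | e <- T]).
have wL : {subset w <= L} by move=> r r_w; rewrite mem_undup mem_cat r_w.
have TL e : e \in T -> {subset e.2 <= L}.
  move=> Te r r_e; rewrite mem_undup mem_cat; apply/orP; right.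
  by apply/flattenP; exists e.2; rewrite ?map_f.
pose p : {mpoly F[size L]} := \sum_(e <- T) e.1 *: 'X_[word_mnm L e.2].
have p0 : p = 0.
  apply: mpoly_fun_eq0 => y _; rewrite -(T0 (fun r => ord_ext 0 y (index r L))).
  rewrite (raddf_sum (meval y)) /nceval; apply: eq_big_seq => e Te /=.
  by rewrite mevalZ mevalX weval_word_mnm ?undup_uniq //; apply: TL.
have := congr1 (mcoeff (word_mnm L w)) p0.
rewrite mcoeff0 (raddf_sum (mcoeff _)) => coef_w; rewrite -[RHS]coef_w big_mkcond.
apply: eq_big_seq => e Te /=; rewrite mcoeffZ mcoeffX word_mnm_perm //; last exact: TL.
by case: perm_eq; rewrite ?mulr1 ?mulr0.
Qed.

Section WordsInEnvelope.
Variables (F : numFieldType) (t : ctype) (prec : rel sel).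
Local Notation gt := (gtth t prec).
Hypothesis gtO : strict_total_order gt.
Local Notation U := (env F t prec).
Local Notation gen := (@gen F t prec).
Local Notation valid := (valid t prec).
Local Notation bracket := (@bracket F t prec).
Implicit Types (S T : ncpoly F) (Q : pred proot) (r s : proot) (w : seq proot).

Definition env_word w : U := \prod_(r <- w) gen r.
Definition env_ncpoly T : U := \sum_(e <- T) e.1 *: env_word e.2.

Lemma env_word_cat w w' : env_word (w ++ w') = env_word w * env_word w'.
Proof. exact: big_cat. Qed.
Lemma env_word_cons r w : env_word (r :: w) = gen r * env_word w.
Proof. exact: big_cons. Qed.
Lemma env_ncpoly_nil : env_ncpoly [::] = 0. Proof. exact: big_nil. Qed.
Lemma env_ncpoly_cons e T : env_ncpoly (e :: T) = e.1 *: env_word e.2 + env_ncpoly T.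
Proof. exact: big_cons. Qed.
Lemma env_ncpoly_cat S T : env_ncpoly (S ++ T) = env_ncpoly S + env_ncpoly T.
Proof. exact: big_cat. Qed.
Lemma env_ncpoly_scale c T : env_ncpoly (ncscale c T) = c *: env_ncpoly T.
Proof. by rewrite /env_ncpoly big_map scaler_sumr; apply: eq_bigr => e _; rewrite scalerA. Qed.
Lemma env_ncpoly_ncsub S T : env_ncpoly (ncsub S T) = env_ncpoly S - env_ncpoly T.
Proof. by rewrite env_ncpoly_cat env_ncpoly_scale scaleN1r. Qed.
Lemma env_ncpoly_ncmul S T : env_ncpoly (ncmul S T) = env_ncpoly S * env_ncpoly T.
Proof.
rewrite /env_ncpoly big_allpairs_dep mulr_suml; apply: eq_bigr => a _.
rewrite mulr_sumr; apply: eq_bigr => b _ /=.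
by rewrite env_word_cat -scalerAl -scalerAr scalerA.
Qed.
Lemma env_ncpoly_filter (p : pred (F * seq proot)) T :
  env_ncpoly T = env_ncpoly (filter p T) + env_ncpoly (filter (predC p) T).
Proof. by rewrite /env_ncpoly !big_filter; apply: (bigID p). Qed.

Fixpoint expand (z : term F) : ncpoly F :=
  match z with
  | Tc c => [:: (c, [::])]
  | Tg r => if valid r then [:: (1, [:: r])] else [::]
  | Tadd a b => expand a ++ expand b
  | Tmul a b => ncmul (expand a) (expand b)
  end.

Lemma env_ncpoly_expand z : env_ncpoly (expand z) = env_of t prec z.
Proof.
elim: z => [c|r|a IHa b IHb|a IHa b IHb] /=.
- by rewrite /env_ncpoly big_seq1 /env_word big_nil env_of_const.
- case: ifP => [_|/negbT/(gen_invalid F) r0]; last by rewrite env_ncpoly_nil -/(gen r) r0.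
  by rewrite /env_ncpoly big_seq1 /env_word big_seq1 scale1r.
- by rewrite env_ncpoly_cat IHa IHb env_ofD.
- by rewrite env_ncpoly_ncmul IHa IHb env_ofM.
Qed.

Lemma expand_valid z : letters valid (expand z).
Proof.
elim: z => [c|r|a IHa b IHb|a IHa b IHb] //=; last exact: letters_ncmul.
  by case: ifP => //= ->.
by rewrite letters_cat IHa.
Qed.

Fixpoint ad_word r w : ncpoly F :=
  if w is s :: w' then
    [seq (e.1, e.2 :: w') | e <- bracket r s] ++ [seq (e.1, s :: e.2) | e <- ad_word r w']
  else [::].
Definition nc_ad r T : ncpoly F := flatten [seq ncscale e.1 (ad_word r e.2) | e <- T].
Definition coad r (v : proot -> F) s : F := \sum_(e <- bracket r s) e.1 * v e.2.

Lemma nc_ad_cons r c w T : nc_ad r ((c, w) :: T) = ncscale c (ad_word r w) ++ nc_ad r T.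
Proof. by []. Qed.

Lemma env_ncpoly_ad_word r w : valid r -> all valid w ->
  env_ncpoly (ad_word r w) = gen r * env_word w - env_word w * gen r.
Proof.
move=> vr; elim: w => [|s w IHw] /=.
  by rewrite env_ncpoly_nil /env_word big_nil mulr1 mul1r subrr.
case/andP => vs vw; rewrite env_ncpoly_cat.
have -> : env_ncpoly [seq (e.1, s :: e.2) | e <- ad_word r w] = gen s * env_ncpoly (ad_word r w).
  rewrite /env_ncpoly big_map mulr_sumr; apply: eq_bigr => e _ /=.
  by rewrite env_word_cons scalerAr.
rewrite /env_ncpoly big_map /=; under eq_bigr do rewrite env_word_cons scalerAl.
rewrite -mulr_suml -gen_bracket // -/(env_ncpoly _) IHw //.
by rewrite !env_word_cons mulrBl mulrBr !mulrA addrA subrK.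
Qed.

Lemma env_ncpoly_ad r T : valid r -> letters valid T ->
  env_ncpoly (nc_ad r T) = gen r * env_ncpoly T - env_ncpoly T * gen r.
Proof.
move=> vr; elim: T => [|[c w] T IHT] /=; first by rewrite env_ncpoly_nil mulr0 mul0r subrr.
case/andP => vw vT; rewrite nc_ad_cons env_ncpoly_cat env_ncpoly_scale IHT //.
rewrite env_ncpoly_ad_word // env_ncpoly_cons /= mulrDr mulrDl -scalerAr -scalerAl.
by rewrite opprD addrACA scalerBr.
Qed.

Lemma nceval_ad_word r w v : ev v (ad_word r w) = wderiv v (coad r v) w.
Proof.
elim: w => [|s w IHw] /=; first exact: big_nil.
rewrite nceval_cat -IHw /coad mulr_suml mulr_sumr; congr (_ + _).
  by rewrite /nceval big_map; apply: eq_bigr => e _; rewrite weval_cons mulrA.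
rewrite /nceval big_map; apply: eq_bigr => e _; rewrite weval_cons.
by rewrite mulrCA.
Qed.

Lemma nceval_ad r T v : ev v (nc_ad r T) = ncderiv v (coad r v) T.
Proof.
elim: T => [|[c w] T IHT]; first by rewrite /nceval /ncderiv !big_nil.
by rewrite nc_ad_cons nceval_cat IHT nceval_scale nceval_ad_word /ncderiv big_cons.
Qed.

Lemma size_ad_word r w e : e \in ad_word r w -> size e.2 = size w.
Proof.
elim: w e => [//|s w IHw] e /=; rewrite mem_cat => /orP [] /mapP [e' ad_e' ->] //=.
by rewrite (IHw _ ad_e').
Qed.

Lemma homog_part_ad d r T : homog_part d (nc_ad r T) = nc_ad r (homog_part d T).
Proof.
elim: T => [//|[c w] T IHT].
rewrite nc_ad_cons /homog_part filter_cat -!/(homog_part d _) IHT /=.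
have size_ad : {in ncscale c (ad_word r w), forall e, size e.2 = size w}.
  by move=> _ /mapP [e /size_ad_word <- ->].
case: ifP => size_w.
  by rewrite nc_ad_cons; congr (_ ++ _); apply/all_filterP/allP => e /size_ad ->.
rewrite -[RHS]cat0s; congr (_ ++ _); apply/eqP; rewrite -[_ == _]negbK -has_filter.
by apply/hasPn => e /size_ad ->; rewrite size_w.
Qed.

Definition ad_stable (R Q : pred proot) :=
  forall r s, R r -> Q s -> all (fun e => Q e.2) (bracket r s).

Lemma letters_ad_word (R Q : pred proot) r w :
  ad_stable R Q -> R r -> all Q w -> letters Q (ad_word r w).
Proof.
move=> Q_stable Rr; elim: w => [//|s w IHw] /= /andP [Qs Qw].
rewrite letters_cat /letters !all_map; apply/andP; split.
  by apply: sub_all (Q_stable _ _ Rr Qs) => e /= ->.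
by apply: sub_all (IHw Qw) => e /= ->; rewrite Qs.
Qed.

Lemma letters_ad (R Q : pred proot) r T :
  ad_stable R Q -> R r -> letters Q T -> letters Q (nc_ad r T).
Proof.
move=> Q_stable Rr; elim: T => [//|[c w] T IHT] /= /andP [Qw QT].
by rewrite nc_ad_cons letters_cat letters_scale (letters_ad_word Q_stable) ?IHT.
Qed.

Record subspace (K : U -> Prop) : Prop := Subspace {
  subspace0 : K 0;
  subspaceD : forall x y, K x -> K y -> K (x + y);
  subspaceZ : forall c x, K x -> K (c *: x) }.

Lemma env_ncpoly_in_subspace K T : subspace K ->
  (forall e e', e \in T -> e' \in T -> perm_eq e.2 e'.2 -> K (env_word e.2 - env_word e'.2)) ->
  (forall v, ev v T = 0) -> K (env_ncpoly T).
Proof.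
move=> sK; have [n] := ubnP (size T); elim: n T => // n IHn [|e0 T] lt_n T_perm T0.
  by rewrite env_ncpoly_nil; apply: subspace0.
set S := e0 :: T in lt_n T_perm T0 *; pose alike (e : F * seq proot) := perm_eq e.2 e0.2.
have coef0 := nceval_eq0_coef e0.2 T0.
rewrite (env_ncpoly_filter alike); apply: subspaceD => //.
  have -> : env_ncpoly (filter alike S) =
      \sum_(e <- S | (e \in S) && alike e) e.1 *: (env_word e.2 - env_word e0.2).
    rewrite -big_seq_cond; under [RHS]eq_bigr do rewrite scalerBr.
    by rewrite sumrB -scaler_suml coef0 scale0r subr0 /env_ncpoly big_filter.
  apply: big_ind => [||e /andP [Se alike_e]]; [exact: subspace0|exact: subspaceD|].
  by apply: subspaceZ => //; apply: T_perm => //; rewrite mem_head.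
apply: IHn => [|e e'|v].
- rewrite /S /= /alike perm_refl /= size_filter.
  by apply: leq_ltn_trans (count_size _ _) _; rewrite -ltnS.
- by rewrite !mem_filter => /andP [_ Se] /andP [_ Se']; apply: T_perm.
- have := T0 v; rewrite (nceval_filter _ _ alike) (_ : ev v (filter alike S) = 0) ?add0r //.
  rewrite /nceval big_filter (eq_bigr (fun e => e.1 * weval v e0.2)).
    by rewrite -mulr_suml coef0 mul0r.
  by move=> e alike_e; congr (_ * _); apply: perm_big.
Qed.

Definition lower Q (d : nat) (x : U) : Prop :=
  exists T, [/\ letters Q T, all (fun e => size e.2 < d)%N T & x = env_ncpoly T].

Lemma lower_subspace Q d : subspace (lower Q d).
Proof.
split.
- by exists [::]; rewrite env_ncpoly_nil.
- move=> _ _ [S [QS szS ->]] [T [QT szT ->]]; exists (S ++ T).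
  by rewrite letters_cat QS all_cat szS env_ncpoly_cat.
- move=> c _ [T [QT szT ->]]; exists (ncscale c T).
  by rewrite letters_scale QT env_ncpoly_scale all_map.
Qed.

Section SubalgebraOfWords.
Variable Q : pred proot.
Hypothesis Q_closed : ad_stable Q Q.
Hypothesis Q_valid : {subset Q <= valid}.

Lemma lower_transpose w1 w2 r s : all Q w1 -> all Q w2 -> Q r -> Q s ->
  lower Q (size w1 + size w2).+2
    (env_word (w1 ++ r :: s :: w2) - env_word (w1 ++ s :: r :: w2)).
Proof.
move=> Qw1 Qw2 Qr Qs; exists [seq (e.1, w1 ++ e.2 :: w2) | e <- bracket r s]; split.
- rewrite /letters all_map; apply: sub_all (Q_closed Qr Qs) => e /= Qe.
  by rewrite all_cat /= Qw1 Qe Qw2.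
- by rewrite all_map; apply/allP => e _ /=; rewrite size_cat /= addnS.
- rewrite /env_ncpoly big_map /= (eq_bigr (fun e =>
    env_word w1 * (e.1 *: gen e.2) * env_word w2)); last first.
    by move=> e _; rewrite env_word_cat env_word_cons -scalerAr -scalerAl mulrA.
  rewrite -mulr_suml -mulr_sumr -(gen_bracket _ gtO); [|exact: Q_valid..].
  by rewrite !env_word_cat !env_word_cons mulrBr mulrBl !mulrA.
Qed.

Lemma lower_move w0 w1 w2 r : Q r -> all Q (w0 ++ w1 ++ w2) ->
  lower Q (size (w0 ++ w1 ++ w2)).+1
    (env_word (w0 ++ r :: w1 ++ w2) - env_word (w0 ++ w1 ++ r :: w2)).
Proof.
move=> Qr; elim: w1 w0 => [|s w1 IHw] w0 Qw /=.
  by rewrite subrr; apply: subspace0 (lower_subspace _ _).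
have -> : env_word (w0 ++ r :: s :: w1 ++ w2) - env_word (w0 ++ s :: w1 ++ r :: w2) =
  (env_word (w0 ++ r :: s :: w1 ++ w2) - env_word (w0 ++ s :: r :: w1 ++ w2))
  + (env_word (rcons w0 s ++ r :: w1 ++ w2) - env_word (rcons w0 s ++ w1 ++ r :: w2)).
  by rewrite !cat_rcons addrA subrK.
apply: (subspaceD (lower_subspace _ _)); last first.
  by have := IHw (rcons w0 s); rewrite cat_rcons; apply.
move: Qw; rewrite all_cat /= => /and3P [Qw0 Qs Qw12].
have := lower_transpose Qw0 Qw12 Qr Qs.
by rewrite [size (w0 ++ _)]size_cat /= addnS.
Qed.

Lemma lower_perm w w' : all Q w -> perm_eq w w' ->
  lower Q (size w) (env_word w - env_word w').
Proof.
elim: w w' => [|r w IHw] w' Qw.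
  by rewrite perm_sym => /perm_nilP ->; rewrite subrr; apply: subspace0 (lower_subspace _ _).
move=> perm_w; have rw' : r \in w' by rewrite -(perm_mem perm_w) mem_head.
have [w1 [w2 w'E]] : exists w1 w2, w' = w1 ++ r :: w2.
  by case/splitPr: rw' => w1 w2; exists w1, w2.
move: perm_w; rewrite {}w'E perm_sym perm_catC cat_cons perm_cons perm_catC perm_sym.
case/andP: Qw => Qr Qw perm_w.
have Qw12 : all Q (w1 ++ w2) by rewrite -(perm_all _ perm_w).
have -> : env_word (r :: w) - env_word (w1 ++ r :: w2) =
    (env_word (r :: w) - env_word (r :: w1 ++ w2))
    + (env_word ([::] ++ r :: w1 ++ w2) - env_word ([::] ++ w1 ++ r :: w2)).
  by rewrite addrA subrK.
apply: (subspaceD (lower_subspace _ _)); last first.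
  by rewrite /= (perm_size perm_w : size w = _); apply: (lower_move (w0 := [::])).
have [T [QT szT eqT]] := IHw _ Qw perm_w; exists (ncmul [:: (1, [:: r])] T); split.
- by apply: letters_ncmul => //=; rewrite Qr.
- apply/allP => _ /allpairsP [[a b] [/= /[!inE] /eqP -> Tb ->]] /=.
  by rewrite ltnS; apply: (allP szT).
- rewrite env_ncpoly_ncmul -eqT env_ncpoly_cons env_ncpoly_nil addr0 scale1r.
  by rewrite !env_word_cons /env_word big_nil mulr1 mulrBr.
Qed.

Lemma lower_of_nceval_eq0 d T : letters Q T -> all (fun e => size e.2 == d) T ->
  (forall v, ev v T = 0) -> lower Q d (env_ncpoly T).
Proof.
move=> QT szT; apply: env_ncpoly_in_subspace; first exact: lower_subspace.
move=> e e' Te Te' perm_e; rewrite -(eqP (allP szT _ Te)).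
by apply: lower_perm => //; apply: (allP QT).
Qed.
End SubalgebraOfWords.

Section CommutingLetters.
Variable Q : pred proot.
Hypothesis Q_comm : forall r s, Q r -> Q s -> gen r * gen s = gen s * gen r.

Lemma env_word_perm w w' : all Q w -> perm_eq w w' -> env_word w = env_word w'.
Proof.
elim: w w' => [|r w IHw] w' Qw; first by rewrite perm_sym => /perm_nilP ->.
move=> perm_w; have rw' : r \in w' by rewrite -(perm_mem perm_w) mem_head.
have [w1 [w2 w'E]] : exists w1 w2, w' = w1 ++ r :: w2.
  by case/splitPr: rw' => w1 w2; exists w1, w2.
move: perm_w; rewrite {}w'E perm_sym perm_catC cat_cons perm_cons perm_catC perm_sym.
case/andP: Qw => Qr Qw perm_w.
have : all Q (w1 ++ w2) by rewrite -(perm_all _ perm_w).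
rewrite all_cat => /andP [Qw1 _].
rewrite env_word_cons (IHw _ Qw perm_w) !env_word_cat env_word_cons !mulrA; congr (_ * _).
elim: w1 Qw1 {perm_w} => [|s w1 IHw1] /=; first by rewrite /env_word big_nil mulr1 mul1r.
by case/andP => Qs Qw1; rewrite env_word_cons mulrA Q_comm // -mulrA IHw1 // mulrA.
Qed.

Lemma env_ncpoly_eq0 T : letters Q T -> (forall v, ev v T = 0) -> env_ncpoly T = 0.
Proof.
move=> QT; apply: (@env_ncpoly_in_subspace (fun x => x = 0)).
- by split=> // [x y -> ->|c x ->]; [exact: addr0|exact: scaler0].
- move=> e e' Te Te' perm_e; rewrite (env_word_perm _ perm_e) ?subrr //.
  exact: (allP QT).
Qed.
End CommutingLetters.
End WordsInEnvelope.

(** * Symbols are well defined *)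

Section Representations.
Variables (F : numFieldType) (t : ctype) (prec : rel sel).
Local Notation valid := (valid t prec).
Variables (W : lmodType F) (rho : proot -> {linear W -> W}).
Implicit Types (a b z : term F) (x y : W) (T : ncpoly F).

Definition is_representation := forall r s L,
  valid r -> valid s -> all (fun e => valid e.2) L ->
  (forall i j, comm_entry (rmat F t r) (rmat F t s) i j = lincomb_entry t L i j) ->
  forall x, rho r (rho s x) - rho s (rho r x) = \sum_(e <- L) e.1 *: rho e.2 x.

Hypothesis rhoP : is_representation.

Fixpoint tact z : W -> W :=
  match z with
  | Tc c => fun x => c *: x
  | Tg r => fun x => if valid r then rho r x else 0
  | Tadd a b => fun x => tact a x + tact b x
  | Tmul a b => fun x => tact a (tact b x)
  end.

Lemma tact_is_linear z : linear (tact z).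
Proof.
elim: z => [d|r|a IHa b IHb|a IHa b IHb] c x y /=.
- by rewrite scalerDr !scalerA mulrC.
- by case: ifP => _; rewrite ?linearP // scaler0 addr0.
- by rewrite IHa IHb scalerDr addrACA.
- by rewrite IHb IHa.
Qed.
HB.instance Definition _ z := GRing.isLinear.Build F W W *:%R (tact z) (tact_is_linear z).

Lemma tact_tsum s x : tact (tsum s) x = \sum_(a <- s) tact a x.
Proof. by elim: s => [|a s IHs]; rewrite ?big_nil ?big_cons /= ?scale0r ?IHs. Qed.

Lemma equ_tact a b : equ t prec a b -> forall x, tact a x = tact b x.
Proof.
elim=> {a b} /= [||a b c _ eq_ab _ eq_bc x|a a' b b' _ eq_a _ eq_b x
  |a a' b b' _ eq_a _ eq_b x||||||||||||||].
- by [].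
- by move=> a b _ eq_ab x; rewrite eq_ab.
- by rewrite eq_ab eq_bc.
- by rewrite eq_a eq_b.
- by rewrite eq_b eq_a.
- by move=> *; rewrite addrA.
- by move=> *; rewrite addrC.
- by move=> a x; rewrite scale0r add0r.
- by move=> a x; rewrite scaleN1r subrr scale0r.
- by [].
- by move=> a x; rewrite scale1r.
- by move=> a x; rewrite scale1r.
- by [].
- by move=> *; rewrite linearD.
- by move=> *; rewrite scalerDl.
- by move=> *; rewrite scalerA.
- by move=> *; rewrite linearZ.
- by move=> r /negbTE -> x; rewrite scale0r.
move=> r s L vr vs vL commL x; rewrite vr vs scaleN1r (rhoP vr vs vL commL).
rewrite tact_tsum big_map; apply: eq_big_seq => e Le /=.
by rewrite (allP vL _ Le).
Qed.

Fixpoint word_act w x : W := if w is r :: w' then rho r (word_act w' x) else x.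

Lemma word_act_env_ncpoly0 T x : letters valid T -> env_ncpoly t prec T = 0 ->
  \sum_(e <- T) e.1 *: word_act e.2 x = 0.
Proof.
move=> vT; pose reify (S : ncpoly F) :=
  tsum [seq tscale e.1 (tprod [seq Tg r | r <- e.2]) | e <- S].
have reifyE S : env_of t prec (reify S) = env_ncpoly t prec S.
  rewrite env_of_tsum big_map; apply: eq_bigr => e _; rewrite env_of_scale; congr (_ *: _).
  elim: e.2 => [|r w IHw]; first by rewrite /env_word big_nil.
  by rewrite env_word_cons -IHw /= env_ofM.
rewrite -reifyE -env_of0 => /env_ofP/equ_tact/(_ x) /=; rewrite scale0r => reify0.
rewrite -[RHS]reify0 tact_tsum big_map; apply: eq_big_seq => e Te /=; congr (_ *: _).
elim: e.2 (allP vT e Te) => [|r w IHw] /=; first by rewrite scale1r.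
by case/andP => -> /IHw <-.
Qed.
End Representations.

(* The tensor product of a representation with the natural one: the first
   label of a function on [sel * sel] carries the matrix action, the second
   one is passive and records the starting basis vector. *)
Section TensorWithNatural.
Variables (F : numFieldType) (t : ctype) (prec : rel sel).
Variables (W : lmodType F) (rho : proot -> {linear W -> W}).
Hypothesis rhoP : is_representation t prec rho.
Implicit Types (M : fmat F) (g : sel -> W) (a b : sel) (r s : proot) (w : seq proot).

Definition mat_act M g a : W := \sum_(e <- M | e.1.2 == a) e.1.1 *: g e.2.

Lemma mat_act_mentry M g a (bs : seq sel) : uniq bs -> {subset [seq e.2 | e <- M] <= bs} ->
  mat_act M g a = \sum_(b <- bs) mentry M a b *: g b.
Proof.
move=> bs_uniq M_bs; rewrite /mat_act big_mkcond.
under [RHS]eq_bigr do rewrite /mentry scaler_suml.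
rewrite exchange_big; apply: eq_big_seq => e Me /=.
rewrite (bigD1_seq e.2) ?M_bs ?map_f //= eqxx andbT big1 ?addr0 => [|b /negbTE neq_b].
  by case: ifP => _; rewrite ?scale0r.
by rewrite [e.2 == b]eq_sym neq_b andbF scale0r.
Qed.

Lemma mat_act_mmul (A B : fmat F) g a : mat_act (mmul A B) g a = mat_act A (mat_act B g) a.
Proof.
rewrite /mat_act /mmul big_flatten big_map [RHS]big_mkcond; apply: eq_bigr => e _ /=.
rewrite big_map big_filter_cond; case: ifP => e_a; last first.
  by rewrite big1 // => e' /=; rewrite ?e_a andbF.
rewrite scaler_sumr big_mkcond [RHS]big_mkcond; apply: eq_bigr => e' _ /=.
by rewrite ?e_a andbT [e'.1.2 == _]eq_sym; case: ifP => // _; rewrite scalerA.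
Qed.

Lemma mat_actD M g g' a : mat_act M (g + g') a = mat_act M g a + mat_act M g' a.
Proof. by rewrite /mat_act -big_split; apply: eq_bigr => e _; rewrite scalerDr. Qed.
Lemma mat_actZ M c g a : mat_act M (c *: g) a = c *: mat_act M g a.
Proof. by rewrite /mat_act scaler_sumr; apply: eq_bigr => e _; rewrite !scalerA mulrC. Qed.
Lemma mat_act_linear M (f : {linear W -> W}) g a : f (mat_act M g a) = mat_act M (f \o g) a.
Proof. by rewrite /mat_act linear_sum; apply: eq_bigr => e _; rewrite linearZ. Qed.

Lemma mat_act_comm (A B : fmat F) L g a :
  (forall i j, comm_entry A B i j = lincomb_entry t L i j) ->
  mat_act (mmul A B) g a - mat_act (mmul B A) g a
  = \sum_(e <- L) e.1 *: mat_act (rmat F t e.2) g a.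
Proof.
move=> comm_AB.
pose s := undup ([seq e.2 | e <- mmul A B] ++ [seq e.2 | e <- mmul B A]
                 ++ flatten [seq [seq e.2 | e <- rmat F t f.2] | f <- L]).
have s_uniq : uniq s by apply: undup_uniq.
rewrite !(@mat_act_mentry _ _ _ s) //; first last.
- by move=> x Mx; rewrite mem_undup !mem_cat Mx.
- by move=> x Mx; rewrite mem_undup !mem_cat Mx orbT.
rewrite (eq_big_seq (fun f => \sum_(b <- s) (f.1 * mentry (rmat F t f.2) a b) *: g b)).
  rewrite exchange_big -sumrB; apply: eq_bigr => b _ /=.
  by rewrite -scaler_suml -scalerBl -/(comm_entry A B a b) comm_AB.
move=> f Lf; rewrite (@mat_act_mentry _ _ _ s) //.
  by rewrite scaler_sumr; apply: eq_bigr => b _; rewrite scalerA.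
move=> x Mx; rewrite mem_undup !mem_cat; apply/orP; right; apply/orP; right.
by apply/flattenP; eexists; [apply: map_f Lf|exact: Mx].
Qed.

Definition tensor_fun r (h : sel * sel -> W) : sel * sel -> W :=
  fun p => mat_act (rmat F t r) (fun a => h (a, p.2)) p.1 + rho r (h p).

Lemma tensor_fun_is_linear r : linear (tensor_fun r).
Proof.
move=> c h h'; apply: funext => p.
rewrite -[RHS]/(c *: tensor_fun r h p + tensor_fun r h' p) /tensor_fun linearP.
by rewrite (mat_actD _ (c *: (fun a => h (a, p.2)))) mat_actZ scalerDr addrACA.
Qed.
HB.instance Definition _ r := GRing.isLinear.Build F (sel * sel -> W) (sel * sel -> W) *:%R
  (tensor_fun r) (tensor_fun_is_linear r).
Definition tensor r : {linear (sel * sel -> W) -> (sel * sel -> W)} := tensor_fun r.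

Lemma tensor_comp r s (h : sel * sel -> W) p : tensor r (tensor s h) p =
  mat_act (mmul (rmat F t r) (rmat F t s)) (fun a => h (a, p.2)) p.1
  + (mat_act (rmat F t r) (fun a => rho s (h (a, p.2))) p.1
     + mat_act (rmat F t s) (fun a => rho r (h (a, p.2))) p.1)
  + rho r (rho s (h p)).
Proof.
rewrite -[LHS]/(tensor_fun r (tensor_fun s h) p) mat_act_mmul {1}/tensor_fun.
rewrite (mat_actD _ (mat_act _ (fun a => h (a, p.2)))) [tensor_fun s h p]/tensor_fun.
by rewrite linearD mat_act_linear !addrA.
Qed.

Lemma tensor_is_representation : is_representation t prec tensor.
Proof.
move=> r s L vr vs vL commL h; apply: funext => p; rewrite fct_sumE.
rewrite -[LHS]/(tensor r (tensor s h) p - tensor s (tensor r h) p) !tensor_comp.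
have -> : \sum_(e <- L) (e.1 *: tensor e.2 h) p =
    \sum_(e <- L) e.1 *: mat_act (rmat F t e.2) (fun a => h (a, p.2)) p.1
    + \sum_(e <- L) e.1 *: rho e.2 (h p).
  by rewrite -big_split; apply: eq_bigr => e _ /=; rewrite -scalerDr.
rewrite -(mat_act_comm _ _ commL) -(rhoP vr vs vL commL).
rewrite [X in _ - (_ + X + _)]addrC opprD addrACA; congr (_ + _).
by rewrite opprD addrACA subrr addr0.
Qed.

Fixpoint word_matrix w b a : F :=
  if w is r :: w' then \sum_(e <- rmat F t r | e.1.2 == a) e.1.1 * word_matrix w' b e.2
  else (a == b)%:R.

Fixpoint splits w : seq (seq proot * seq proot) :=
  if w is r :: w' then [seq (r :: p.1, p.2) | p <- splits w']
                       ++ [seq (p.1, r :: p.2) | p <- splits w']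
  else [:: ([::], [::])].

Lemma word_act_tensor w x a b :
  word_act tensor w (fun p => (p.1 == p.2)%:R *: x) (a, b)
  = \sum_(p <- splits w) word_matrix p.1 b a *: word_act rho p.2 x.
Proof.
pose diag (p : sel * sel) := (p.1 == p.2)%:R *: x; rewrite -/diag.
elim: w a b => [|r w IHw] a b; first by rewrite big_seq1.
rewrite -[LHS]/(tensor_fun r (word_act tensor w diag) (a, b)) /tensor_fun /=.
rewrite big_cat !big_map /=; congr (_ + _); last first.
  by rewrite IHw linear_sum; apply: eq_bigr => p _; rewrite linearZ.
rewrite /mat_act; under [LHS]eq_bigr do rewrite IHw scaler_sumr.
rewrite exchange_big; apply: eq_bigr => p _; rewrite scaler_suml.
by apply: eq_bigr => e _; rewrite scalerA.
Qed.
End TensorWithNatural.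

Lemma splits_size w p : p \in splits w -> (size p.1 + size p.2 = size w)%N.
Proof.
elim: w p => [|r w IHw] p /=; first by rewrite inE => /eqP ->.
by rewrite mem_cat => /orP [] /mapP [q /IHw <- ->] /=; rewrite ?addnS.
Qed.

Lemma splits_subset w p : p \in splits w -> {subset p.1 <= w} /\ {subset p.2 <= w}.
Proof.
elim: w p => [|r w IHw] p /=; first by rewrite inE => /eqP ->.
rewrite mem_cat => /orP [] /mapP [q /IHw [sub1 sub2] ->] /=; split=> x; rewrite !inE.
- by case/orP => [->//|/sub1 ->]; rewrite orbT.
- by move/sub2 ->; rewrite orbT.
- by move/sub1 ->; rewrite orbT.
- by case/orP => [->//|/sub2 ->]; rewrite orbT.
Qed.

Section Symbol.
Variables (F : numFieldType) (t : ctype) (prec : rel sel).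
Hypothesis gtO : strict_total_order (gtth t prec).
Local Notation valid := (valid t prec).
Implicit Types (T : ncpoly F) (v : proot -> F) (r s : proot) (w : seq proot) (L : seq proot).

Lemma sum_splits0 w v :
  \sum_(p <- splits w | size p.1 == 0) weval v p.1 * weval v p.2 = weval v w.
Proof.
elim: w => [|r w IHw] /=; first by rewrite big_cons big_nil /= weval_nil addr0 mul1r.
rewrite big_cat !big_map /= big_pred0_eq add0r weval_cons -IHw mulr_sumr.
by apply: eq_bigr => p _ /=; rewrite weval_cons mulrCA.
Qed.

Lemma sum_splits1 w v :
  \sum_(p <- splits w | size p.1 == 1) weval v p.1 * weval v p.2 = (size w)%:R * weval v w.
Proof.
elim: w => [|r w IHw] /=; first by rewrite big_cons big_nil /= mul0r.
rewrite big_cat !big_map /= weval_cons -natr1 mulrDl mul1r [RHS]addrC; congr (_ + _).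
  rewrite -(sum_splits0 w) mulr_sumr; apply: eq_big => p; first by rewrite eqSS.
  by move=> _; rewrite weval_cons mulrA.
rewrite mulrCA -IHw mulr_sumr; apply: eq_bigr => p _.
by rewrite weval_cons mulrCA.
Qed.

Lemma mentry_weight r x y k : mentry (rmat F t r) x y != 0 ->
  sel_weight x k - sel_weight y k = root_weight r k.
Proof.
have /allP mat_weight : all (fun e => sel_weight e.1.2 k - sel_weight e.2 k == root_weight r k)
    (rmat F t r).
  rewrite /root_weight; case: r => [i j|i j|i|i] /=; do ?case: ifP => _ /=;
    rewrite ?eqxx ?andbT //=; apply/eqP; ring.
move=> nz; apply/eqP; apply: contraNT nz => neq_wt; rewrite /mentry big_seq big1 // => e Me.
by case: ifP => // /andP [/eqP ex /eqP ey]; rewrite -ex -ey mat_weight in neq_wt.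
Qed.

Lemma mentry_position r s : valid r -> valid s ->
  mentry (rmat F t r) (position s).1 (position s).2 = (r == s)%:R.
Proof.
move=> vr vs; have [<-|neq_rs] := eqVneq r s; last first.
  apply/eqP; apply: contraNT neq_rs => /mentry_weight wt_s.
  by apply/eqP/(root_weight_inj gtO vr vs) => k; rewrite -wt_s.
case: r vr {s vs} => [i j|i j|i|i] vr; rewrite mentryE ?PP_mat /rmat; do ?case: ifP => _;
  rewrite !big_cons big_nil /= ?sel_eqE ?eqxx /=; try by ring.
by rewrite (negbTE (valid_PP_neq gtO vr)) mulr0 addr0 addr0 !mulr1.
Qed.

Lemma position_offdiag r : valid r -> ((position r).1 == (position r).2) = false.
Proof. by case: r => //= i j vr; apply/negbTE/(gt_neq gtO). Qed.

Definition readout L v w : F :=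
  \sum_(r <- L) v r * word_matrix F t w (position r).2 (position r).1.

Lemma readout_nil L v : all valid L -> readout L v [::] = 0.
Proof.
move=> vL; rewrite /readout big_seq big1 // => r /(allP vL)/position_offdiag /= ->.
by rewrite mulr0.
Qed.

Lemma readout1 L v r : all valid L -> uniq L -> r \in L -> readout L v [:: r] = v r.
Proof.
move=> vL uL Lr; have word_matrix1 s : s \in L ->
    word_matrix F t [:: r] (position s).2 (position s).1 = (r == s)%:R.
  move=> Ls; rewrite -(mentry_position (allP vL _ Lr) (allP vL _ Ls)) mentryE /= big_mkcond.
  by apply: eq_bigr => e _; case: ifP => _; rewrite ?mulr1 ?mulr0 ?mul0r.
rewrite /readout (eq_big_seq (fun s => v s * (r == s)%:R)) => [|s Ls]; last by rewrite word_matrix1.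
rewrite (bigD1_seq r) //= eqxx mulr1 big1 ?addr0 // => s /negbTE neq_s.
by rewrite eq_sym neq_s mulr0.
Qed.

Section PositionFunctional.
Variables (W : lmodType F) (phi : {scalar W}) (L : seq proot) (v : proot -> F).

Definition position_functional (h : sel * sel -> W) : F :=
  \sum_(r <- L) v r * phi (h (position r)).

Lemma position_functional_is_scalar : scalar position_functional.
Proof.
move=> c h h'; rewrite /position_functional mulr_sumr -big_split; apply: eq_bigr => r _ /=.
by rewrite -[(c *: h + h') _]/(c *: h _ + h' _) linearP /=; ring.
Qed.
HB.instance Definition _ := GRing.isLinear.Build F (sel * sel -> W) F *%R
  position_functional position_functional_is_scalar.

Lemma position_functional_tensor (rho : proot -> {linear W -> W}) w x :
  position_functional (word_act (tensor t rho) w (fun p => (p.1 == p.2)%:R *: x))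
  = \sum_(p <- splits w) readout L v p.1 * phi (word_act rho p.2 x).
Proof.
rewrite /position_functional; under eq_bigr => r _.
  rewrite [position r]surjective_pairing word_act_tensor linear_sum mulr_sumr.
  by under eq_bigr do rewrite linearZ /= mulrA; over.
rewrite exchange_big; apply: eq_bigr => p _; rewrite -mulr_suml; congr (_ * _).
Qed.
End PositionFunctional.

(* At a valuation v, the degree d part of the symbol is a matrix coefficient of
   the d-th tensor power of the natural representation. *)
Lemma symbol_functional L v d : all valid L -> uniq L ->
  exists (W : lmodType F) (rho : proot -> {linear W -> W}) (phi : {scalar W}) (x : W),
    is_representation t prec rho /\
    forall w, {subset w <= L} -> (size w <= d)%N ->
      phi (word_act rho w x) = if size w == d then d`!%:R * weval v w else 0.
Proof.
move=> vL uL; elim: d => [|d [W [rho [phi [x [rhoP phi_word]]]]]].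
  exists F^o, (fun=> \0), idfun, 1; split=> [r s M _ _ _ _ x|[|r w] _ //= _].
    by rewrite subrr big1 // => e _; rewrite scaler0.
  by rewrite weval_nil mulr1.
exists (sel * sel -> W)%type, (tensor t rho), (position_functional phi L v).
exists (fun p => (p.1 == p.2)%:R *: x); split=> [|w wL size_w].
  exact: tensor_is_representation.
rewrite [LHS]position_functional_tensor (eq_big_seq (fun p => if size p.1 == 1%N then
   (if size w == d.+1 then d`!%:R * (weval v p.1 * weval v p.2) else 0) else 0)).
  rewrite -big_mkcond; case: ifP => [/eqP size_wd|_]; last by rewrite big1.
  by rewrite -mulr_sumr sum_splits1 size_wd factS natrM; ring.
move=> [u1 u2] split_u /=; have [sub1 sub2] := splits_subset split_u.
have phi_u2 : (size u2 <= d)%N -> phi (word_act rho u2 x) =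
    if size u2 == d then d`!%:R * weval v u2 else 0.
  by apply: phi_word => r /sub2/wL.
have := splits_size split_u; rewrite /= in sub1 sub2 *.
case: u1 sub1 {split_u} => [|r0 [|r1 u1]] /= sub1 size_u.
- by rewrite readout_nil // mul0r.
- rewrite readout1 //; last by apply/wL/sub1/mem_head.
  rewrite phi_u2 -?size_u; last by rewrite -ltnS -add1n size_u.
  rewrite add1n eqSS; case: ifP => _; last by rewrite mulr0.
  by rewrite weval_cons weval_nil; ring.
- have lt_u2 : (size u2 < d)%N.
    by rewrite -ltnS (leq_trans _ size_w) // -size_u !addSn !ltnS leq_addl.
  by rewrite phi_u2 ?ltn_eqF ?mulr0 // ltnW.
Qed.

Lemma symbol_eq0 T d : letters valid T -> all (fun e => size e.2 <= d)%N T ->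
  env_ncpoly t prec T = 0 -> forall v, ev v (homog_part d T) = 0.
Proof.
move=> vT szT T0 v; pose L := undup (flatten [seq e.2 | e <- T]).
have TL e : e \in T -> {subset e.2 <= L}.
  move=> Te r r_e; rewrite mem_undup; apply/flattenP; exists e.2 => //.
  exact: map_f.
have vL : all valid L.
  apply/allP => r; rewrite mem_undup => /flattenP [_ /mapP [e Te ->]].
  exact: (allP (allP vT _ Te)).
have [W [rho [phi [x [rhoP phi_word]]]]] := symbol_functional v d vL (undup_uniq _).
have : \sum_(e <- T) e.1 * phi (word_act rho e.2 x) = 0.
  have /(congr1 phi) := word_act_env_ncpoly0 rhoP x vT T0.
  rewrite linear_sum linear0 => sum0; rewrite -[RHS]sum0; apply: eq_bigr => e _.
  by rewrite linearZ.
rewrite (eq_big_seq (fun e => d`!%:R * (if size e.2 == d then e.1 * weval v e.2 else 0))).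
  rewrite -mulr_sumr -big_mkcond /nceval big_filter => /eqP.
  by rewrite mulf_eq0 pnatr_eq0 -leqn0 leqNgt fact_gt0 /= => /eqP.
move=> e Te; rewrite phi_word; [|exact: TL|exact: (allP szT)].
by case: ifP => _; ring.
Qed.
End Symbol.

(** * Coadjoint invariants *)

Section TermClosure.
Variables (F : numFieldType) (K : term F -> Prop).
Hypothesis KC : forall c, K (Tc c).
Hypothesis KD : forall a b, K a -> K b -> K (Tadd a b).
Hypothesis KM : forall a b, K a -> K b -> K (Tmul a b).

Lemma closed_tscale c a : K a -> K (tscale c a).
Proof. by move=> Ka; apply: KM. Qed.
Lemma closed_tsum (I : Type) (s : seq I) f : (forall i, K (f i)) -> K (tsum [seq f i | i <- s]).
Proof. by move=> Kf; elim: s => [|i s IHs] //=; apply: KD. Qed.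
Lemma closed_tprod (I : Type) (s : seq I) f : (forall i, K (f i)) -> K (tprod [seq f i | i <- s]).
Proof. by move=> Kf; elim: s => [|i s IHs] //=; apply: KM. Qed.
Lemma closed_tpow a n : K a -> K (tpow a n).
Proof. by move=> Ka; elim: n => [|n IHn] //=; apply: KM. Qed.

Lemma closed_ueval k (p : {mpoly F[k]}) g : (forall i, K (g i)) -> K (ueval p g).
Proof.
move=> Kg; apply: closed_tsum => m; apply: closed_tscale; apply: closed_tprod => i.
exact: closed_tpow.
Qed.
Lemma closed_tdet q (x : 'I_q -> 'I_q -> term F) : (forall i j, K (x i j)) -> K (tdet x).
Proof.
by move=> Kx; apply: closed_tsum => s; apply: closed_tscale; apply: closed_tprod.
Qed.
Lemma closed_tpf q (x : 'I_q.*2 -> 'I_q.*2 -> term F) : (forall i j, K (x i j)) -> K (tpf x).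
Proof.
move=> Kx; apply: closed_tscale; apply: closed_tsum => s; apply: closed_tscale.
exact: closed_tprod.
Qed.
End TermClosure.

Section Invariants.
Variables (F : numFieldType) (t : ctype) (prec : rel sel).
Hypothesis gtO : strict_total_order (gtth t prec).
Local Notation valid := (valid t prec).
Local Notation expand := (@expand F t prec).
Local Notation coad := (@coad F t prec).
Local Notation bracket := (@bracket F t prec).
Local Notation gen := (@gen F t prec).
Local Notation env_of := (@env_of F t prec).
Local Notation env_ncpoly := (@env_ncpoly F t prec).
Implicit Types (S T : ncpoly F) (a b z : term F) (Q L : pred proot) (v : proot -> F).

Section TermValues.
Variable v : proot -> F.

Definition teval z : F := ev v (expand z).

Lemma teval_const c : teval (Tc c) = c.
Proof. by rewrite /teval /nceval big_seq1 weval_nil mulr1. Qed.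
Lemma teval_gen r : valid r -> teval (Tg r) = v r.
Proof.
by move=> vr; rewrite /teval /= vr /nceval big_seq1 weval_cons weval_nil mul1r mulr1.
Qed.
Lemma tevalD a b : teval (Tadd a b) = teval a + teval b.
Proof. exact: nceval_cat. Qed.
Lemma tevalM a b : teval (Tmul a b) = teval a * teval b.
Proof. exact: nceval_ncmul. Qed.
Lemma tevalZ c a : teval (tscale c a) = c * teval a.
Proof. by rewrite tevalM teval_const. Qed.
Lemma teval_tsum (I : Type) (s : seq I) f :
  teval (tsum [seq f i | i <- s]) = \sum_(i <- s) teval (f i).
Proof.
by elim: s => [|i s IHs]; rewrite ?big_nil ?big_cons ?teval_const //= tevalD IHs.
Qed.
Lemma teval_tprod (I : Type) (s : seq I) f :
  teval (tprod [seq f i | i <- s]) = \prod_(i <- s) teval (f i).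
Proof.
by elim: s => [|i s IHs]; rewrite ?big_nil ?big_cons ?teval_const //= tevalM IHs.
Qed.
Lemma teval_tpow a n : teval (tpow a n) = teval a ^+ n.
Proof. by elim: n => [|n IHn]; rewrite ?teval_const // [LHS]tevalM IHn exprS. Qed.

Lemma teval_ueval k (p : {mpoly F[k]}) g : teval (ueval p g) = p.@[fun i => teval (g i)].
Proof.
rewrite teval_tsum mevalE; apply: eq_bigr => m _.
rewrite tevalZ teval_tprod big_enum; congr (_ * _).
by apply: eq_bigr => i _; rewrite teval_tpow.
Qed.

Lemma teval_tdet q (x : 'I_q -> 'I_q -> term F) :
  teval (tdet x) = \det (\matrix_(i, j) teval (x i j)).
Proof.
rewrite teval_tsum big_enum; apply: eq_big => [s|s _]; first by rewrite inE.
rewrite tevalZ teval_tprod big_enum; congr (_ * _).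
by apply: eq_bigr => i _; rewrite mxE.
Qed.

Lemma teval_tpf q (x : 'I_q.*2 -> 'I_q.*2 -> term F) (X : nat -> nat -> F) :
  (forall i j, teval (x i j) = X i j) -> teval (tpf x) = pfaffian q X.
Proof.
move=> xX; rewrite tevalZ teval_tsum big_enum; congr (_ * _).
apply: eq_big => [s|s _]; first by rewrite inE.
rewrite tevalZ teval_tprod big_enum; congr (_ * _).
by apply: eq_bigr => i _; apply: xX.
Qed.
End TermValues.

Section TermLetters.
Variable Q : pred proot.

Lemma letters_gen r : Q r -> letters Q (expand (Tg r)).
Proof. by rewrite /=; case: ifP => //= _ ->. Qed.

Lemma letters_Tadd a b : letters Q (expand a) -> letters Q (expand b) ->
  letters Q (expand (Tadd a b)).
Proof. by rewrite /= letters_cat => ->. Qed.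

Lemma letters_tscale c a : letters Q (expand a) -> letters Q (expand (tscale c a)).
Proof. by move=> Qa; apply: letters_ncmul. Qed.

Lemma letters_tdet q (x : 'I_q -> 'I_q -> term F) :
  (forall i j, letters Q (expand (x i j))) -> letters Q (expand (tdet x)).
Proof.
by apply: (closed_tdet (K := fun z => letters Q (expand z))) => // a b;
  [apply: letters_Tadd|apply: letters_ncmul].
Qed.

Lemma letters_tpf q (x : 'I_q.*2 -> 'I_q.*2 -> term F) :
  (forall i j, letters Q (expand (x i j))) -> letters Q (expand (tpf x)).
Proof.
by apply: (closed_tpf (K := fun z => letters Q (expand z))) => // a b;
  [apply: letters_Tadd|apply: letters_ncmul].
Qed.
End TermLetters.

Definition coad_invariant T := forall r v, valid r -> ncderiv v (coad r v) T = 0.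

Lemma coad_invariant_ncsub S T : coad_invariant S -> coad_invariant T ->
  coad_invariant (ncsub S T).
Proof.
by move=> S_inv T_inv r v vr; rewrite ncderiv_ncsub S_inv // T_inv // subrr.
Qed.

Definition invariant_in Q z := letters Q (expand z) /\ coad_invariant (expand z).

Lemma invariant_in_ueval Q k (p : {mpoly F[k]}) g :
  (forall i, invariant_in Q (g i)) -> invariant_in Q (ueval p g).
Proof.
apply: closed_ueval => [c|a b [Qa a_inv] [Qb b_inv]|a b [Qa a_inv] [Qb b_inv]].
- by split=> // r v _; rewrite /ncderiv big_seq1 mulr0.
- split; first by rewrite /= letters_cat Qa.
  by move=> r v vr; rewrite /= ncderiv_cat a_inv // b_inv // addr0.
- split; first exact: letters_ncmul.
  by move=> r v vr; rewrite /= ncderiv_ncmul a_inv // b_inv // mulr0 mul0r addr0.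
Qed.

Lemma gen_comm r s : valid r -> valid s -> bracket r s = [::] -> gen r * gen s = gen s * gen r.
Proof.
by move=> vr vs rs0; apply/eqP; rewrite -subr_eq0 gen_bracket // rs0 big_nil.
Qed.

Record commuting_ideal Q : Prop := CommutingIdeal {
  ideal_valid : {subset Q <= valid};
  ideal_comm : forall r s, Q r -> Q s -> bracket r s = [::];
  ideal_ad : ad_stable F t prec valid Q }.

Section CommutingIdealTheory.
Variable Q : pred proot.
Hypothesis Q_ideal : commuting_ideal Q.

Lemma ideal_gen_comm r s : Q r -> Q s -> gen r * gen s = gen s * gen r.
Proof.
move=> Qr Qs; apply: gen_comm; rewrite ?(ideal_comm Q_ideal) //; exact: (ideal_valid Q_ideal).
Qed.

Lemma invariant_in_central z x : invariant_in Q z -> env_of z * x = x * env_of z.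
Proof.
move=> [Qz z_inv]; move: x; apply: commute_of_gens => r vr; apply/eqP.
rewrite -subr_eq0 -!env_ncpoly_expand -env_ncpoly_ad //; last exact: expand_valid.
apply/eqP; apply: (env_ncpoly_eq0 ideal_gen_comm); last by move=> v; rewrite nceval_ad z_inv.
exact: letters_ad (ideal_ad Q_ideal) vr Qz.
Qed.

Lemma env_ncpoly_inj0 T : letters Q T -> env_ncpoly T = 0 -> forall v, ev v T = 0.
Proof.
move=> QT T0 v; pose d := (\max_(e <- T) size e.2)%N.
have : all (fun e => size e.2 <= d)%N T.
  by apply/allP => e Te; apply: (leq_bigmax_seq (P := xpredT) (F := fun e => size e.2) _ Te isT).
move: d => d; elim: d T QT T0 => [|d IHd] T QT T0 szT;
  have top0 := symbol_eq0 gtO (letters_subset (ideal_valid Q_ideal) QT) szT T0.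
  rewrite -(top0 v); congr (nceval _ _ _); apply/esym/all_filterP.
  by apply: sub_all szT => e; rewrite leqn0.
rewrite (nceval_filter _ _ (fun e => size e.2 == d.+1)) -/(homog_part d.+1 T) top0 add0r.
apply: IHd; first exact: letters_filter.
  have := T0; rewrite (env_ncpoly_filter _ _ (fun e => size e.2 == d.+1)).
  by rewrite (env_ncpoly_eq0 ideal_gen_comm (letters_filter _ QT) top0) add0r.
apply/allP => e; rewrite mem_filter /= => /andP [neq_d /(allP szT)].
by rewrite leq_eqVlt (negbTE neq_d).
Qed.
End CommutingIdealTheory.

Lemma homog_part_invariant d T : letters valid T -> all (fun e => size e.2 <= d)%N T ->
  (forall x, env_ncpoly T * x = x * env_ncpoly T) -> coad_invariant (homog_part d T).
Proof.
move=> vT szT T_central r v vr; rewrite -nceval_ad -homog_part_ad.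
apply: (symbol_eq0 gtO).
- by apply: letters_ad vr vT => s s'; apply: bracket_valid.
- apply/allP => e /flattenP [_ /mapP [f Tf ->]] /mapP [g /size_ad_word size_g ->] /=.
  by rewrite size_g; apply: (allP szT).
- by rewrite env_ncpoly_ad // T_central subrr.
Qed.

Definition slice_point (kap : proot -> F) (lam : proot -> nat) (d : nat -> F) : proot -> F :=
  fun r => kap r * d (lam r).

(* A slice d |-> slice_point d for the coadjoint action on functions of the letters
   in Q: invariants are determined by their restriction to it, and G_1, ..., G_k
   restrict to the partial products of the coordinates. *)
Record generic_slice (G : nat -> term F) (k : nat) Q kap lam (c : nat -> F) : Prop := GenericSlice {
  slice_ideal : commuting_ideal Q;
  slice_index : forall r, kap r != 0 -> (lam r < k)%N;
  slice_generator : forall i, (i < k)%N -> invariant_in Q (G i.+1);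
  slice_coef_neq0 : forall i, c i != 0;
  slice_value : forall i d, (i < k)%N ->
    teval (slice_point kap lam d) (G i.+1) = c i * \prod_(j < i.+1) d j;
  slice_determines : forall T, letters Q T -> coad_invariant T ->
    (forall d, ev (slice_point kap lam d) T = 0) -> forall v, ev v T = 0;
  slice_regular : forall T, letters Q T -> coad_invariant T ->
    forall q d, (q.+1 < k)%N -> (forall l, d l != 0) -> exists p : {poly F},
    forall s, s != 0 -> ev (slice_point kap lam (torus_scale q q.+1 s d)) T = p.[s] }.

Section SliceTheory.
Variables (G : nat -> term F) (k : nat) (Q : pred proot).
Variables (kap : proot -> F) (lam : proot -> nat) (c : nat -> F).
Hypothesis sliceP : generic_slice G k Q kap lam c.
Local Notation generators := (fun j : 'I_k => G j.+1).
Let Q_ideal := slice_ideal sliceP.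

Lemma ueval_generators_invariant (p : {mpoly F[k]}) : invariant_in Q (ueval p generators).
Proof. by apply: invariant_in_ueval => i; apply: (slice_generator sliceP). Qed.

Lemma teval_generators d (p : {mpoly F[k]}) :
  teval (slice_point kap lam d) (ueval p generators)
  = p.@[fun i : 'I_k => c i * \prod_(j < i.+1) d j].
Proof.
by rewrite teval_ueval; apply: meval_eq => i; apply: (slice_value sliceP).
Qed.

Lemma generators_alg_independent (p : {mpoly F[k]}) : env_of (ueval p generators) = 0 -> p = 0.
Proof.
rewrite -env_ncpoly_expand => p0.
apply: (partial_prods_alg_independent (slice_coef_neq0 sliceP)) => d.
rewrite -teval_generators; apply: (env_ncpoly_inj0 Q_ideal) p0 _.
by case: (ueval_generators_invariant p).
Qed.

Lemma slice_restriction T : exists h : {mpoly F[k]}, forall d : nat -> F,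
  h.@[fun i : 'I_k => d i] = ev (slice_point kap lam d) T.
Proof.
pose X l : {mpoly F[k]} := ord_ext 0 (fun i => 'X_i) l.
exists (nceval (@mpolyC k F) (fun r => kap r *: X (lam r)) T) => d.
rewrite (nceval_morph _ (meval (fun i : 'I_k => d i))); apply: eq_bigr => e _.
rewrite /= mevalC; congr (_ * _); apply: eq_bigr => r _ /=.
rewrite mevalZ /slice_point; have [->|kap0] := eqVneq (kap r) 0; first by rewrite !mul0r.
by rewrite -[lam r]/(val (Ordinal (slice_index sliceP kap0))) /X ord_extE mevalXU.
Qed.

Lemma invariant_polynomial T : letters Q T -> coad_invariant T ->
  exists p : {mpoly F[k]}, forall v, ev v T = teval v (ueval p generators).
Proof.
move=> QT T_inv; have [h hE] := slice_restriction T.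
have [m i j hm eq_ij|p pE] := @mpoly_in_partial_prods _ k h c (slice_coef_neq0 sliceP).
  have neq_ij : i != j by rewrite -val_eqE eq_ij ltn_eqF.
  apply: (msupp_le_of_torus_regular neq_ij) hm => y y0.
  pose d := ord_ext 1 y.
  have d0 l : d l != 0 by apply: (@ord_ext_ind _ _ _ _ (fun x => x != 0)); rewrite ?oner_eq0.
  have lt_ik : (i.+1 < k)%N by rewrite -eq_ij ltn_ord.
  have [p p_reg] := slice_regular sliceP QT T_inv lt_ik d0; exists p => s s0.
  rewrite -p_reg // -hE; apply: meval_eq => l.
  by rewrite /torus_scale -eq_ij /d !ord_extE.
exists p => v; have [Qp p_inv] := ueval_generators_invariant p.
apply/eqP; rewrite -subr_eq0 -nceval_ncsub; apply/eqP; move: v; apply: (slice_determines sliceP).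
- by rewrite letters_ncsub QT.
- exact: coad_invariant_ncsub.
- move=> d; rewrite nceval_ncsub -/(teval _ _) teval_generators pE hE.
  by rewrite subrr.
Qed.

Definition reduces_to L := forall T, letters L T -> coad_invariant T ->
  forall v, ev v T = ev v [seq e <- T | all Q e.2].

Section CentralElements.
Variable L : pred proot.
Hypothesis L_valid : {subset L <= valid}.
Hypothesis L_closed : ad_stable F t prec L L.
Hypothesis L_red : reduces_to L.

Lemma invariant_homog_mod_lower d T : letters L T -> all (fun e => size e.2 == d) T ->
  coad_invariant T -> exists p : {mpoly F[k]},
    lower L d (env_ncpoly T - env_of (ueval p generators)).
Proof.
move=> LT szT T_inv; pose TQ := [seq e <- T | all Q e.2].
have evTQ : forall v, ev v T = ev v TQ by apply: L_red.
have QTQ : letters Q TQ by apply: filter_all.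
have [|p pE] := @invariant_polynomial TQ QTQ.
  by move=> r v vr; rewrite -(eq_ncderiv_of_eval _ _ evTQ) T_inv.
have [Qp _] := ueval_generators_invariant p.
have TQ_env : env_ncpoly TQ = env_of (ueval p generators).
  apply/eqP; rewrite -subr_eq0 -env_ncpoly_expand -env_ncpoly_ncsub; apply/eqP.
  apply: (env_ncpoly_eq0 (ideal_gen_comm Q_ideal)); first by rewrite letters_ncsub QTQ.
  by move=> v; rewrite nceval_ncsub pE subrr.
exists p; rewrite -TQ_env -env_ncpoly_ncsub; apply: lower_of_nceval_eq0 => //.
- by rewrite letters_ncsub LT letters_filter.
- rewrite all_cat szT all_map; apply/allP => e; rewrite mem_filter => /andP [_].
  exact: (allP szT).
- by move=> v; rewrite nceval_ncsub evTQ subrr.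
Qed.

Lemma central_is_polynomial d T : letters L T -> all (fun e => size e.2 < d)%N T ->
  (forall x, env_ncpoly T * x = x * env_ncpoly T) ->
  exists p : {mpoly F[k]}, env_ncpoly T = env_of (ueval p generators).
Proof.
elim: d T => [|d IHd] T LT szT T_central.
  exists 0; rewrite /ueval msupp0 /= env_of0 (_ : T = [::]) ?env_ncpoly_nil //.
  by case: T szT {LT T_central}.
have vT := letters_subset L_valid LT.
have [|||p [S [LS szS topE]]] := @invariant_homog_mod_lower d (homog_part d T).
- exact: letters_filter.
- exact: filter_all.
- by apply: homog_part_invariant => //; apply: sub_all szT.
pose T' := [seq e <- T | size e.2 != d] ++ S.
have TE : env_ncpoly T = env_ncpoly T' + env_of (ueval p generators).
  rewrite (env_ncpoly_filter _ _ (fun e => size e.2 == d)) env_ncpoly_cat -topE.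
  by rewrite -addrA subrK addrC.
have [||x|p' p'E] := IHd T'.
- by rewrite letters_cat LS andbT letters_filter.
- rewrite all_cat szS andbT; apply/allP => e; rewrite mem_filter => /andP [neq_d /(allP szT)].
  by rewrite ltnS leq_eqVlt (negbTE neq_d).
- have -> : env_ncpoly T' = env_ncpoly T - env_of (ueval p generators) by rewrite TE addrK.
  rewrite mulrBl mulrBr T_central (invariant_in_central Q_ideal) //.
  exact: ueval_generators_invariant.
have uevalD v : teval v (ueval (p' + p) generators) =
    teval v (ueval p' generators) + teval v (ueval p generators).
  by rewrite !teval_ueval mevalD.
exists (p' + p); rewrite TE p'E -!env_ncpoly_expand -env_ncpoly_cat; apply/eqP.
rewrite -subr_eq0 -env_ncpoly_ncsub; apply/eqP; apply: (env_ncpoly_eq0 (ideal_gen_comm Q_ideal)).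
  have Qp p0 := (ueval_generators_invariant p0).1.
  by rewrite letters_ncsub letters_cat !Qp.
by move=> v; rewrite nceval_ncsub nceval_cat -!/(teval _ _) uevalD subrr.
Qed.
End CentralElements.
End SliceTheory.

Definition partial_dir (s0 : proot) : proot -> F := fun s => (s == s0)%:R.

Lemma nceval_filter_of_partial Q L T : letters L T ->
  (forall s, L s -> ~~ Q s -> forall v, ncderiv v (partial_dir s) T = 0) ->
  forall v, ev v T = ev v [seq e <- T | all Q e.2].
Proof.
move=> LT dT0 v; pose w r := if Q r then v r else 0.
have <- : ev w T = ev v [seq e <- T | all Q e.2].
  rewrite (nceval_filter _ _ (fun e => all Q e.2)) [X in _ + X](_ : _ = 0) ?addr0.
    by apply: (eq_nceval (Q := Q)); [apply: filter_all|move=> r Qr; rewrite /w Qr].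
  rewrite /nceval big_filter big1 // => e /allPn [r e_r /negbTE nQ].
  by rewrite /weval (big_rem r) //= /w nQ mul0r mulr0.
have -> : v = jet w (v - w) (fun=> 0) 1.
  by apply: funext => r; rewrite /jet mul1r mulr0 addr0 addrC subrK.
apply: nceval_jet_const => s.
pose B := [seq r <- undup (flatten [seq e.2 | e <- T]) | ~~ Q r].
have letter_in e r : e \in T -> r \in e.2 -> r \in flatten [seq e.2 | e <- T].
  by move=> Te e_r; apply/flattenP; exists e.2; rewrite ?map_f.
rewrite (eq_ncderiv (Q := mem (flatten [seq e.2 | e <- T])) (v' := jet w (v - w) (fun=> 0) s)
  (h' := fun r => \sum_(x <- B) (v - w) x * partial_dir x r)) //; last 2 first.
- by apply/allP => e Te; apply/allP => r; apply: letter_in.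
- move=> r T_r; rewrite /= mul0rn mulr0 addr0 /partial_dir.
  have [Qr|nQ] := boolP (Q r).
    rewrite big_seq big1 => [|x]; first by rewrite -[LHS]/(v r - w r) /w Qr subrr.
    by rewrite mem_filter => /andP [nQx _]; case: eqP => [e|_]; rewrite ?mulr0 // -e Qr in nQx *.
  rewrite (bigD1_seq r) ?mem_filter ?nQ ?mem_undup ?filter_uniq ?undup_uniq //= eqxx mulr1.
  by rewrite big1 ?addr0 // => x /negbTE neq_x; rewrite eq_sym neq_x mulr0.
rewrite ncderiv_sum big_seq big1 // => x; rewrite mem_filter mem_undup => /andP [nQ].
case/flattenP => _ /mapP [e Te ->] e_x.
by rewrite dT0 ?mulr0 //; apply: (allP (allP LT _ Te)).
Qed.

Definition roots_in (M : seq nat) : pred proot :=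
  fun r => valid r && all (mem M) (root_support r).

Lemma root_weight_eq0 M r k : roots_in M r -> k \notin M -> root_weight r k = 0.
Proof.
case/andP => vr /allP Mr nMk; apply/eqP; rewrite -[_ == _]negbK -(mem_root_support gtO) //.
by apply: contra nMk; apply: Mr.
Qed.

Lemma roots_in_closed M : ad_stable F t prec (roots_in M) (roots_in M).
Proof.
move=> r s Mr Ms; apply/allP => e rs_e; have [/andP [vr _] /andP [vs _]] := (Mr, Ms).
have ve : valid e.2 by apply: (allP (bracket_valid F gtO vr vs)).
apply/andP; split=> //; apply/allP => x; rewrite (mem_root_support gtO) //; apply: contraNT => nMx.
by rewrite (eqP (allP (bracket_weight F gtO r s x) _ rs_e)) !(root_weight_eq0 _ nMx).
Qed.

(* A root r involving an index outside M moves every letter over M out of M, and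
   by weights different letters to different ones. *)
Lemma partial_eq0_of_bracket M T r s0 s1 c0 k : letters (roots_in M) T -> coad_invariant T ->
  valid r -> k \in root_support r -> k \notin M ->
  roots_in M s0 -> bracket r s0 = [:: (c0, s1)] -> c0 != 0 ->
  forall v, ncderiv v (partial_dir s0) T = 0.
Proof.
move=> LT T_inv vr r_k nMk Ms0 rs0 c00 v.
have weight0 s : roots_in M s -> root_weight s k = 0 by move/root_weight_eq0; apply.
have out s e : roots_in M s -> e \in bracket r s -> ~~ roots_in M e.2.
  move=> Ms rs_e; have := allP (bracket_weight F gtO r s k) _ rs_e.
  rewrite (weight0 s) // addr0 => /eqP wt_e; apply: contraL r_k => /weight0.
  by rewrite wt_e (mem_root_support gtO) // => ->; rewrite eqxx.
have inj s e : roots_in M s -> e \in bracket r s -> e.2 = s1 -> s = s0.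
  move=> Ms rs_e e_s1; apply: (root_weight_inj gtO) => [||j]; try by [case/andP: Ms|case/andP: Ms0].
  have rs0_s1 : (c0, s1) \in bracket r s0 by rewrite rs0 mem_head.
  have := allP (bracket_weight F gtO r s j) _ rs_e; rewrite e_s1.
  by rewrite (eqP (allP (bracket_weight F gtO r s0 j) _ rs0_s1)) => /eqP /addrI.
pose v' x := if roots_in M x then v x else if x == s1 then c0^-1 else 0.
have ns1 : roots_in M s1 = false by apply/negbTE/(out s0 (c0, s1)); rewrite ?rs0 ?mem_head.
rewrite -(T_inv r v' vr); apply: (eq_ncderiv LT) => s Ms; first by rewrite /v' Ms.
rewrite /partial_dir; have [->|neq_s] := eqVneq s s0.
  by rewrite /coad rs0 big_seq1 /v' /= ns1 eqxx mulfV.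
rewrite /coad big_seq big1 // => e rs_e; rewrite /v' (negbTE (out _ _ Ms rs_e)).
by case: eqP => [/(inj _ _ Ms rs_e) eq_s|_]; rewrite ?mulr0 //; case/eqP: neq_s.
Qed.
End Invariants.

(** * Slices in types B, C and D *)

Section CoadjointFlow.
Variables (F : numFieldType) (t : ctype) (prec : rel sel).
Local Notation coad := (@coad F t prec).
Implicit Types (T : ncpoly F) (v h k : proot -> F) (r x : proot).

Lemma coad_jet r v h k s : coad r (jet v h k s) = jet (coad r v) (coad r h) (coad r k) s.
Proof.
apply: funext => x; rewrite /jet /coad !mulr_sumr -!big_split /=.
by apply: eq_bigr => e _; ring.
Qed.

(* The one-parameter group generated by r, when ad r is nilpotent of order 3. *)
Definition coad_flow r v : F -> proot -> F :=
  jet v (coad r v) (fun x => 2^-1 * coad r (coad r v) x).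

Lemma nceval_coad_flow Q r T v : letters Q T -> coad_invariant t prec T ->
  valid t prec r -> (forall x, Q x -> coad r (coad r (coad r v)) x = 0) ->
  forall s, ev (coad_flow r v s) T = ev v T.
Proof.
move=> QT T_inv vr coad3 s; apply: nceval_jet_const => {}s.
rewrite -[RHS](T_inv r (coad_flow r v s) vr); apply: (eq_ncderiv QT) => // x Qx.
have two0 : (2 : F) != 0 by rewrite pnatr_eq0.
rewrite coad_jet /jet [X in s ^+ 2 * X](_ : _ = 2^-1 * coad r (coad r (coad r v)) x).
  by rewrite coad3 // mulr2n; field.
by rewrite /coad mulr_sumr; apply: eq_bigr => e _; rewrite mulrCA.
Qed.

Lemma ncderiv_coad_eq0_of_flow r T v :
  (forall s, ev (coad_flow r v s) T = ev v T) -> ncderiv v (coad r v) T = 0.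
Proof. exact: ncderiv_jet_const. Qed.
End CoadjointFlow.

Section SumRoots.
Variables (F : numFieldType) (t : ctype) (prec : rel sel).
Local Notation gt := (gtth t prec).
Hypothesis gtO : strict_total_order gt.
Local Notation valid := (valid t prec).
Local Notation coad := (@coad F t prec).
Local Notation eta := (form_sign F t).
Implicit Types (v : proot -> F) (T : ncpoly F) (r : proot) (u : F).

Definition sum_value v i j : F := \sum_(e <- sum_root F t prec i j) e.1 * v e.2.

Lemma sum_value_gt v i j : gt i j -> sum_value v i j = v (PP i j).
Proof. by rewrite /sum_value /sum_root => ->; rewrite big_seq1 mul1r. Qed.

Lemma sum_value_lt v i j : gt j i -> sum_value v i j = eta * v (PP j i).
Proof.
by move=> gt_ji; rewrite /sum_value /sum_root (gt_asym gtO gt_ji) gt_ji big_seq1.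
Qed.

Lemma sum_value_diag v i : sum_value v i i = if ctype_eqb t TC then 2 * v (PL i) else 0.
Proof.
by rewrite /sum_value /sum_root (gt_irr gtO); case: ifP => _; rewrite ?big_seq1 ?big_nil.
Qed.

Lemma sum_value_symmetric v : sign_symmetric eta (sum_value v).
Proof.
move=> i j; have [->|/(gt_total gtO)/orP [gt_ij|gt_ji]] := eqVneq i j.
- by rewrite sum_value_diag /form_sign; case: ifP => _; rewrite ?mul1r ?mulr0.
- by rewrite (sum_value_lt _ gt_ij) (sum_value_gt _ gt_ij).
- by rewrite (sum_value_lt _ gt_ji) (sum_value_gt _ gt_ji) mulrA form_sign_sq mul1r.
Qed.

Lemma sum_value_jet v h k u i j :
  sum_value (jet v h k u) i j = sum_value v i j + u * sum_value h i j + u ^+ 2 * sum_value k i j.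
Proof.
rewrite /sum_value !mulr_sumr -!big_split /=.
by apply: eq_bigr => e _; rewrite /jet; ring.
Qed.

Lemma coad_PM_PP x y v i j :
  coad (PM x y) v (PP i j) = (y == i)%:R * sum_value v x j + (y == j)%:R * sum_value v i x.
Proof.
rewrite /coad /= big_cat /=.
by case: (y == i); case: (y == j); rewrite ?big_nil ?mul1r ?mul0r.
Qed.

Lemma coad_PM_PL x y v i : coad (PM x y) v (PL i) = (y == i)%:R * sum_value v x i.
Proof. by rewrite /coad /=; case: (y == i); rewrite ?big_nil ?mul1r ?mul0r. Qed.

Lemma sum_value_coad x y v i j : sum_value (coad (PM x y) v) i j =
  (y == i)%:R * sum_value v x j + (y == j)%:R * sum_value v i x.
Proof.
have [->|/(gt_total gtO)/orP [gt_ij|gt_ji]] := eqVneq i j.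
- rewrite sum_value_diag coad_PM_PL (sum_value_symmetric v x j) /form_sign.
  by case: ifP => _; ring.
- by rewrite sum_value_gt // coad_PM_PP.
- rewrite sum_value_lt // coad_PM_PP (sum_value_symmetric v i x) (sum_value_symmetric v x j).
  by rewrite -[RHS]mul1r -[X in _ = X * _](form_sign_sq F t); ring.
Qed.

Lemma sum_value_coad2 x y v i j : x != y ->
  sum_value (coad (PM x y) (coad (PM x y) v)) i j
  = 2 * (y == i)%:R * (y == j)%:R * sum_value v x x.
Proof. by move=> neq_xy; rewrite !sum_value_coad [y == x]eq_sym (negbTE neq_xy) /=; ring. Qed.

Lemma sum_value_coad_flow x y v u i j : x != y ->
  sum_value (coad_flow t prec (PM x y) v u) i j = cong x (single y u) (sum_value v) i j.
Proof.
move=> neq_xy; rewrite /coad_flow sum_value_jet.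
rewrite [X in u ^+ 2 * X](_ : _ = 2^-1 * (2 * (y == i)%:R * (y == j)%:R * sum_value v x x)).
  rewrite sum_value_coad /cong !singleE ![_ == y]eq_sym.
  by have two0 : (2 : F) != 0 by [rewrite pnatr_eq0]; field.
by rewrite -sum_value_coad2 // /sum_value mulr_sumr; apply: eq_bigr => e _; rewrite mulrCA.
Qed.

Definition valid_sum_root r := is_sum_root r && valid r.

Lemma eq_sum_value v w r : valid_sum_root r ->
  (forall i j, i \in root_support r -> j \in root_support r ->
     sum_value v i j = sum_value w i j) -> v r = w r.
Proof.
case: r => [//|i j|//|i] /= vr eq_vw.
  have /andP [_ gt_ij] : valid (PP i j) by [].
  by rewrite -!sum_value_gt // eq_vw // !inE eqxx ?orbT.
have := eq_vw i i; rewrite !sum_value_diag inE eqxx (vr : ctype_eqb t TC).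
by move=> /(_ isT isT)/mulfI; apply; rewrite pnatr_eq0.
Qed.

Lemma coad_PM_cubed x y v r : x != y -> valid_sum_root r ->
  coad (PM x y) (coad (PM x y) (coad (PM x y) v)) r = 0.
Proof.
move=> neq_xy vr; apply: (eq_sum_value (w := fun=> 0) vr) => i j _ _.
rewrite sum_value_coad2 // sum_value_coad ![y == x]eq_sym (negbTE neq_xy) !mul0r addr0 mulr0.
by rewrite /sum_value big1 // => e _; rewrite mulr0.
Qed.

Lemma nceval_cong_flow x y T v u : gt x y -> letters valid_sum_root T ->
  coad_invariant t prec T -> ev (coad_flow t prec (PM x y) v u) T = ev v T.
Proof.
move=> gt_xy QT T_inv; apply: (nceval_coad_flow QT T_inv) => // r.
exact: coad_PM_cubed (gt_neq gtO gt_xy).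
Qed.
End SumRoots.

Section SumRootsOver.
Variables (F : numFieldType) (t : ctype) (prec : rel sel).
Local Notation gt := (gtth t prec).
Hypothesis gtO : strict_total_order gt.
Hypothesis not_A : ~~ ctype_eqb t TA.
Local Notation eta := (form_sign F t).
Implicit Types (v : proot -> F) (T : ncpoly F) (r : proot) (X : nat -> nat -> F) (s : seq nat).

Definition sum_roots_over s : pred proot :=
  fun r => valid_sum_root t prec r && all (mem s) (root_support r).

Lemma sum_root_over s x y : x \in s -> y \in s ->
  all (fun e => sum_roots_over s e.2) (sum_root F t prec x y).
Proof.
move=> xs ys; apply/allP => e xy_e.
have := allP (sum_root_valid F prec x y not_A) _ xy_e.
rewrite /sum_roots_over /valid_sum_root => ->; move: xy_e.
by rewrite /sum_root; do !case: ifP => _; rewrite // inE => /eqP -> /=; rewrite ?xs ?ys.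
Qed.

Lemma sum_roots_over_subset s s' : {subset s <= s'} ->
  {subset sum_roots_over s <= sum_roots_over s'}.
Proof.
by move=> sub r /andP [vr sr]; apply/andP; split=> //; apply: sub_all sr => x; apply: sub.
Qed.

Lemma sum_roots_over_ideal s : initial_segment gt s -> commuting_ideal F t prec (sum_roots_over s).
Proof.
move=> [_ s_up]; split=> [r /andP [/andP []] //|r r'|r r' vr].
  by case: r => [x y|x y|x|x] //; case: r' => [i j|i j|i|i].
case/andP; case: r vr => [x y|x y|x|x] vr; case: r' => [i j|i j|i|i] //= _.
  rewrite andbT => /andP [si sj]; rewrite all_cat; apply/andP; split; apply: all_if => /eqP e.
    by apply: sum_root_over => //; apply: s_up si _; rewrite -e.
  by apply: sum_root_over => //; apply: s_up sj _; rewrite -e.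
rewrite andbT => si; apply: all_if => /eqP e.
by apply: sum_root_over => //; apply: s_up si _; rewrite -e.
Qed.

Definition root_matrix s v : nat -> nat -> F :=
  fun i j => sum_value t prec v (nth 0%N s i) (nth 0%N s j).

Definition matrix_values s X r : F :=
  match r with
  | PP x y => X (index x s) (index y s)
  | PL x => X (index x s) (index x s) / 2
  | _ => 0
  end.

Section Segment.
Variable s : seq nat.
Hypothesis s_init : initial_segment gt s.
Let s_sorted : sorted gt s := s_init.1.
Let s_uniq : uniq s := gt_sorted_uniq gtO s_sorted.

Lemma root_matrix_matrix_values X i j : sign_symmetric eta X ->
  (i < size s)%N -> (j < size s)%N -> root_matrix s (matrix_values s X) i j = X i j.
Proof.
move=> symX lt_i lt_j; have gt_nth := gt_sorted_nth gtO 0%N s_sorted.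
rewrite /root_matrix; case: (ltngtP i j) => [lt_ij|lt_ji|<-].
- by rewrite sum_value_gt ?gt_nth //= !index_uniq.
- by rewrite (sum_value_lt gtO) ?gt_nth //= !index_uniq // -symX.
- rewrite (sum_value_diag gtO); move: symX; rewrite /form_sign; case: ifP => _ symX /=.
    by rewrite index_uniq // mulrC divfK // pnatr_eq0.
  by rewrite skew_diag_eq0.
Qed.

Section InvariantsOver.
Variable T : ncpoly F.
Hypothesis sT : letters (sum_roots_over s) T.
Local Notation f := (fun X => ev (matrix_values s X) T).

Lemma nceval_root_matrix X w :
  (forall i j, (i < size s)%N -> (j < size s)%N -> root_matrix s w i j = X i j) ->
  sign_symmetric eta X -> ev w T = f X.
Proof.
move=> wX symX; apply: (eq_nceval sT) => r /andP [vr /allP rs].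
apply: (eq_sum_value gtO vr) => x y /rs xs /rs ys.
rewrite -(nth_index 0%N xs) -(nth_index 0%N ys) -!/(root_matrix s _ _ _).
by rewrite wX ?root_matrix_matrix_values ?index_mem.
Qed.

Lemma matrix_values_local X Y :
  (forall i j, (i < size s)%N -> (j < size s)%N -> X i j = Y i j) -> f X = f Y.
Proof.
move=> eqXY; apply: (eq_nceval sT) => r /andP [_ /allP rs].
case: r rs => [//|i j|//|i] /= rs; first by rewrite eqXY ?index_mem ?rs // !inE eqxx ?orbT.
by rewrite eqXY ?index_mem ?rs // inE.
Qed.

Lemma matrix_values_polynomial : polynomial_on_lines f.
Proof.
move=> X H; have [p pE] := nceval_line (matrix_values s X) (matrix_values s H) T.
exists p => u; rewrite -pE; congr (nceval _ _ T); apply: funext => r.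
by case: r => [i j|i j|i|i] /=; rewrite /line; ring.
Qed.

Hypothesis T_inv : coad_invariant t prec T.

Lemma matrix_values_cong_single a b u X : (a < b < size s)%N -> sign_symmetric eta X ->
  f (cong a (single b u) X) = f X.
Proof.
move=> /andP [lt_ab lt_b] symX; have lt_a := ltn_trans lt_ab lt_b.
have gt_ab : gt (nth 0%N s a) (nth 0%N s b) by rewrite (gt_sorted_nth gtO).
have vT : letters (valid_sum_root t prec) T by apply: letters_subset sT => r /andP [].
rewrite -(nceval_cong_flow gtO (matrix_values s X) u gt_ab vT T_inv).
apply/esym/nceval_root_matrix; last exact: cong_sign_symmetric.
move=> i j lt_i lt_j; rewrite /root_matrix (sum_value_coad_flow gtO _ _ _ _ (gt_neq gtO gt_ab)).
rewrite /cong !singleE !nth_uniq // -!/(root_matrix s _ _ _).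
by rewrite !root_matrix_matrix_values.
Qed.

Lemma matrix_values_cong a c X : sign_symmetric eta X ->
  (forall i, c i != 0 -> (a < i < size s)%N) -> f (cong a c X) = f X.
Proof.
move=> symX c_supp; apply: (cong_invariant (n := size s) (e := eta)) => // b u Y.
exact: matrix_values_cong_single.
Qed.
End InvariantsOver.
End Segment.
End SumRootsOver.

Section SliceMatrices.
Variables (F : numFieldType) (t : ctype).
Implicit Types (d : nat -> F) (X : nat -> nat -> F).

Definition slice_matrix d := if ctype_eqb t TC then diagm d else skewm d.

Lemma slice_matrix_symmetric d : sign_symmetric (form_sign F t) (slice_matrix d).
Proof.
rewrite /form_sign /slice_matrix; case: ifP => _; first exact: diagm_symmetric.
exact: skewm_skew.
Qed.

Lemma slice_matrixE d i j :
  slice_matrix d i j = slice_matrix (fun=> 1) i j * d (i %/ step_size t)%N.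
Proof.
rewrite /slice_matrix /step_size; case: ifP => _; rewrite ?divn1 ?divn2.
  by rewrite /diagm; case: ifP => _; rewrite ?mul1r ?mul0r.
by rewrite /skewm; do 2?case: ifP => _; rewrite ?mulN1r ?mul1r ?mul0r.
Qed.

Lemma slice_matrix_index n d i j : (i < n)%N -> (j < n)%N -> slice_matrix d i j != 0 ->
  (i %/ step_size t < n %/ step_size t)%N.
Proof.
rewrite /slice_matrix /step_size; case: ifP => _ lt_i lt_j; rewrite ?divn1 ?divn2 //.
rewrite /skewm /partner; case: (j =P _) => [eq_j _|_]; last by rewrite eqxx.
by move: eq_j; case: ifP; lia.
Qed.

Lemma symmetric_form_eq0 n (f : (nat -> nat -> F) -> F) :
  (forall X Y, (forall i j, (i < n)%N -> (j < n)%N -> X i j = Y i j) -> f X = f Y) ->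
  (forall a c X, sign_symmetric (form_sign F t) X ->
     (forall i, c i != 0 -> (a < i < n)%N) -> f (cong a c X) = f X) ->
  polynomial_on_lines f -> (forall d, f (slice_matrix d) = 0) ->
  forall X, sign_symmetric (form_sign F t) X -> f X = 0.
Proof.
rewrite /form_sign /slice_matrix; case: ifP => _ f_local f_cong f_poly.
  exact: (symmetric_eq0_of_diag (n := n)).
exact: (skew_eq0_of_skewm (n := n)).
Qed.

Definition form_value q X : F := if ctype_eqb t TC then rev_det q X else pfaffian q X.

Lemma eq_form_value q X Y :
  (forall i j, (i < q * step_size t)%N -> (j < q * step_size t)%N -> X i j = Y i j) ->
  form_value q X = form_value q Y.
Proof.
rewrite /form_value /step_size; case: ifP => _; rewrite ?muln1 ?muln2; first exact: eq_rev_det.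
exact: eq_pfaffian.
Qed.

Lemma form_value_cong q a b u X : (a < b)%N ->
  form_value q (cong a (single b u) X) = form_value q X.
Proof.
by move=> lt_ab; rewrite /form_value; case: ifP => _; [apply: rev_det_cong|apply: pfaffian_cong].
Qed.

Lemma form_value_slice_matrix q : exists2 c : F, c != 0 &
  forall d, form_value q (slice_matrix d) = c * \prod_(i < q) d i.
Proof.
rewrite /form_value /slice_matrix; case: (ctype_eqb t TC); last exact: pfaffian_skewm.
exists ((-1) ^+ rev_perm q : F) => [|d]; first by rewrite signr_eq0.
exact: rev_det_diagm.
Qed.
End SliceMatrices.

Lemma slice_matrix_torus_regular (F : numClosedFieldType) t (f : (nat -> nat -> F) -> F) n q d :
  polynomial_on_lines f ->
  (forall a b u X, (a < b < n)%N -> sign_symmetric (form_sign F t) X ->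
     f (cong a (single b u) X) = f X) ->
  (q.+1 < n %/ step_size t)%N -> (forall l, d l != 0) ->
  exists p : {poly F}, forall s, s != 0 ->
    f (slice_matrix t (torus_scale q q.+1 s d)) = p.[s].
Proof.
rewrite /slice_matrix /form_sign /step_size; case: ifP => _ f_poly f_cong.
  rewrite divn1 => lt_q; apply: symmetric_torus_regular => // u X.
  by apply: f_cong; rewrite ltnSn.
rewrite divn2 => lt_q; apply: skew_torus_regular => // a b u X lt_ab.
by apply: f_cong; lia.
Qed.

Section FPlus.
Variables (F : numFieldType) (t : ctype) (prec : rel sel).
Local Notation gt := (gtth t prec).
Hypothesis gtO : strict_total_order gt.
Implicit Types (v : proot -> F) (i j : nat).

Lemma sum_root_neq i j : i != j -> exists2 c, c != 0 &
  sum_root F t prec i j = [:: (c, fplus t prec i j)].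
Proof.
move=> neq_ij; rewrite /fplus /sum_root; case: ifP => [_|ngt_ij].
  by exists 1; rewrite ?oner_eq0.
have := gt_total gtO neq_ij; rewrite ngt_ij /= => ->.
by exists (form_sign F t); rewrite // /form_sign; case: ifP => _; rewrite ?oppr_eq0 oner_eq0.
Qed.

Lemma fplusC i j : i != j -> fplus t prec i j = fplus t prec j i.
Proof.
by move=> /(gt_total gtO)/orP [] gt_ij; rewrite /fplus gt_ij (gt_asym gtO gt_ij).
Qed.

Lemma fplus_valid i j : ~~ ctype_eqb t TA -> i != j -> valid t prec (fplus t prec i j).
Proof.
move=> not_A neq_ij; have := sum_root_valid F prec i j not_A.
by have [c _ ->] := sum_root_neq neq_ij; rewrite /= andbT.
Qed.

Lemma mem_fplus_support i j : i \in root_support (fplus t prec i j).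
Proof. by rewrite /fplus; case: ifP => _; rewrite !inE eqxx ?orbT. Qed.

Lemma sum_value_fplus v i j : ctype_eqb t TC -> i != j ->
  sum_value t prec v i j = v (fplus t prec i j).
Proof.
move=> is_C /(gt_total gtO)/orP [gt_ij|gt_ji]; rewrite /fplus.
  by rewrite sum_value_gt // gt_ij.
by rewrite (sum_value_lt gtO) // (gt_asym gtO gt_ji) /form_sign is_C mul1r.
Qed.

End FPlus.

Section CascadeGenerators.
Variables (F : numFieldType) (t : ctype) (prec : rel sel).
Local Notation gt := (gtth t prec).
Hypothesis gtO : strict_total_order gt.
Hypothesis not_A : ~~ ctype_eqb t TA.
Local Notation expand := (@expand F t prec).
Local Notation root_matrix := (@root_matrix F t prec).
Local Notation sum_roots_over := (sum_roots_over t prec).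
Implicit Types (v : proot -> F) (q : nat) (a : nat -> nat) (s : seq nat).

Definition form_generator q a : term F :=
  if ctype_eqb t TC then Delta_C F t prec q a else Pf_BD F q a.

Section Listing.
Variables (q : nat) (a : nat -> nat) (s : seq nat).
Hypothesis s_sorted : sorted gt s.
Hypothesis a_s : mkseq a (q * step_size t) = s.

Let nth_s i : (i < q * step_size t)%N -> nth 0%N s i = a i.
Proof. by move=> lt_i; rewrite -a_s nth_mkseq. Qed.
Let size_s : size s = (q * step_size t)%N.
Proof. by rewrite -a_s size_mkseq. Qed.
Let gt_a i j : (i < q * step_size t)%N -> (j < q * step_size t)%N -> gt (a i) (a j) = (i < j)%N.
Proof. by move=> lt_i lt_j; rewrite -!nth_s // (gt_sorted_nth gtO) ?size_s. Qed.
Let mem_a i : (i < q * step_size t)%N -> a i \in s.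
Proof. by move=> lt_i; rewrite -nth_s // mem_nth ?size_s. Qed.

Lemma teval_Delta_C v : ctype_eqb t TC ->
  teval t prec v (Delta_C F t prec q a) = rev_det q (root_matrix s v).
Proof.
move=> is_C; rewrite teval_tdet; congr (\det _); apply/matrixP => i j; rewrite !mxE.
have [lt_i lt_j] := (ltn_ord i, ltn_ord j); have lt_rj : (q.-1 - j < q)%N by lia.
have size_C := mul_step_size_C q is_C.
rewrite /root_matrix !nth_s ?size_C //.
case: eqP => [eq_ij|neq_ij].
  rewrite (_ : (q.-1 - j)%N = i) ?(sum_value_diag gtO) ?is_C; last by lia.
  by rewrite tevalZ teval_gen.
have neq_a : a i != a (q.-1 - j)%N.
  by rewrite -!nth_s ?size_C // nth_uniq ?size_s ?size_C ?(gt_sorted_uniq gtO) //; lia.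
by rewrite (sum_value_fplus gtO) // teval_gen // (fplus_valid F gtO).
Qed.

Lemma teval_Pf_BD v : ~~ ctype_eqb t TC ->
  teval t prec v (Pf_BD F q a) = pfaffian q (root_matrix s v).
Proof.
move=> not_C; apply: teval_tpf => i j; have [lt_i lt_j] := (ltn_ord i, ltn_ord j).
have size_BD := mul_step_size_BD q not_C.
rewrite /root_matrix !nth_s ?size_BD //.
have valid_PP k l : (k < q.*2)%N -> (l < q.*2)%N -> (k < l)%N -> valid t prec (PP (a k) (a l)).
  by move=> lt_k lt_l lt_kl; rewrite /= not_A gt_a ?size_BD.
case: (ltngtP i j) => [lt_ij|lt_ji|/val_inj ->].
- by rewrite teval_gen ?valid_PP // sum_value_gt // gt_a ?size_BD.
- rewrite tevalZ teval_gen ?valid_PP // (sum_value_lt gtO) ?gt_a ?size_BD //.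
  by rewrite /form_sign (negbTE not_C).
- by rewrite teval_const (sum_value_diag gtO) (negbTE not_C).
Qed.

Lemma teval_form_generator v :
  teval t prec v (form_generator q a) = form_value t q (root_matrix s v).
Proof.
rewrite /form_generator /form_value; have [is_C|not_C] := boolP (ctype_eqb t TC).
  exact: teval_Delta_C.
exact: teval_Pf_BD.
Qed.

Lemma letters_form_generator : letters (sum_roots_over s) (expand (form_generator q a)).
Proof.
have PP_over i j : (i < j < q * step_size t)%N -> sum_roots_over s (PP (a i) (a j)).
  move=> /andP [lt_ij lt_j]; have lt_i := ltn_trans lt_ij lt_j.
  by rewrite /sum_roots_over /valid_sum_root /= not_A gt_a // lt_ij !mem_a.
rewrite /form_generator; have [is_C|not_C] := boolP (ctype_eqb t TC).
  apply: letters_tdet => i j; have [lt_i lt_j] := (ltn_ord i, ltn_ord j).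
  have size_C := mul_step_size_C q is_C.
  case: eqP => [eq_ij|neq_ij].
    apply/letters_tscale/letters_gen.
    by rewrite /sum_roots_over /valid_sum_root /= is_C mem_a ?size_C.
  have lt_rj : (q.-1 - j < q)%N by lia.
  apply: letters_gen; rewrite /fplus gt_a ?size_C //.
  by case: ltnP => lt_ij; apply: PP_over; rewrite size_C; lia.
have size_BD := mul_step_size_BD q not_C.
apply: letters_tpf => i j; have [lt_i lt_j] := (ltn_ord i, ltn_ord j).
by case: ltngtP => // lt_ij; [|apply: letters_tscale];
  apply: letters_gen; apply: PP_over; rewrite size_BD lt_ij.
Qed.
End Listing.

Lemma form_generator_invariant q a s : initial_segment gt s -> mkseq a (q * step_size t) = s ->
  invariant_in t prec (sum_roots_over s) (form_generator q a).
Proof.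
move=> [s_sorted s_up] a_s; have sT := letters_form_generator s_sorted a_s; split=> // r v vr.
have coad0 : (forall x, sum_roots_over s x -> coad t prec r v x = 0) ->
    ncderiv v (coad t prec r v) (expand (form_generator q a)) = 0.
  by move=> r0; rewrite -[RHS](ncderiv0 v (expand (form_generator q a))); apply: (eq_ncderiv sT).
case: r vr coad0 => [x y gt_xy|x y _|x _|x _]; last 3 first.
- by apply=> -[i j|i j|i|i] // _; rewrite /coad big_nil.
- by apply=> -[i j|i j|i|i] // _; rewrite /coad big_nil.
- by apply=> -[i j|i j|i|i] // _; rewrite /coad big_nil.
have [ys _|nys] := boolP (y \in s); last first.
  have neq_y i : i \in s -> (y == i) = false by move=> si; apply: contraNF nys => /eqP ->.
  apply=> -[i j|i j|i|i] // /andP [_ /=]; rewrite ?coad_PM_PP ?coad_PM_PL andbT.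
    by case/andP => si sj; rewrite !neq_y // !mul0r addr0.
  by move=> si; rewrite neq_y // mul0r.
have size_s : size s = (q * step_size t)%N by rewrite -a_s size_mkseq.
have neq_xy := gt_neq gtO gt_xy; have xs := s_up x y ys gt_xy.
apply: ncderiv_coad_eq0_of_flow => u; rewrite -!/(teval _ _ _ _).
rewrite !(teval_form_generator s_sorted a_s).
rewrite -[RHS](@form_value_cong F t q (index x s) (index y s) u).
  apply: eq_form_value => i j; rewrite -size_s => lt_i lt_j.
  rewrite /root_matrix (sum_value_coad_flow gtO _ _ _ _ neq_xy) /cong !singleE !nth_index //.
  have eq_y k : (k < size s)%N -> (nth 0%N s k == y) = (k == index y s).
    by move=> lt_k; rewrite -{1}(nth_index 0%N ys) nth_uniq ?index_mem ?(gt_sorted_uniq gtO).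
  by rewrite !eq_y.
by rewrite -(gt_sorted_nth gtO 0%N s_sorted) ?index_mem ?nth_index.
Qed.

Lemma is_generator_initial q s G : initial_segment gt s -> (q * step_size t <= size s)%N ->
  is_generator t prec q G ->
  exists2 a, mkseq a (q * step_size t) = take (q * step_size t) s & G = form_generator q a.
Proof.
move=> s_init le_s [a]; have Nq := Nset_initial gtO not_A s_init le_s.
have [take_sorted _] := initial_segment_take gtO (q * step_size t) s_init.
have := dec_listing_sorted gtO (n := q * step_size t) (a := a) _ take_sorted Nq.
rewrite /form_generator /step_size; move: not_A.
by case: t => //= _; rewrite ?muln1 ?muln2 => listing [/listing a_s ->]; exists a.
Qed.
End CascadeGenerators.

Section FormSlice.
Variables (F : numClosedFieldType) (t : ctype) (prec : rel sel).
Local Notation gt := (gtth t prec).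
Hypothesis gtO : strict_total_order gt.
Hypothesis not_A : ~~ ctype_eqb t TA.
Variable s : seq nat.
Hypothesis s_init : initial_segment gt s.
Local Notation sum_roots_over := (sum_roots_over t prec).
Local Notation matrix_values := (@matrix_values F s).
Implicit Types (d : nat -> F) (r : proot) (T : ncpoly F).

Definition form_slice_coef r : F :=
  if sum_roots_over s r then matrix_values (slice_matrix t (fun=> 1)) r else 0.
Definition form_slice_index r : nat := (index (head 0%N (root_support r)) s %/ step_size t)%N.
Local Notation slice d := (slice_point form_slice_coef form_slice_index d).

Lemma form_slice_pointE d r : sum_roots_over s r -> slice d r = matrix_values (slice_matrix t d) r.
Proof.
move=> sr; rewrite /slice_point /form_slice_coef sr /form_slice_index.
case: r {sr} => [i j|i j|i|i] /=; rewrite ?mul0r //; first by rewrite [RHS]slice_matrixE.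
by rewrite [in RHS]slice_matrixE mulrAC.
Qed.

Lemma nceval_form_slice d T : letters (sum_roots_over s) T ->
  ev (slice d) T = ev (matrix_values (slice_matrix t d)) T.
Proof. by move=> sT; apply: (eq_nceval sT) => r; apply: form_slice_pointE. Qed.

Lemma form_slice_index_lt r :
  form_slice_coef r != 0 -> (form_slice_index r < size s %/ step_size t)%N.
Proof.
rewrite /form_slice_coef; case: ifP => [/andP [_ /allP rs]|_]; last by rewrite eqxx.
rewrite /form_slice_index; case: r rs => [i j|i j|i|i] //= rs; rewrite ?eqxx //.
  by apply: slice_matrix_index; rewrite index_mem rs // !inE eqxx ?orbT.
rewrite mulf_eq0 => /norP [+ _]; apply: slice_matrix_index; rewrite index_mem rs //.
  exact: mem_head.
exact: mem_head.
Qed.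

Variable G : nat -> term F.
Hypothesis G_gen : forall q, (0 < q)%N -> cascade_ge t prec q -> is_generator t prec q (G q).

Lemma form_generatorP i : (i < size s %/ step_size t)%N ->
  let n := (i.+1 * step_size t)%N in
  exists2 a, mkseq a n = take n s & G i.+1 = form_generator F t prec i.+1 a.
Proof.
move=> lt_i n; have le_s : (n <= size s)%N.
  by rewrite -leq_divRL // step_size_gt0.
have casc := cascade_ge_initial gtO not_A s_init le_s.
exact (is_generator_initial gtO not_A s_init le_s (G_gen (ltn0Sn i) casc)).
Qed.

Lemma form_generator_in_slice i : (i < size s %/ step_size t)%N ->
  invariant_in t prec (sum_roots_over s) (G i.+1).
Proof.
move=> /form_generatorP [a a_s ->].
have [letters_G G_inv] := form_generator_invariant F gtO not_A
  (initial_segment_take gtO _ s_init) a_s.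
split=> //; apply: letters_subset letters_G; apply: sum_roots_over_subset => x.
exact: mem_take.
Qed.

Lemma form_generator_on_slice i d : (i < size s %/ step_size t)%N ->
  teval t prec (slice d) (G i.+1) = form_value t i.+1 (slice_matrix t d).
Proof.
move=> lt_i; have [letters_G _] := form_generator_in_slice lt_i.
rewrite /teval nceval_form_slice // -/(teval t prec _ (G i.+1)).
have [a a_s ->] := form_generatorP lt_i.
have [take_sorted _] := initial_segment_take gtO (i.+1 * step_size t) s_init.
rewrite (teval_form_generator gtO not_A take_sorted a_s); apply: eq_form_value => k l lt_k lt_l.
have le_s : (i.+1 * step_size t <= size s)%N by rewrite -leq_divRL // step_size_gt0.
rewrite /root_matrix !nth_take // -/(root_matrix t prec s _ k l).
rewrite (root_matrix_matrix_values gtO s_init) ?(leq_trans _ le_s) //.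
exact: slice_matrix_symmetric.
Qed.

Lemma form_generic_slice : exists c, generic_slice t prec G (size s %/ step_size t)
  (sum_roots_over s) form_slice_coef form_slice_index c.
Proof.
have /choice [c cP] : forall q, exists c : F, c != 0 /\
    forall d, form_value t q (slice_matrix t d) = c * \prod_(i < q) d i.
  by move=> q; have [c c0 cE] := form_value_slice_matrix F t q; exists c.
exists (fun i => c i.+1); split.
- exact: sum_roots_over_ideal.
- exact: form_slice_index_lt.
- exact: form_generator_in_slice.
- by move=> i; have [] := cP i.+1.
- by move=> i d lt_i; rewrite form_generator_on_slice //; have [_ ->] := cP i.+1.
- move=> T sT T_inv T0 v.
  rewrite (nceval_root_matrix gtO s_init sT (X := root_matrix t prec s v)) //; last first.
    by move=> i j; apply: (sum_value_symmetric gtO).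
  apply: (symmetric_form_eq0 (t := t) (n := size s)
    (f := fun X => ev (matrix_values X) T)) => [X Y|a b X symX|||].
  + exact: (matrix_values_local sT).
  + exact: (matrix_values_cong gtO s_init sT T_inv symX).
  + exact: matrix_values_polynomial.
  + by move=> d; rewrite -nceval_form_slice.
  + by move=> i j; apply: (sum_value_symmetric gtO).
- move=> T sT T_inv q d lt_q d0.
  have [p pE] := slice_matrix_torus_regular (matrix_values_polynomial s T)
    (matrix_values_cong_single gtO s_init sT T_inv) lt_q d0.
  by exists p => u u0; rewrite nceval_form_slice // pE.
Qed.
End FormSlice.

Section FormReduction.
Variables (F : numFieldType) (t : ctype) (prec : rel sel) (M s : seq nat).
Local Notation gt := (gtth t prec).
Hypothesis gtO : strict_total_order gt.
Hypothesis not_A : ~~ ctype_eqb t TA.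
Hypothesis s_max : forall x, x \in M -> x \notin s -> exists2 k, k \notin M & gt k x.
Variable T : ncpoly F.
Hypothesis MT : letters (roots_in t prec M) T.
Hypothesis T_inv : coad_invariant t prec T.
Local Notation bracket := (bracket F t prec).

Lemma partial_PM_eq0 i j v : roots_in t prec M (PM i j) -> ncderiv v (partial_dir F (PM i j)) T = 0.
Proof.
move=> M_ij; have [k nMk] := exists_notin_nat M.
have [iM jM] : i \in M /\ j \in M by case/andP: M_ij => _ /= /and3P [].
have neq_ki : k != i by apply: contraNneq nMk => ->.
have neq_kj : k != j by apply: contraNneq nMk => ->.
have [c c0 sumE] := sum_root_neq F gtO neq_ki.
have : exists2 c, c != 0 & bracket (fplus t prec k j) (PM i j) = [:: (c, fplus t prec k i)].
  rewrite {1}/fplus; case: ifP => _ /=; rewrite eqxx eq_sym (negbTE neq_kj).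
    by exists (- c); rewrite ?oppr_eq0 // sumE.
  rewrite eq_sym in neq_ki; have [c' c'0 ->] := sum_root_neq F gtO neq_ki.
  by exists (- c'); rewrite ?oppr_eq0 // fplusC.
case=> c' c'0 bracketE; apply: (partial_eq0_of_bracket gtO MT T_inv _ _ nMk M_ij bracketE c'0).
  exact: fplus_valid.
exact: mem_fplus_support.
Qed.

Lemma partial_PS_eq0 i v : roots_in t prec M (PS i) -> ncderiv v (partial_dir F (PS i)) T = 0.
Proof.
move=> M_i; have [k nMk] := exists_notin_nat M.
have [vi iM] : valid t prec (PS i) /\ i \in M by case/andP: M_i => /= ? /andP [].
have neq_ki : k != i by apply: contraNneq nMk => ->.
have [c c0 sumE] := sum_root_neq F gtO neq_ki.
apply: (partial_eq0_of_bracket gtO MT T_inv (r := PS k) vi _ nMk M_i (c0 := - c));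
  rewrite ?oppr_eq0 //.
  exact: mem_head.
by rewrite /= sumE.
Qed.

Lemma partial_sum_root_eq0 r v : roots_in t prec M r -> valid_sum_root t prec r ->
  ~~ sum_roots_over t prec s r -> ncderiv v (partial_dir F r) T = 0.
Proof.
move=> Mr vr; rewrite /sum_roots_over vr => /allPn [z r_z nsz].
have [k nMk gt_kz] : exists2 k, k \notin M & gt k z.
  by apply: s_max => //; case/andP: Mr => _ /allP; apply.
have neq_k x : x \in root_support r -> k != x.
  by move=> r_x; apply: contraNneq nMk => ->; case/andP: Mr => _ /allP; apply.
have [c c0 [x bracketE]] : exists2 c, c != 0 &
    exists x, bracket (PM k z) r = [:: (c, fplus t prec k x)].
  case: r vr r_z neq_k {Mr} => [//|i j|//|i] /andP [_ vr]; rewrite !inE => r_z neq_k; last first.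
    rewrite (eqP r_z) /= eqxx; have [|c c0 ->] := sum_root_neq F gtO (i := k) (j := i).
      by apply: neq_k; rewrite inE.
    by exists c => //; exists i.
  have neq_ij : i != j by case/andP: vr => _; apply: gt_neq.
  case/orP: r_z => /eqP -> /=; rewrite eqxx.
    rewrite (negbTE neq_ij) cats0; have [|c c0 ->] := sum_root_neq F gtO (i := k) (j := j).
      by apply: neq_k; rewrite !inE eqxx orbT.
    by exists c => //; exists j.
  rewrite eq_sym (negbTE neq_ij); have [|c c0 ->] := sum_root_neq F gtO (i := i) (j := k).
    by rewrite eq_sym neq_k // inE eqxx.
  by exists c => //; exists i; rewrite fplusC // eq_sym neq_k // inE eqxx.
apply: (partial_eq0_of_bracket gtO MT T_inv (r := PM k z) gt_kz _ nMk Mr bracketE c0).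
exact: mem_head.
Qed.
End FormReduction.

Lemma form_reduces_to (F : numFieldType) t prec (M s : seq nat) :
  strict_total_order (gtth t prec) -> ~~ ctype_eqb t TA ->
  (forall x, x \in M -> x \notin s -> exists2 k, k \notin M & gtth t prec k x) ->
  reduces_to F t prec (sum_roots_over t prec s) (roots_in t prec M).
Proof.
move=> gtO not_A s_max T MT T_inv; apply: (nceval_filter_of_partial MT) => r Mr nsr v.
have vr : valid t prec r by case/andP: Mr.
case: r vr Mr nsr => [i j|i j|i|i] vr Mr nsr.
- exact: (partial_PM_eq0 gtO not_A MT T_inv v Mr).
- exact: (partial_sum_root_eq0 gtO s_max MT T_inv v Mr).
- exact: (partial_PS_eq0 gtO MT T_inv v Mr).
- exact: (partial_sum_root_eq0 gtO s_max MT T_inv v Mr).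
Qed.

(** * Slices in type A *)

Section Rectangles.
Variables (F : numFieldType) (t : ctype) (prec : rel sel).
Local Notation gt := (gtth t prec).
Local Notation lt := (fun i j => gtth t prec j i).
Hypothesis gtO : strict_total_order gt.
Hypothesis is_A : ctype_eqb t TA.
Local Notation valid := (valid t prec).
Local Notation coad := (@coad F t prec).
Implicit Types (v : proot -> F) (T : ncpoly F) (r : proot) (X : nat -> nat -> F) (s : seq nat).

Variant difference_root_spec : proot -> Prop :=
  DifferenceRoot x y of gt x y : difference_root_spec (PM x y).

Lemma valid_A r : valid r -> difference_root_spec r.
Proof. by case: r => [x y|x y|x|x]; [apply: DifferenceRoot|case: t is_A..]. Qed.

Lemma coad_PM_PM x y v i j :
  coad (PM x y) v (PM i j) = (y == i)%:R * v (PM x j) - (j == x)%:R * v (PM i y).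
Proof.
rewrite /coad /= big_cat /=.
by case: (y == i); case: (j == x); rewrite ?big_seq1 ?big_nil /=; ring.
Qed.

Lemma coad_PM_squared x y v i j : gt x y -> gt i j ->
  coad (PM x y) (coad (PM x y) v) (PM i j) = 0.
Proof.
move=> gt_xy gt_ij; rewrite !coad_PM_PM [y == x]eq_sym.
rewrite (negbTE (gt_neq gtO gt_xy)) /=.
have [eq_yi|_] := eqVneq y i; last by rewrite /=; ring.
have [eq_jx|_] := eqVneq j x; last by rewrite /=; ring.
by rewrite -eq_yi eq_jx (gt_asym gtO gt_xy) in gt_ij.
Qed.

Lemma coad_flow_PM x y v u i j : gt x y -> gt i j -> coad_flow t prec (PM x y) v u (PM i j)
  = v (PM i j) + u * ((y == i)%:R * v (PM x j) - (j == x)%:R * v (PM i y)).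
Proof.
by move=> gt_xy gt_ij; rewrite /coad_flow /jet coad_PM_squared // coad_PM_PM !mulr0 addr0.
Qed.

Lemma nceval_PM_flow x y T v u : gt x y -> letters valid T -> coad_invariant t prec T ->
  ev (coad_flow t prec (PM x y) v u) T = ev v T.
Proof.
move=> gt_xy vT T_inv; apply: (nceval_coad_flow vT T_inv) => // r /valid_A [i j gt_ij].
exact: coad_PM_squared.
Qed.

Definition rectangle s s' : pred proot :=
  fun r => if r is PM x y then (x \in s) && (y \in s') else false.

Definition rect_matrix s s' v : nat -> nat -> F :=
  fun i j => v (PM (nth 0%N s i) (nth 0%N s' j)).

Definition rect_values s s' X r : F :=
  if r is PM x y then X (index x s) (index y s') else 0.

Section Rectangle.
Variables s s' : seq nat.
Hypothesis s_init : initial_segment gt s.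
Hypothesis s'_init : initial_segment lt s'.
Let gt_ss' x y (sx : x \in s) (s'y : y \in s') : gt x y :=
  initial_gt_final gtO s_init s'_init sx s'y.
Let ltO : strict_total_order lt := converse_strict_total_order gtO.
Let s_uniq : uniq s := gt_sorted_uniq gtO s_init.1.
Let s'_uniq : uniq s' := gt_sorted_uniq ltO s'_init.1.

Lemma rectangle_valid : {subset rectangle s s' <= valid}.
Proof. by case=> // x y /andP [sx s'y]; apply: gt_ss'. Qed.

Lemma rectangle_ideal : commuting_ideal F t prec (rectangle s s').
Proof.
split=> [|r r'|r r' /valid_A [x y gt_xy]]; first exact: rectangle_valid.
  case: r r' => [x y|//|//|//] [i j|//|//|//] /andP [sx s'y] /andP [si s'j] /=.
  rewrite [y == i]eq_sym (negbTE (gt_neq gtO (gt_ss' si s'y))).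
  by rewrite [j == x]eq_sym (negbTE (gt_neq gtO (gt_ss' sx s'j))).
case: r' => [i j|//|//|//] /andP [si s'j].
rewrite /= all_cat; apply/andP; split; apply: all_if => /eqP e /=; rewrite andbT.
  by rewrite s'j andbT; apply: s_init.2 si _; rewrite -e.
by rewrite si; apply: s'_init.2 s'j _; rewrite e.
Qed.

Lemma rect_matrix_rect_values X i j : (i < size s)%N -> (j < size s')%N ->
  rect_matrix s s' (rect_values s s' X) i j = X i j.
Proof. by move=> lt_i lt_j; rewrite /rect_matrix /= !index_uniq. Qed.

Lemma rect_matrix_row_flow a b v u i j : (a < b < size s)%N ->
  (i < size s)%N -> (j < size s')%N ->
  rect_matrix s s' (coad_flow t prec (PM (nth 0%N s a) (nth 0%N s b)) v u) i j
  = rowop a (single b u) (rect_matrix s s' v) i j.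
Proof.
move=> /andP [lt_ab lt_b] lt_i lt_j; have lt_a := ltn_trans lt_ab lt_b.
have gt_ab : gt (nth 0%N s a) (nth 0%N s b) by rewrite (gt_sorted_nth gtO) ?s_init.1.
have gt_nth k : (k < size s)%N -> gt (nth 0%N s k) (nth 0%N s' j).
  by move=> lt_k; apply: gt_ss'; apply: mem_nth.
rewrite /rect_matrix coad_flow_PM ?gt_nth // /rowop singleE nth_uniq // [b == i]eq_sym.
by rewrite [_ == nth _ _ a]eq_sym (negbTE (gt_neq gtO (gt_nth _ lt_a))) /=; ring.
Qed.

Lemma rect_matrix_col_flow a b v u i j : (a < b < size s')%N ->
  (i < size s)%N -> (j < size s')%N ->
  rect_matrix s s' (coad_flow t prec (PM (nth 0%N s' b) (nth 0%N s' a)) v u) i j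
  = colop a (single b (- u)) (rect_matrix s s' v) i j.
Proof.
move=> /andP [lt_ab lt_b] lt_i lt_j; have lt_a := ltn_trans lt_ab lt_b.
have gt_ba : gt (nth 0%N s' b) (nth 0%N s' a).
  by rewrite (gt_sorted_nth (gt := lt) ltO) ?s'_init.1.
have gt_nth k : (k < size s')%N -> gt (nth 0%N s i) (nth 0%N s' k).
  by move=> lt_k; apply: gt_ss'; apply: mem_nth.
rewrite /rect_matrix coad_flow_PM ?gt_nth // /colop singleE nth_uniq //.
by rewrite [nth _ _ a == _]eq_sym (negbTE (gt_neq gtO (gt_nth _ lt_a))) /=; ring.
Qed.

Section InvariantsOver.
Variable T : ncpoly F.
Hypothesis QT : letters (rectangle s s') T.
Local Notation f := (fun X => ev (rect_values s s' X) T).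

Lemma nceval_rect_matrix X w :
  (forall i j, (i < size s)%N -> (j < size s')%N -> rect_matrix s s' w i j = X i j) ->
  ev w T = f X.
Proof.
move=> wX; apply: (eq_nceval QT) => -[x y|//|//|//] /andP [sx s'y] /=.
by rewrite -wX ?index_mem // /rect_matrix !nth_index.
Qed.

Lemma rect_values_local X Y :
  (forall i j, (i < size s)%N -> (j < size s')%N -> X i j = Y i j) -> f X = f Y.
Proof.
move=> eqXY; apply: nceval_rect_matrix => i j lt_i lt_j.
by rewrite rect_matrix_rect_values ?eqXY.
Qed.

Lemma rect_values_polynomial : polynomial_on_lines f.
Proof.
move=> X H; have [p pE] := nceval_line (rect_values s s' X) (rect_values s s' H) T.
exists p => u; rewrite -pE; congr (nceval _ _ T); apply: funext => r.
by case: r => [i j|i j|i|i] /=; rewrite /line; ring.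
Qed.

Hypothesis T_inv : coad_invariant t prec T.
Let vT : letters valid T := letters_subset rectangle_valid QT.

Lemma rect_values_rowop a c X : (forall i, c i != 0 -> (a < i < size s)%N) ->
  f (rowop a c X) = f X.
Proof.
apply: rowop_invariant => b u Y lt_ab; have /andP [lt_a lt_b] := lt_ab.
have gt_ab : gt (nth 0%N s a) (nth 0%N s b).
  by rewrite (gt_sorted_nth gtO) ?s_init.1 ?(ltn_trans lt_a lt_b).
rewrite -(nceval_PM_flow (rect_values s s' Y) u gt_ab vT T_inv).
apply/esym/nceval_rect_matrix => i j lt_i lt_j.
by rewrite rect_matrix_row_flow // /rowop !rect_matrix_rect_values ?(ltn_trans lt_a lt_b).
Qed.

Lemma rect_values_colop a c X : (forall i, c i != 0 -> (a < i < size s')%N) ->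
  f (colop a c X) = f X.
Proof.
apply: colop_invariant => b u Y lt_ab; have /andP [lt_a lt_b] := lt_ab.
have gt_ba : gt (nth 0%N s' b) (nth 0%N s' a).
  by rewrite (gt_sorted_nth (gt := lt) ltO) ?s'_init.1 ?(ltn_trans lt_a lt_b).
rewrite -(nceval_PM_flow (rect_values s s' Y) (- u) gt_ba vT T_inv).
apply/esym/nceval_rect_matrix => i j lt_i lt_j.
rewrite rect_matrix_col_flow // opprK /colop.
by rewrite !rect_matrix_rect_values ?(ltn_trans lt_a lt_b).
Qed.
End InvariantsOver.
End Rectangle.
End Rectangles.

Section RectangleGenerators.
Variables (F : numFieldType) (t : ctype) (prec : rel sel).
Local Notation gt := (gtth t prec).
Local Notation lt := (fun i j => gtth t prec j i).
Hypothesis gtO : strict_total_order gt.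
Hypothesis is_A : ctype_eqb t TA.
Implicit Types (v : proot -> F) (q : nat) (a : nat -> nat) (s : seq nat).

Section Listing.
Variables (q : nat) (a : nat -> nat) (s s' : seq nat).
Hypothesis s_init : initial_segment gt s.
Hypothesis s'_init : initial_segment lt s'.
Hypothesis size_s : size s = q.
Hypothesis size_s' : size s' = q.
Hypothesis a_s : mkseq a q.*2 = s ++ rev s'.

Let nth_s i : (i < q)%N -> a i = nth 0%N s i.
Proof.
move=> lt_i; rewrite -(nth_mkseq 0%N a (n := q.*2)) ?a_s ?nth_cat ?size_s ?lt_i //.
by rewrite (leq_trans lt_i) // -addnn leq_addr.
Qed.

Let nth_s' i : (i < q)%N -> a (q + i)%N = nth 0%N s' (q.-1 - i).
Proof.
move=> lt_i; rewrite -(nth_mkseq 0%N a (n := q.*2)) ?a_s ?nth_cat ?size_s; last by lia.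
by rewrite ltnNge leq_addr addKn nth_rev ?size_s' //; congr nth; lia.
Qed.

Lemma teval_Delta_A v : teval t prec v (Delta_A F q a) = rev_det q (rect_matrix s s' v).
Proof.
rewrite teval_tdet; congr (\det _); apply/matrixP => i j; rewrite !mxE.
have [lt_i lt_j] := (ltn_ord i, ltn_ord j); have lt_rj : (q.-1 - j < q)%N by lia.
rewrite nth_s // nth_s' // teval_gen //.
by apply: (initial_gt_final gtO s_init s'_init); rewrite mem_nth ?size_s ?size_s'.
Qed.

Lemma letters_Delta_A : letters (rectangle s s') (expand t prec (Delta_A F q a)).
Proof.
apply: letters_tdet => i j; apply: letters_gen.
have [lt_i lt_j] := (ltn_ord i, ltn_ord j); have lt_rj : (q.-1 - j < q)%N by lia.
by rewrite nth_s // nth_s' //= !mem_nth ?size_s ?size_s'.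
Qed.

Lemma Delta_A_invariant : invariant_in t prec (rectangle s s') (Delta_A F q a).
Proof.
split=> [|r v /(valid_A is_A) [x y gt_xy]]; first exact: letters_Delta_A.
have ltO := converse_strict_total_order gtO.
have [ys|nys] := boolP (y \in s).
  have xs := s_init.2 x y ys gt_xy.
  have lt_xy : (index x s < index y s)%N.
    by rewrite -(gt_sorted_nth gtO 0%N s_init.1) ?index_mem ?nth_index.
  apply: ncderiv_coad_eq0_of_flow => u; rewrite -!/(teval _ _ _ _) !teval_Delta_A.
  rewrite -[RHS](rev_det_rowop q u _ lt_xy); apply: eq_rev_det => i j lt_i lt_j.
  rewrite -(rect_matrix_row_flow gtO s_init s'_init) ?lt_xy ?index_mem ?size_s ?size_s' //.
  by rewrite !nth_index.
have [xs'|nxs'] := boolP (x \in s').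
  have ys' := s'_init.2 y x xs' gt_xy.
  have lt_yx : (index y s' < index x s')%N.
    by rewrite -(gt_sorted_nth (gt := lt) ltO 0%N s'_init.1) ?index_mem ?nth_index.
  apply: ncderiv_coad_eq0_of_flow => u; rewrite -!/(teval _ _ _ _) !teval_Delta_A.
  rewrite -[RHS](rev_det_colop q (- u) _ lt_yx); apply: eq_rev_det => i j lt_i lt_j.
  rewrite -(rect_matrix_col_flow gtO s_init s'_init) ?lt_yx ?index_mem ?size_s ?size_s' //.
  by rewrite !nth_index.
rewrite -[RHS](ncderiv0 v (expand t prec (Delta_A F q a))).
apply: (eq_ncderiv letters_Delta_A) => // -[i j|//|//|//] /andP [si s'j].
rewrite coad_PM_PM; have -> : (y == i) = false by apply: contraNF nys => /eqP ->.
have -> : (j == x) = false by apply: contraNF nxs' => /eqP <-.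
by rewrite !mul0r subrr.
Qed.
End Listing.

Lemma is_generator_initial_final q s s' G : initial_segment gt s -> initial_segment lt s' ->
  (q <= size s)%N -> (q <= size s')%N -> is_generator t prec q G ->
  exists2 a, mkseq a q.*2 = take q s ++ rev (take q s') & G = Delta_A F q a.
Proof.
move=> s_init s'_init le_s le_s' [a].
have Nq := Nset_initial_final gtO is_A s_init s'_init le_s le_s'.
suff sorted_ss' : sorted gt (take q s ++ rev (take q s')).
  have := dec_listing_sorted gtO (n := q.*2) (a := a) _ sorted_ss'.
  move: is_A Nq; case: t => // _ Nq listing [a_list ->]; exists a => //.
  by apply: listing a_list _ => x; rewrite mem_cat mem_rev.
have ltO := converse_strict_total_order gtO.
have [sorted_s _] := initial_segment_take gtO q s_init.
have [sorted_s' _] := initial_segment_take (gt := lt) ltO q s'_init.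
rewrite (sorted_pairwise (gt_trans gtO)) pairwise_cat -!(sorted_pairwise (gt_trans gtO)).
rewrite rev_sorted sorted_s sorted_s' !andbT; apply/allrelP => x y /mem_take sx.
by rewrite mem_rev => /mem_take s'y; apply: (initial_gt_final gtO s_init s'_init).
Qed.
End RectangleGenerators.

Section RectangleSlice.
Variables (F : numClosedFieldType) (t : ctype) (prec : rel sel).
Local Notation gt := (gtth t prec).
Local Notation lt := (fun i j => gtth t prec j i).
Hypothesis gtO : strict_total_order gt.
Hypothesis is_A : ctype_eqb t TA.
Variables s s' : seq nat.
Hypothesis s_init : initial_segment gt s.
Hypothesis s'_init : initial_segment lt s'.
Local Notation rectangle := (rectangle s s').
Local Notation rect_values := (@rect_values F s s').
Implicit Types (d : nat -> F) (r : proot) (T : ncpoly F).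

Definition rect_slice_coef r : F := if rectangle r then rect_values (diagm (fun=> 1)) r else 0.
Definition rect_slice_index r : nat := index (head 0%N (root_support r)) s.
Local Notation slice d := (slice_point rect_slice_coef rect_slice_index d).

Lemma rect_slice_pointE d r : rectangle r -> slice d r = rect_values (diagm d) r.
Proof.
move=> Qr; rewrite /slice_point /rect_slice_coef Qr /rect_slice_index.
case: r {Qr} => [i j|i j|i|i] /=; rewrite ?mul0r // /diagm.
by case: eqP => _; rewrite ?mul1r ?mul0r.
Qed.

Lemma nceval_rect_slice d T : letters rectangle T -> ev (slice d) T = ev (rect_values (diagm d)) T.
Proof. by move=> QT; apply: (eq_nceval QT) => r; apply: rect_slice_pointE. Qed.

Lemma rect_slice_index_lt r :
  rect_slice_coef r != 0 -> (rect_slice_index r < minn (size s) (size s'))%N.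
Proof.
rewrite /rect_slice_coef; case: ifP => [|_]; last by rewrite eqxx.
case: r => [x y|//|//|//] /andP [sx s'y]; rewrite /= /diagm /rect_slice_index /=.
case: (index x s =P _) => [eq_xy _|_]; last by rewrite eqxx.
by rewrite leq_min {2}eq_xy !index_mem sx s'y.
Qed.

Variable G : nat -> term F.
Hypothesis G_gen : forall q, (0 < q)%N -> cascade_ge t prec q -> is_generator t prec q (G q).

Lemma rect_generatorP i : (i < minn (size s) (size s'))%N ->
  exists2 a, mkseq a i.+1.*2 = take i.+1 s ++ rev (take i.+1 s') & G i.+1 = Delta_A F i.+1 a.
Proof.
rewrite leq_min => /andP [le_s le_s'].
have casc := cascade_ge_initial_final gtO is_A s_init s'_init le_s le_s'.
exact (is_generator_initial_final gtO is_A s_init s'_init le_s le_s' (G_gen (ltn0Sn i) casc)).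
Qed.

Lemma rect_generator_in_slice i : (i < minn (size s) (size s'))%N ->
  invariant_in t prec rectangle (G i.+1).
Proof.
move=> lt_i; have [a a_s ->] := rect_generatorP lt_i.
move: lt_i; rewrite leq_min => /andP [le_s le_s'].
have ltO := converse_strict_total_order gtO.
have [letters_G G_inv] := Delta_A_invariant F gtO is_A (initial_segment_take gtO i.+1 s_init)
  (initial_segment_take (gt := lt) ltO i.+1 s'_init) (size_takel le_s) (size_takel le_s') a_s.
split=> //; apply: letters_subset letters_G => -[x y|//|//|//] /andP [sx s'y].
by apply/andP; split; [apply: mem_take sx|apply: mem_take s'y].
Qed.

Lemma rect_generator_on_slice i d : (i < minn (size s) (size s'))%N ->
  teval t prec (slice d) (G i.+1) = rev_det i.+1 (diagm d).
Proof.
move=> lt_i; have [letters_G _] := rect_generator_in_slice lt_i.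
rewrite /teval nceval_rect_slice // -/(teval t prec _ (G i.+1)).
have [a a_s ->] := rect_generatorP lt_i.
move: lt_i; rewrite leq_min => /andP [le_s le_s'].
have ltO := converse_strict_total_order gtO.
rewrite (teval_Delta_A gtO is_A (initial_segment_take gtO i.+1 s_init)
  (initial_segment_take (gt := lt) ltO i.+1 s'_init) (size_takel le_s) (size_takel le_s') a_s).
apply: eq_rev_det => k l lt_k lt_l; rewrite /rect_matrix !nth_take // -/(rect_matrix s s' _ k l).
by rewrite (rect_matrix_rect_values gtO s_init s'_init) ?(leq_trans _ le_s) ?(leq_trans _ le_s').
Qed.

Lemma rect_generic_slice : generic_slice t prec G (minn (size s) (size s'))
  rectangle rect_slice_coef rect_slice_index (fun i => (-1) ^+ rev_perm i.+1).
Proof.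
split.
- exact: rectangle_ideal.
- exact: rect_slice_index_lt.
- exact: rect_generator_in_slice.
- by move=> i; rewrite signr_eq0.
- by move=> i d lt_i; rewrite rect_generator_on_slice // rev_det_diagm.
- move=> T QT T_inv T0 v.
  rewrite (nceval_rect_matrix QT (X := rect_matrix s s' v)) //.
  apply: (rect_eq0_of_diag (p := size s) (m := size s')
    (f := fun X => ev (rect_values X) T)) => [X Y|a c X|a c X||d].
  + exact: (rect_values_local gtO s_init s'_init QT).
  + exact: (rect_values_rowop gtO is_A s_init s'_init QT T_inv).
  + exact: (rect_values_colop gtO is_A s_init s'_init QT T_inv).
  + exact: rect_values_polynomial.
  + by rewrite -nceval_rect_slice.
- move=> T QT T_inv q d; rewrite leq_min => /andP [lt_s lt_s'] d0.
  have single_supp n u : (q.+1 < n)%N -> forall i, single q.+1 u i != 0 :> F -> (q < i < n)%N.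
    by move=> lt_n i; rewrite /single; case: (i =P _) => [->|_]; rewrite ?ltnSn ?eqxx.
  have f_cong u X (_ : sign_symmetric 1 X) :
      ev (rect_values (cong q (single q.+1 u) X)) T = ev (rect_values X) T.
    rewrite cong_colop_rowop.
    rewrite (rect_values_colop gtO is_A s_init s'_init QT T_inv) ?(rect_values_rowop gtO) //.
      exact: single_supp.
    exact: single_supp.
  have [p pE] := symmetric_torus_regular (rect_values_polynomial s s' T) f_cong d0.
  by exists p => u u0; rewrite nceval_rect_slice // pE.
Qed.
End RectangleSlice.

Lemma rectangle_reduces_to (F : numFieldType) t prec (M s s' : seq nat) :
  strict_total_order (gtth t prec) -> ctype_eqb t TA ->
  (forall x, x \in M -> x \notin s -> exists2 k, k \notin M & gtth t prec k x) ->
  (forall x, x \in M -> x \notin s' -> exists2 k, k \notin M & gtth t prec x k) ->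
  reduces_to F t prec (rectangle s s') (roots_in t prec M).
Proof.
move=> gtO is_A s_max s'_min T MT T_inv; apply: (nceval_filter_of_partial MT) => r Mr nQr v.
have /andP [/(valid_A is_A) r_diff _] := Mr; case: r / r_diff Mr nQr => i j gt_ij Mr nQr.
have [iM jM] : i \in M /\ j \in M by case/andP: Mr => _ /= /and3P [].
move: nQr; rewrite /= negb_and => /orP [/(s_max _ iM)|/(s'_min _ jM)] [k nMk gt_k].
  have neq_jk : j != k by apply: contraNneq nMk => <-.
  apply: (partial_eq0_of_bracket gtO MT T_inv (r := PM k i) (s1 := PM k j) (c0 := 1) gt_k _ nMk Mr).
  - exact: mem_head.
  - by rewrite /= eqxx (negbTE neq_jk).
  - exact: oner_neq0.
have neq_ki : k != i by apply: contraNneq nMk => ->.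
apply: (partial_eq0_of_bracket gtO MT T_inv (r := PM j k) (s1 := PM i k) (c0 := -1) gt_k _ nMk Mr).
- by rewrite !inE eqxx orbT.
- by rewrite /= eqxx (negbTE neq_ki).
- by rewrite oppr_eq0 oner_neq0.
Qed.

(** * The center *)

Section Center.
Variables (F : numClosedFieldType) (t : ctype) (prec : rel sel).
Local Notation gt := (gtth t prec).
Hypothesis gtO : strict_total_order gt.
Variable G : nat -> term F.
Hypothesis G_gen : forall q, (0 < q)%N -> cascade_ge t prec q -> is_generator t prec q (G q).

Lemma cascade_generic_slice k : cascade_ge t prec k ->
  exists Q kap lam c, generic_slice t prec G k Q kap lam c.
Proof.
have [is_A|not_A] := boolP (ctype_eqb t TA).
  case/(initial_final_of_cascade_ge gtO is_A) => s [s' [s_init s'_init size_s size_s']].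
  have := rect_generic_slice gtO is_A s_init s'_init G_gen.
  by rewrite size_s size_s' minnn => sliceP; do 4!eexists; apply: sliceP.
case/(initial_of_cascade_ge gtO not_A) => s s_init size_s.
have [c] := form_generic_slice gtO not_A s_init G_gen.
by rewrite size_s mulnK ?step_size_gt0 // => sliceP; do 4!eexists; apply: sliceP.
Qed.

Lemma reducing_slice (M : seq nat) : exists k Q kap lam c, [/\ cascade_ge t prec k,
  generic_slice t prec G k Q kap lam c & reduces_to F t prec Q (roots_in t prec M)].
Proof.
have [s s_init s_max] := maximal_initial_segment gtO M.
have [is_A|not_A] := boolP (ctype_eqb t TA); last first.
  have [c sliceP] := form_generic_slice gtO not_A s_init G_gen.
  do 5!eexists; split; [|exact: sliceP|exact: form_reduces_to].
  by apply: (cascade_ge_initial gtO not_A s_init); apply: leq_trunc_div.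
have [s' s'_init s'_min] := maximal_initial_segment (converse_strict_total_order gtO) M.
do 5!eexists; split.
- exact: (cascade_ge_initial_final gtO is_A s_init s'_init (geq_minl _ _) (geq_minr _ _)).
- exact: (rect_generic_slice gtO is_A s_init s'_init G_gen).
- exact: rectangle_reduces_to.
Qed.

Lemma cascade_generator_central q : (0 < q)%N -> cascade_ge t prec q -> central t prec (G q).
Proof.
case: q => // q _ /cascade_generic_slice [Q [kap [lam [c sliceP]]]]; apply/centralP => x.
exact: (invariant_in_central gtO (slice_ideal sliceP) x (slice_generator sliceP (ltnSn q))).
Qed.

Lemma center_generated z : central t prec z -> exists k, cascade_ge t prec k /\
  exists p : {mpoly F[k]}, equ t prec z (ueval p (fun j : 'I_k => G j.+1)).
Proof.
move=> /centralP z_central; pose T := expand t prec z.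
pose M := flatten [seq root_support r | r <- flatten [seq e.2 | e <- T]].
have [k [Q [kap [lam [c [k_casc sliceP Q_red]]]]]] := reducing_slice M.
exists k; split=> //; have M_valid : {subset roots_in t prec M <= valid t prec}.
  by move=> r /andP [].
have MT : letters (roots_in t prec M) T.
  apply/allP => e Te; apply/allP => r e_r; apply/andP; split.
    exact: (allP (allP (expand_valid t prec z) _ Te)).
  apply/allP => x r_x; apply/flattenP; exists (root_support r) => //; apply: map_f.
  by apply/flattenP; exists e.2 => //; apply: map_f.
have szT : all (fun e => size e.2 < (\max_(e <- T) size e.2).+1)%N T.
  apply/allP => e Te; rewrite ltnS.
  exact: (leq_bigmax_seq (P := xpredT) (F := fun e => size e.2) _ Te isT).
have [x|p pE] := central_is_polynomial gtO sliceP M_valid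
  (@roots_in_closed F t prec gtO M) Q_red MT szT; first by rewrite env_ncpoly_expand.
by exists p; apply/env_ofP; rewrite -pE env_ncpoly_expand.
Qed.

Lemma cascade_generators_independent k (p : {mpoly F[k]}) : cascade_ge t prec k ->
  equ t prec (ueval p (fun j : 'I_k => G j.+1)) (Tc 0) -> p = 0.
Proof.
case/cascade_generic_slice => Q [kap [lam [c sliceP]]] /env_ofP p0.
by apply: (generators_alg_independent gtO sliceP); rewrite p0 env_of0.
Qed.
End Center.

Theorem theorem2p6 (R : realType) (t : ctype) (prec : rel sel)
  (Hadm : admissible t prec) (G : nat -> term R[i])
  (HG : forall q, (0 < q)%N -> cascade_ge t prec q ->
          is_generator t prec q (G q)) :
  (forall q, (0 < q)%N -> cascade_ge t prec q -> central t prec (G q)) /\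
  (forall z, central t prec z ->
     exists k, cascade_ge t prec k /\
       exists p : {mpoly R[i][k]},
         equ t prec z (ueval p (fun j : 'I_k => G j.+1))) /\
  (forall (k : nat) (p : {mpoly R[i][k]}), cascade_ge t prec k ->
     equ t prec (ueval p (fun j : 'I_k => G j.+1)) (Tc 0) -> p = 0).
Proof.
have gtO := admissible_strict_total_order Hadm; split; [|split].
- exact: (cascade_generator_central gtO HG).
- exact: (center_generated gtO HG).
- exact: (cascade_generators_independent gtO HG).
Qed.
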